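(* If $\alpha\in[0,1)$, then the generalized Grushin plane $\mathbb{G}_{\alpha}$ is bi-Lipschitz homeomorphic to $\mathbb{R}^2$ with the Euclidean metric.
   Context: Generalized Grushin plane: for real $\alpha\ge 0$, $\mathbb{G}_\alpha$ is the set $\mathbb{R}^2$ equipped with the Carnot–Carathéodory metric $d_{\mathbb{G}_\alpha}$ generated by the vector fields $X_1=\partial_{x_1}$ and $X_2=|x_1|^{\alpha}\partial_{x_2}$, that is, $$d_{\mathbb{G}_\alpha}(p,q)=\inf_\gamma\int_0^1\sqrt{x_1'(t)^2+\frac{x_2'(t)^2}{|x_1(t)|^{2\alpha}}}\,dt,$$ where the infimum is over all paths $\gamma=(x_1(t),x_2(t)):[0,1]\to\mathbb{R}^2$ with $\gamma(0)=p$, $\gamma(1)=q$ that are absolutely continuous in the Euclidean metric. Conventions: $|x_1|^{0}=1$ (so $\mathbb{G}_0$ is the Euclidean plane); for $\alpha>0$, at times $t$ with $x_1(t)=0$ the quotient $x_2'(t)^2/|x_1(t)|^{2\alpha}$ is read as $0$ if $x_2'(t)=0$ and as $+\infty$ otherwise. A map $f:X\to Y$ between metric spaces is bi-Lipschitz if there is $L\ge1$ with $L^{-1}d_X(x,y)\le d_Y(f(x),f(y))\le L\,d_X(x,y)$ for all $x,y\in X$. Two metric spaces are bi-Lipschitz homeomorphic if there is a bi-Lipschitz map from one onto the other. *)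

(* Defs.v *)
From mathcomp Require Import all_boot all_order all_algebra.
From mathcomp Require Import all_classical all_reals all_analysis.

Set Implicit Arguments.
Unset Strict Implicit.
Unset Printing Implicit Defensive.
Import Order.TTheory GRing.Theory Num.Theory.
Import numFieldNormedType.Exports.

Local Open Scope classical_set_scope.
Local Open Scope ring_scope.

(* The norm that the library puts on R * R is the maximum norm. *)
Definition euclidean_dist (R : realType) (p q : R * R) : R :=
  Num.sqrt ((p.1 - q.1) ^+ 2 + (p.2 - q.2) ^+ 2).

(* Paths are total functions on R; only their values on [0, 1] matter.
   An empty interval `]a k, b k[ (a k = b k) contributes 0 to both sums. *)
Definition abs_continuous_path (R : realType) (g : R -> R * R) : Prop :=
  forall e : R, 0 < e -> exists2 d : R, 0 < d &
    forall (n : nat) (a b : 'I_n -> R),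
      (forall k, 0 <= a k /\ a k <= b k /\ b k <= 1) ->
      trivIset [set: 'I_n] (fun k => `]a k, b k[%classic) ->
      \sum_(k < n) (b k - a k) < d ->
      \sum_(k < n) euclidean_dist (g (a k)) (g (b k)) < e.

(* Since 0 `^ 0 = 1 and 0 `^ r = 0 for r != 0, the first branch is taken
   exactly when x = 0 and alpha != 0. *)
Definition grushin_quotient (R : realType) (alpha x v : R) : \bar R :=
  if `|x| `^ (2 * alpha) == 0 then (if v == 0 then 0%E else +oo%E)
  else (v ^+ 2 / `|x| `^ (2 * alpha))%:E.

(* An absolutely continuous path is differentiable almost everywhere on
   [0, 1], so the junk value of the derivative elsewhere is irrelevant, and so
   are the values of g outside [0, 1]. *)
Definition grushin_length (R : realType) (alpha : R) (g : R -> R * R)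
    : \bar R :=
  let x1 t := (g t).1 in
  let x2 t := (g t).2 in
  (\int[@lebesgue_measure R]_(t in `[0%R, 1%R])
     sqrte ((derive1 x1 t ^+ 2)%:E + grushin_quotient alpha (x1 t) (derive1 x2 t)))%E.

Definition grushin_dist (R : realType) (alpha : R) (p q : R * R) : \bar R :=
  ereal_inf [set grushin_length alpha g | g in
    [set g : R -> R * R | [/\ abs_continuous_path g, g 0 = p & g 1 = q]]].

(* Distances are extended real numbers because an infimum of lengths is. *)
Definition bilipschitz (R : realType) (X Y : Type)
    (dX : X -> X -> \bar R) (dY : Y -> Y -> \bar R) (f : X -> Y) : Prop :=
  exists2 L : R, 1 <= L & forall x y : X,
    ((L^-1)%:E * dX x y <= dY (f x) (f y))%E /\
    (dY (f x) (f y) <= L%:E * dX x y)%E.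

Definition bilipschitz_homeomorphic (R : realType) (X Y : Type)
    (dX : X -> X -> \bar R) (dY : Y -> Y -> \bar R) : Prop :=
  exists f : X -> Y, bilipschitz dX dY f /\ set_surj [set: X] [set: Y] f.

(* Main.v *)
From HB Require Import structures.
Require Import Defs.
From mathcomp Require Import all_boot all_order all_algebra.
From mathcomp Require Import all_classical all_reals all_analysis.
From mathcomp Require Import measurable_realfun ring lra zify.
Import Order.TTheory GRing.Theory Num.Theory.
Import numFieldNormedType.Exports HBNNSimple.
Set Implicit Arguments.
Unset Strict Implicit.
Unset Printing Implicit Defensive.
Local Open Scope classical_set_scope.
Local Open Scope ring_scope.

(** Why the theorem holds.

    A Grushin length has a simple substitute.  Call a pair of points p, q
    admissible for L when the first coordinates differ by at most L and the
    second ones by at most (|p.1| + L)^alpha L.  A path of length L joins only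
    admissible points, because its first coordinate stays below |p.1| + L in
    absolute value ([length_admissible]); and admissible points are joined by
    a path of length at most 6 L that moves away from the axis by L, shifts the second
    coordinate there and moves back ([admissible_dist]).  The first fact needs
    that an absolutely continuous function is an integral of its derivative
    ([ac_density], by the variation, its Stieltjes measure and the
    Radon-Nikodym theorem; then Lebesgue differentiation).

    So it is enough to find a map of the plane onto itself that turns
    admissibility into Euclidean distance.  On the axis, admissibility for L
    means |x2 - y2| <= L^(1 + alpha): the axis has to go to a snowflake of
    dimension 1 + alpha, which the plane has room for because alpha < 1.
    The snowflake here is the symmetric Koch-like curve that consists of two
    copies of itself scaled by s, where s^(1 + alpha) = 1/2.  The copies are
    laid along the equal sides of the triangle of basis 1 and height k / 2,
    4 s^2 = 1 + k^2, and s^2 < 1/2 means that its apex angle is more than a right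
    one.

    One half of this curve is surrounded by a quadrilateral, [box], in which
    the two folds [fold0] and [fold1], similarities of ratio s, place two
    smaller copies.  In coordinates (t, v), where t is the parameter of the
    curve and |v| a distance to it, [koch] maps [0, 1] x [-1, 1] onto the box:
    the part s <= |v| is sent to the room left by the small boxes by explicit
    formulas ([tile]), and the part |v| <= s is folded, one half of the t-axis
    into each small box.  A fold halves t and multiplies distances by s, so
    that at depth |v| about s^n horizontal distances are multiplied by
    (2 s)^n, which is s^(- alpha n), about |v|^(- alpha): this is
    admissibility ([koch_lip]).

    For the lower bound, a segment of the box is cut where it passes from one
    piece to another; in a piece the estimate is the one for tiles, scaled
    ([split_pieces], [koch_tame]).  This reduces everything to segments that
    come close to the curve.  There one uses that the distance to the curve is
    at least of the order of |v| ([koch_separation]: a mirror image in the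
    axis between the two halves brings a point closer) and that the
    curve is a snowflake ([curve_colip]).  The result is [koch_colip].

    Finally [fold1] has a fixed point inside the box, and blowing up [koch]
    there gives a map of the whole plane, [plane], with the same bounds at all
    scales.  Its image is dense by construction, and complete by the lower
    bound ([plane_surj]).
*)



(** * Absolutely continuous functions are integrals *)

Definition dyad (R : realType) (m k : nat) : R := k%:R / 2 ^+ m.

(** Absolute continuity tested only on unions of dyadic intervals of one level:
    such unions exhaust an open set from inside, and they are what a variation
    along dyadic subdivisions can be estimated on. *)
Definition dyadic_ac (R : realType) (f : R -> R) : Prop :=
  forall e : R, 0 < e -> exists2 d : R, 0 < d &
    forall (m : nat) (P : pred nat),
      \sum_(k < 2 ^ m | P k) (2 ^+ m)^-1 < d ->
      \sum_(k < 2 ^ m | P k) `|f (dyad R m k.+1) - f (dyad R m k)| <= e.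

Section Dyad.
Variable R : realType.
Implicit Types (m k : nat) (x : R).

Lemma dyad_gt0 m : 0 < 2 ^+ m :> R. Proof. exact: exprn_gt0. Qed.

Lemma dyadS m k : dyad R m k.+1 = dyad R m k + (2 ^+ m)^-1.
Proof. by rewrite /dyad -natr1 mulrDl mul1r. Qed.

Lemma dyad_le m k l : (k <= l)%N -> dyad R m k <= dyad R m l.
Proof. by move=> kl; rewrite ler_pM2r ?invr_gt0 ?dyad_gt0// ler_nat. Qed.

Lemma dyad_ge0 m k : 0 <= dyad R m k.
Proof. by rewrite divr_ge0// ltW// dyad_gt0. Qed.

Lemma dyad_le1 m k : (k <= 2 ^ m)%N -> dyad R m k <= 1.
Proof. by move=> kl; rewrite ler_pdivrMr ?dyad_gt0// mul1r -natrX ler_nat. Qed.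

Lemma dyad_double m k : dyad R m.+1 k.*2 = dyad R m k.
Proof.
by rewrite /dyad -muln2 natrM exprS [2 * _]mulrC -mulf_div divff ?mulr1// pnatr_eq0.
Qed.

Lemma inv2m_lt (e : R) : 0 < e -> exists m0, forall m, (m0 <= m)%N -> (2 ^+ m)^-1 < e.
Proof.
move=> e0; have [m0 h] : exists m0, (2 ^+ m0)^-1 < e.
  exists (Num.truncn e^-1).+1; rewrite -[ltRHS]invrK ltf_pV2 ?posrE ?invr_gt0 ?dyad_gt0//.
  apply: (@lt_le_trans _ _ (Num.truncn e^-1).+1%:R).
    by rewrite truncnS_gt.
  by rewrite -natrX ler_nat ltnW// ltn_expl.
exists m0 => m mm; apply: le_lt_trans h.
by rewrite lef_pV2 ?posrE ?dyad_gt0// ler_weXn2l// ler1n.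
Qed.
End Dyad.

Section MonotoneDensity.
Variables (R : realType) (phi : cumulative R R).
Hypothesis hac : dyadic_ac phi.
Let nu := lebesgue_stieltjes_measure phi.

Let nuE (a b : R) : a <= b -> nu `]a, b]%classic = (phi b - phi a)%:E.
Proof.
move=> ab; rewrite /nu /lebesgue_stieltjes_measure /measure_extension.
rewrite measurable_mu_extE/=; last exact: is_ocitv.
by rewrite wlength_itv_bnd.
Qed.

Let D (m k : nat) : set R := `]dyad R m k, dyad R m k.+1]%classic.

Let D_disj (m : nat) : trivIset setT (D m).
Proof.
apply/trivIsetP => i j _ _; wlog ij : i j / (i < j)%N.
  move=> h; rewrite neq_ltn => /orP[] ij.
    by apply: h => //; rewrite ltn_eqF.
  by rewrite setIC; apply: h => //; rewrite ltn_eqF.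
move=> _; rewrite -subset0 => x []; rewrite /D /= !in_itv/= => /andP[_ a] /andP[b _].
by have := lt_le_trans b a; rewrite ltNge dyad_le.
Qed.

Let DU (m : nat) (P : pred nat) : set R := \big[setU/set0]_(k < 2 ^ m | P k) D m k.

Let DUE m P (mu : {measure set (measurableTypeR R) -> \bar R}) :
  mu (DU m P) = (\sum_(k < 2 ^ m | P k) mu (D m k))%E.
Proof.
apply: measure_bigsetU_ord; first by move=> i; exact: measurable_itv.
apply/trivIsetP => i j _ _ ij; have /trivIsetP := @D_disj m; exact.
Qed.

Let DUP m P x : DU m P x <-> exists k, [/\ (k < 2 ^ m)%N, P k & D m k x].
Proof.
rewrite /DU big_mkcond/= -(bigcup_mkord _ (fun k => if P k then D m k else set0)); split.
  by move=> [k /= km]; case: ifP => // Pk Dx; exists k.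
by move=> [k [km Pk Dx]]; exists k => //=; rewrite Pk.
Qed.

Let D_split m k x : D m k x -> D m.+1 k.*2 x \/ D m.+1 k.*2.+1 x.
Proof.
rewrite /D /= !in_itv/= -doubleS !dyad_double => /andP[a b].
have [c|c] := leP x (dyad R m.+1 k.*2.+1); first by left; rewrite a.
by right.
Qed.

Let D_sub1 m k : D m.+1 k.*2 `<=` D m k.
Proof.
move=> x; rewrite /D /= !in_itv/= dyad_double => /andP[-> b] /=.
by apply: le_trans b _; rewrite -[leRHS]dyad_double dyad_le// doubleS.
Qed.

Let D_sub2 m k : D m.+1 k.*2.+1 `<=` D m k.
Proof.
move=> x; rewrite /D /= !in_itv/= -doubleS dyad_double => /andP[b ->].
by rewrite andbT; apply: le_lt_trans b; rewrite -dyad_double dyad_le.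
Qed.

Let lebD m k : lebesgue_measure (D m k) = ((2 ^+ m)^-1)%:E.
Proof.
rewrite /D lebesgue_measure_itv/= lte_fin dyadS ltrDl invr_gt0 dyad_gt0.
by rewrite -EFinB addrAC subrr add0r.
Qed.

(** A null set lies in an open set of small measure, and the dyadic intervals
    contained in this open set cover it up to an increasing union. *)
Let nu_null (A : set R) : measurable A -> lebesgue_measure A = 0%E ->
  nu (A `&` `]0, 1]%classic) = 0%E.
Proof.
move=> mA A0; apply/eqP; rewrite eq_le measure_ge0 andbT.
apply/lee_addgt0Pr => e e0; rewrite add0e.
have [d d0 hd] := hac e0.
have [U [oU AU muU]] : exists U : set R, [/\ open U, A `<=` U &
    (lebesgue_measure U < d%:E)%E].
  have [|U [oU AU h]] := @lebesgue_regularity_outer R A d mA _ d0.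
    by have Aoo : (lebesgue_measure A < +oo)%E by [rewrite A0 ltry]; exact: Aoo.
  exists U; split => //; apply: le_lt_trans h.
  have mU : measurable U by exact: open_measurable.
  have {1}-> : U = A `|` (U `\` A) by rewrite setDUK.
  have dj : A `&` (U `\` A) = set0 by apply/seteqP; split => // x [Ax []].
  have E : (lebesgue_measure (A `|` (U `\` A)) = 0 + lebesgue_measure (U `\` A))%E.
    by rewrite -A0; exact: (measureU lebesgue_measure mA (measurableD mU mA) dj).
  by rewrite E add0e.
have mU : measurable (U : set (measurableTypeR R)) by exact: open_measurable.
pose P m : pred nat := fun k => `[< D m k `<=` U >].
pose F m := DU m (P m).
have mF m : measurable (F m : set (measurableTypeR R)).
  by apply: bigsetU_measurable => i _; exact: measurable_itv.
have FU m : F m `<=` U by move=> x /DUP[k [_ /asboolP h Dx]]; exact: h.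
have muF m : (\sum_(k < 2 ^ m | P m k) (2 ^+ m)^-1 < d)%R.
  rewrite -lte_fin; apply: le_lt_trans muU.
  have h1 : (lebesgue_measure (F m) <= lebesgue_measure U)%E.
    by apply: (le_measure lebesgue_measure) => //; rewrite inE.
  have h2 : lebesgue_measure (F m) = _ := DUE m (P m) lebesgue_measure.
  rewrite h2 in h1; apply: le_trans h1.
  rewrite -sumEFin; apply: lee_sum => k _.
  have hD : (((2 ^+ m)^-1)%:E <= lebesgue_measure (D m k))%E by rewrite lebD.
  exact: hD.
have nuF m : (nu (F m) <= e%:E)%E.
  have h2 : nu (F m) = _ := DUE m (P m) nu.
  rewrite h2; have /= := hd m _ (muF m); rewrite -lee_fin; apply: le_trans.
  rewrite -sumEFin; apply: lee_sum => k _.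
  have hD : (nu (D m k) <= `|phi (dyad R m k.+1) - phi (dyad R m k)|%:E)%E.
    by rewrite /D nuE ?dyad_le// lee_fin ler_norm.
  exact: hD.
have ndF : nondecreasing_seq F.
  apply/nondecreasing_seqP => m; apply/subsetPset => x /DUP[k [km /asboolP Pk Dx]].
  apply/DUP; have [h|h] := D_split Dx.
    exists k.*2; rewrite expnS mul2n ltn_double km; split => //.
    by apply/asboolP; apply: subset_trans Pk; exact: D_sub1.
  exists k.*2.+1; rewrite expnS mul2n ltn_Sdouble km; split => //.
  by apply/asboolP; apply: subset_trans Pk; exact: D_sub2.
have mUF : measurable (\bigcup_n F n : set (measurableTypeR R)).
  exact: bigcup_measurable.
have AF : A `&` `]0, 1] `<=` \bigcup_n F n.
  move=> x [/AU Ux]; rewrite /= in_itv/= => /andP[x0 x1].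
  have [r r0 hr] : exists2 r : R, 0 < r & ball x r `<=` U.
    by have /nbhs_ballP[r /= r0 hr] := open_nbhs_nbhs (conj oU Ux); exists r.
  have [m hm] := inv2m_lt r0; exists m => //; apply/DUP.
  have := hm m (leqnn m) => {}hm.
  have hx : (0 <= Num.ceil (x * 2 ^+ m)).
    by rewrite -(ler_int R) (le_trans _ (ceil_ge _))// mulr_ge0// ltW// dyad_gt0.
  have ch : (0 < Num.ceil (x * 2 ^+ m)).
    by rewrite -(ltr_int R) (lt_le_trans _ (ceil_ge _))// mulr_gt0// dyad_gt0.
  case: (Num.ceil _) ch (ceil_ge (x * 2 ^+ m)) (ceilB1_lt (x * 2 ^+ m)) => // -[//|k] _ h1 h2.
  have Dx : D m k x.
    rewrite /D /= in_itv/= ltr_pdivrMr ?dyad_gt0// ler_pdivlMr ?dyad_gt0//.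
    rewrite -pmulrn in h1; rewrite h1 andbT.
    have -> : k%:R = (Posz k.+1 - 1)%:~R :> R by rewrite rmorphB/= -pmulrn -natr1 addrK.
    exact: h2.
  exists k; split => //.
    rewrite -(ltr_nat R) natrX; move: Dx; rewrite /D /= in_itv/= => /andP[+ _].
    rewrite ltr_pdivrMr ?dyad_gt0// => /lt_le_trans; apply.
    by rewrite -[leRHS]mul1r ler_pM2r ?dyad_gt0.
  apply/asboolP => y Dy; apply: hr; rewrite -ball_normE/= ltr_distlC.
  move: Dx Dy; rewrite /D /= !in_itv/= dyadS; lra.
apply: (@le_trans _ _ (nu (\bigcup_n F n))).
  apply: (le_measure nu) => //; rewrite inE//; apply: measurableI => //.
have cv := nondecreasing_cvg_mu (mu := nu) mF mUF ndF.
by apply: (@cvge_to_le _ _ _ _ _ _ _ cv); near=> n; exact: nuF.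
Unshelve. all: by end_near. Qed.

(** The Stieltjes measure of phi vanishes on the Lebesgue null sets, so the
    density is a Radon-Nikodym derivative. *)
Lemma monotone_ac_density : exists g : R -> R,
  [/\ forall x, 0 <= g x, lebesgue_measure.-integrable setT (EFin \o g) &
   forall x, 0 <= x <= 1 ->
     (phi x - phi 0)%:E = (\int[lebesgue_measure]_(t in `]0%R, x]) (g t)%:E)%E].
Proof.
have m01 : measurable (`]0, 1]%classic : set (measurableTypeR R)).
  exact: measurable_itv.
have oo01 : (nu `]0%R, 1%R]%classic < +oo)%E by rewrite nuE ?ltry.
pose nu1 : {finite_measure set (measurableTypeR R) -> \bar R} := mfrestr m01 oo01.
have dom : nu1 `<< lebesgue_measure.
  by apply/null_content_dominatesP => A mA A0; exact: nu_null.
have [f [f0 ffin fint fE]] := radon_nikodym_sigma_finite dom.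
have fg : EFin \o (fine \o f) = f.
  by apply/funext => x /=; rewrite fineK.
exists (fine \o f); split.
- by move=> x /=; rewrite fine_ge0.
- by rewrite fg.
- move=> x /andP[x0 x1].
  rewrite -(nuE x0); transitivity (nu1 `]0, x]%classic).
    rewrite /nu1/= /mfrestr /mrestr; congr (nu _); apply/seteqP; split => y /=.
      rewrite !in_itv/= => /andP[-> yx]; rewrite yx; split => //=.
      exact: le_trans yx x1.
    by case.
  rewrite fE; last exact: measurable_itv.
  by apply: eq_integral => y _; rewrite /= fineK.
Qed.
End MonotoneDensity.

Lemma big_nat_blocks (R : zmodType) (h : nat -> R) (N L : nat) :
  \sum_(0 <= j < N * L) h j =
  \sum_(0 <= k < N) \sum_(k * L <= j < k.+1 * L) h j.
Proof.
elim: N => [|N IH]; first by rewrite mul0n !big_geq.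
rewrite big_nat_recr//= -IH (@big_cat_nat _ _ _ (N * L))//.
by rewrite leq_mul2r leqnSn orbT.
Qed.

Section Variation.
Variables (R : realType) (f : R -> R).
Hypothesis hac : dyadic_ac f.
Hypothesis hc : forall e : R, 0 < e -> exists2 d : R, 0 < d &
  forall a b : R, 0 <= a -> a <= b -> b <= 1 -> b - a < d -> `|f b - f a| < e.

Let del m k : R := `|f (dyad R m k.+1) - f (dyad R m k)|.
Let fl m (x : R) := Num.truncn (x * 2 ^+ m).
Let W m x : R := \sum_(0 <= k < fl m x) del m k.

(** [W m x] only counts the dyadic intervals of level m to the left of x, hence
    its dependence on x is not continuous; the supremum over m is. *)
Definition variation x : R := sup (range (W ^~ x)).
Let V := variation.

Let fl_dyad m n k : fl (m + n) (dyad R n k) = (k * 2 ^ m)%N.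
Proof.
rewrite /fl; have -> : dyad R n k * 2 ^+ (m + n) = (k * 2 ^ m)%:R.
  by rewrite natrM natrX /dyad addnC exprD mulrA divfK ?gt_eqF ?dyad_gt0.
by apply: truncn_def; rewrite lexx ltr_nat ltnSn.
Qed.

Let fl_itv m x : 0 <= x -> dyad R m (fl m x) <= x < dyad R m (fl m x).+1.
Proof.
move=> x0; have /truncn_itv/andP[a b] : 0 <= x * 2 ^+ m by rewrite mulr_ge0// ltW// dyad_gt0.
by rewrite ler_pdivrMr ?dyad_gt0// a ltr_pdivlMr ?dyad_gt0.
Qed.

Let fl_le1 m x : 0 <= x <= 1 -> (fl m x <= 2 ^ m)%N.
Proof.
move=> /andP[x0 x1]; rewrite -(ler_nat R) natrX.
have /andP[+ _] := fl_itv m x0; rewrite ler_pdivrMr ?dyad_gt0// => /le_trans; apply.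
by rewrite -[leRHS]mul1r ler_pM2r ?dyad_gt0.
Qed.

Let fl_mono m x y : 0 <= x -> x <= y -> (fl m x <= fl m y)%N.
Proof.
move=> x0 xy; apply: le_truncn.
by rewrite ler_pM2r ?dyad_gt0.
Qed.

Let del_ge0 m k : 0 <= del m k. Proof. exact: normr_ge0. Qed.

Let sum_del_mono m a b c d : (c <= a)%N -> (b <= d)%N ->
  \sum_(a <= k < b) del m k <= \sum_(c <= k < d) del m k.
Proof.
move=> ca bd; have [ab|ba] := leqP a b; last first.
  by rewrite big_geq ?(ltnW ba)// sumr_ge0.
rewrite (@big_cat_nat _ _ _ a c d)//=; last exact: leq_trans bd.
rewrite (@big_cat_nat _ _ _ b a d)//= addrCA lerDl addr_ge0// sumr_ge0//.
Qed.

Let W_monoS m x : 0 <= x -> W m x <= W m.+1 x.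
Proof.
move=> x0; apply: (@le_trans _ _ (\sum_(0 <= k < fl m x * 2) del m.+1 k)); last first.
  apply: sum_del_mono => //.
  rewrite truncn_ge_nat ?mulr_ge0 ?(ltW (dyad_gt0 _ _))//.
  rewrite natrM mulrC exprSr mulrA [leRHS]mulrC ler_pM2l//.
  have /andP[+ _] := fl_itv m x0; by rewrite ler_pdivrMr ?dyad_gt0.
rewrite big_nat_blocks; apply: ler_sum => k _.
have -> : (k.+1 * 2 = (k * 2).+2)%N by lia.
rewrite big_nat_recr ?leqW// big_nat1 /del muln2 -doubleS !dyad_double.
by rewrite /= addrC ler_distD.
Qed.

Let W_mono x : 0 <= x -> nondecreasing_seq (W ^~ x).
Proof. by move=> x0; apply/nondecreasing_seqP => m; exact: W_monoS. Qed.

Let sum_filter (F : nat -> R) n a b : (b <= n)%N ->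
  \sum_(k < n | (a <= k < b)%N) F k = \sum_(a <= k < b) F k.
Proof.
move=> bn; rewrite -(big_mkord (fun k => (a <= k < b)%N)) [RHS]big_nat_cond.
have [ab|ba] := leqP a b; last first.
  rewrite [RHS]big_geq ?(ltnW ba)// big1_seq// => i /andP[/andP[ai ib]].
  by move: (leq_ltn_trans ai ib); rewrite ltnNge (ltnW ba).
rewrite (@big_cat_nat _ _ _ b)//= [X in _ + X]big1_seq ?addr0; last first.
  by move=> i /andP[/andP[_ ib]]; rewrite mem_index_iota leqNgt ib.
rewrite (@big_cat_nat _ _ _ a)//= [X in X + _]big1_seq ?add0r; last first.
  by move=> i /andP[/andP[ai _]]; rewrite mem_index_iota ltnNge ai andbF.
by apply: eq_bigl => i; rewrite andbT.
Qed.

Let block_small e : 0 < e -> exists2 d : R, 0 < d & forall m a b,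
  (b <= 2 ^ m)%N -> (b - a)%:R / 2 ^+ m < d -> \sum_(a <= k < b) del m k <= e.
Proof.
move=> e0; have [d d0 hd] := hac e0; exists d => // m a b bm ab.
rewrite -(@sum_filter _ (2 ^ m))//; apply: (hd m (fun k => (a <= k < b)%N)).
by rewrite (@sum_filter (fun=> _))// sumr_const_nat -[_ *+ (b - a)]mulr_natl.
Qed.

Let W_ub : exists M : R, forall m x, 0 <= x <= 1 -> W m x <= M.
Proof.
have [d d0 hd] := block_small (@ltr01 R).
have [m0 hm] := inv2m_lt d0; exists (2 ^ m0)%:R.
have H m x : 0 <= x <= 1 -> W (m + m0) x <= (2 ^ m0)%:R.
  move=> x01; apply: (@le_trans _ _ (\sum_(0 <= k < 2 ^ m0 * 2 ^ m) del (m + m0) k)).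
    by apply: sum_del_mono => //; rewrite -expnD addnC; exact: fl_le1.
  rewrite big_nat_blocks -[leRHS]mulr1 mulr_natl -[X in _ *+ X]subn0 -sumr_const_nat.
  apply: ler_sum_nat => k /andP[_ km]; apply: hd.
    by rewrite addnC expnD leq_mul2r km orbT.
  rewrite -mulnBl subSnn mul1n natrX exprD invfM mulrA divff ?gt_eqF ?dyad_gt0// mul1r.
  exact: hm.
move=> m x /[dup] /andP[x0 x1] x01; have [mm|mm] := leqP m0 m.
  by rewrite -(subnK mm); exact: H.
apply: le_trans (H 0%N _ x01); rewrite add0n.
by apply: W_mono => //; exact: ltnW.
Qed.

Let W_has_ub x : 0 <= x <= 1 -> has_ubound (range (W ^~ x)).
Proof.
by move=> x01; have [M hM] := W_ub; exists M => _ [m _ <-]; exact: hM.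
Qed.

Let W_cvg x : 0 <= x <= 1 -> W m x @[m --> \oo] --> V x.
Proof.
move=> /[dup] x01 /andP[x0 _].
by apply: nondecreasing_cvgn; [exact: W_mono | exact: W_has_ub].
Qed.

Let WB m x y : 0 <= x -> x <= y ->
  W m y - W m x = \sum_(fl m x <= k < fl m y) del m k.
Proof.
move=> x0 xy; rewrite /W (@big_cat_nat _ _ _ (fl m x) 0 (fl m y))//=; last exact: fl_mono.
by rewrite addrAC subrr add0r.
Qed.

(** The sums [W m] see the increment of f only between dyadic points; the
    continuity of f closes the gap. *)
Lemma variation_ge x y : 0 <= x -> x <= y -> y <= 1 -> `|f y - f x| <= V y - V x.
Proof.
move=> x0 xy y1; have y0 : 0 <= y := le_trans x0 xy.
have x1 : x <= 1 := le_trans xy y1.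
apply/ler_addgt0Pr => e e0; have e20 : 0 < e / 2 by rewrite divr_gt0.
rewrite -lerBlDr.
have cv : (W m y - W m x) @[m --> \oo] --> V y - V x.
  by apply: cvgB; apply: W_cvg; rewrite ?x0 ?y0.
apply: (cvgr_to_ge cv).
have [d d0 hd] := hc e20; have [m0 hm] := inv2m_lt d0.
exists m0 => // m /= mm; rewrite WB//.
have near_fl z : 0 <= z -> z <= 1 -> `|f z - f (dyad R m (fl m z))| < e / 2.
  move=> z0 z1; have /andP[a b] := fl_itv m z0; apply: hd => //; first exact: dyad_ge0.
  by rewrite ltrBlDl; apply: lt_trans b _; rewrite dyadS ltrD2l hm.
have h1 := near_fl _ x0 x1; have h2 := near_fl _ y0 y1.
have h3 : `|f (dyad R m (fl m y)) - f (dyad R m (fl m x))| <=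
    \sum_(fl m x <= k < fl m y) del m k.
  rewrite -(telescope_sumr (fun k => f (dyad R m k))) ?fl_mono//.
  exact: ler_norm_sum.
move: h1 h2; rewrite !ltr_norml => /andP[? ?] /andP[? ?].
move: h3; rewrite !ler_norml => /andP[? ?].
rewrite lerBlDr ler_norml; lra.
Qed.

Lemma variation_continuous e : 0 < e -> exists2 d : R, 0 < d &
  forall x y : R, 0 <= x -> x <= y -> y <= 1 -> y - x < d -> V y - V x <= e.
Proof.
move=> e0; have [d d0 hd] := block_small e0.
have d20 : 0 < d / 2 by rewrite divr_gt0.
exists (d / 2) => // x y x0 xy y1 yx; have y0 : 0 <= y := le_trans x0 xy.
have x1 : x <= 1 := le_trans xy y1.
have cv : (W m y - W m x) @[m --> \oo] --> V y - V x.
  by apply: cvgB; apply: W_cvg; rewrite ?x0 ?y0.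
apply: (cvgr_to_le cv); have [m0 hm] := inv2m_lt d20.
exists m0 => // m /= mm; rewrite WB//; apply: hd; first by rewrite fl_le1// y0.
rewrite natrB ?fl_mono// mulrBl.
have /andP[_ a] := fl_itv m x0; have /andP[b _] := fl_itv m y0.
move: a b (hm m mm); rewrite dyadS /dyad; lra.
Qed.

(** At a finer level, the variation over chosen intervals is a sum of increments
    of f over subintervals of the same total length. *)
Lemma variation_dyadic_ac : dyadic_ac V.
Proof.
move=> e e0; have [d d0 hd] := hac e0; exists d => // n P hP.
have d01 k : (k <= 2 ^ n)%N -> 0 <= dyad R n k <= 1 by move=> kn; rewrite dyad_ge0 dyad_le1.
have -> : \sum_(k < 2 ^ n | P k) `|V (dyad R n k.+1) - V (dyad R n k)| =
    \sum_(k < 2 ^ n | P k) (V (dyad R n k.+1) - V (dyad R n k)).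
  apply: eq_bigr => k _; rewrite ger0_norm//.
  apply: le_trans (variation_ge _ _ _); rewrite ?dyad_ge0 ?dyad_le1 ?dyad_le//.
have cv : (\sum_(k < 2 ^ n | P k) (W m (dyad R n k.+1) - W m (dyad R n k)))
    @[m --> \oo] --> \sum_(k < 2 ^ n | P k) (V (dyad R n k.+1) - V (dyad R n k)).
  apply: cvg_big; first exact: add_continuous.
  by move=> k _; apply: cvgB; apply: W_cvg; apply: d01 => //; exact: ltnW.
apply: (cvgr_to_le cv); exists n => // m' /= mm.
have [m ->] : exists m, m' = (m + n)%N by exists (m' - n)%N; rewrite subnK.
have e1 (F : nat -> R) : \sum_(k < 2 ^ (m + n) | P (k %/ 2 ^ m)%N) F k =
    \sum_(k < 2 ^ n | P k) \sum_(k * 2 ^ m <= j < k.+1 * 2 ^ m) F j.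
  rewrite -(big_mkord (fun k => P (k %/ 2 ^ m)%N) F) big_mkcond/=.
  rewrite addnC expnD big_nat_blocks big_mkord [RHS]big_mkcond/=.
  apply: eq_bigr => k _; have H j : (k * 2 ^ m <= j < k.+1 * 2 ^ m)%N -> (j %/ 2 ^ m = k)%N.
    move=> /andP[a b]; apply/eqP; rewrite eqn_leq leq_divRL ?expn_gt0// a andbT.
    by rewrite -ltnS ltn_divLR ?expn_gt0.
  case: ifP => Pk; first by apply: eq_big_nat => j /H ->; rewrite Pk.
  by rewrite big_nat_cond big1// => j /andP[/H -> _]; rewrite Pk.
have := hd (m + n)%N (fun k => P (k %/ 2 ^ m)%N); rewrite /= (e1 (fun=> (2 ^+ (m + n))^-1)) (e1 (del (m + n))) => hh.
have : \sum_(k < 2 ^ n | P k) \sum_(k * 2 ^ m <= j < k.+1 * 2 ^ m) del (m + n) j <= e.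
  apply: hh; apply: le_lt_trans hP; apply: ler_sum => k _.
  rewrite sumr_const_nat -mulnBl subSnn mul1n -[_ *+ (2 ^ m)%N]mulr_natl natrX exprD invfM mulrA.
  by rewrite divff ?gt_eqF ?dyad_gt0// mul1r.
apply: le_trans; apply: ler_sum => k _.
by rewrite WB ?dyad_ge0 ?dyad_le// !fl_dyad.
Qed.
End Variation.

(** Extends a function on [0, 1] to the line by constants, keeping it monotone
    and continuous. *)
Definition clamp01 (R : realType) (x : R) : R := Num.max 0 (Num.min x 1).

Section Clamp.
Variable R : realType.
Implicit Types x y : R.

Lemma clamp01_itv x : 0 <= clamp01 x <= 1.
Proof. by rewrite /clamp01 le_max lexx ge_max ler01 ge_min lexx orbT. Qed.

Lemma clamp01_id x : 0 <= x <= 1 -> clamp01 x = x.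
Proof. by move=> /andP[x0 x1]; rewrite /clamp01 min_l// max_r. Qed.

Lemma clamp01_le x y : x <= y -> clamp01 x <= clamp01 y.
Proof.
move=> xy; rewrite /clamp01 ge_max le_max lexx/= le_max; apply/orP; right.
by rewrite le_min !ge_min xy lexx !orbT.
Qed.

Lemma clamp01_lip x y : x <= y -> clamp01 y - clamp01 x <= y - x.
Proof.
rewrite /clamp01 /Num.max /Num.min; do ![case: ifP]; lra.
Qed.
End Clamp.

Section Density.
Variables (R : realType) (f : R -> R).
Hypothesis hac : dyadic_ac f.
Hypothesis hc : forall e : R, 0 < e -> exists2 d : R, 0 < d &
  forall a b : R, 0 <= a -> a <= b -> b <= 1 -> b - a < d -> `|f b - f a| < e.
Let V := variation f.

Let phi (s x : R) := V (clamp01 x) + s * f (clamp01 x).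

(** The functions V + f and V - f are nondecreasing, and f is half of their
    difference. *)
Let half (s : R) : `|s| = 1 -> exists g : R -> R,
  lebesgue_measure.-integrable setT (EFin \o g) /\
  forall x, 0 <= x <= 1 ->
     (V x + s * f x - (V 0 + s * f 0))%:E = (\int[lebesgue_measure]_(t in `]0%R, x]) (g t)%:E)%E.
Proof.
move=> s1; have eqs z : `|s * z| = `|z| by rewrite normrM s1 mul1r.
have nd : nondecreasing (phi s).
  move=> x y /clamp01_le xy; rewrite /phi.
  have /andP[x0 _] := clamp01_itv x; have /andP[_ y1] := clamp01_itv y.
  have := variation_ge hac hc x0 xy y1; rewrite -eqs mulrBr ler_norml.
  rewrite -/V; lra.
have rc : right_continuous (phi s).
  move=> x; apply/cvgrPdist_le => e e0.
  have e20 : 0 < e / 2 by rewrite divr_gt0.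
  have [d1 d10 h1] := variation_continuous hac e20.
  have [d2 d20 h2] := hc e20.
  near=> y.
  have xy : x <= y by near: y; exact: nbhs_right_ge.
  have yd : y - x < Num.min d1 d2.
    by rewrite ltrBlDl; near: y; apply: nbhs_right_lt; rewrite ltrDl lt_min d10.
  move: yd; rewrite lt_min => /andP[yd1 yd2].
  have := clamp01_lip xy; have := clamp01_le xy.
  have /andP[x0 _] := clamp01_itv x; have /andP[_ y1] := clamp01_itv y.
  move=> cxy lip.
  have g1 := h1 _ _ x0 cxy y1 (le_lt_trans lip yd1).
  have g2 := h2 _ _ x0 cxy y1 (le_lt_trans lip yd2).
  rewrite -/V in g1; have := nd _ _ xy => ndxy.
  rewrite ler0_norm ?subr_le0// opprB; move: g2.
  rewrite -eqs mulrBr ltr_norml /phi; lra.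
pose c := isCumulative.Build R _ R (phi s) nd rc.
pose ph : cumulative R R := HB.pack (phi s) c.
have pac : dyadic_ac ph.
  move=> e e0; have e20 : 0 < e / 2 by rewrite divr_gt0.
  have [d1 d10 h1] := variation_dyadic_ac hac hc e20.
  have [d2 d20 h2] := hac e20.
  exists (Num.min d1 d2); first by rewrite lt_min d10.
  move=> m P; rewrite lt_min => /andP[/h1 {}h1 /h2 {}h2].
  rewrite [leRHS](_ : e = e / 2 + e / 2); last by field.
  apply: le_trans (lerD h1 h2); rewrite -big_split/=; apply: ler_sum => k _.
  rewrite /phi !clamp01_id ?dyad_ge0 ?dyad_le1// 1?ltnW//.
  rewrite -/V -[X in _ <= _ + X]eqs mulrBr; apply: le_trans (ler_normD _ _).
  by rewrite le_eqVlt; apply/orP; left; apply/eqP; congr (`|_|); ring.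
have [g [g0 ig hg]] := monotone_ac_density pac.
exists g; split=> // x x01; rewrite -hg//=.
by rewrite /phi !clamp01_id// lexx ler01.
Unshelve. all: by end_near. Qed.

Lemma ac_density : exists g : R -> R,
  lebesgue_measure.-integrable setT (EFin \o g) /\
  forall x, 0 <= x <= 1 ->
     f x - f 0 = \int[lebesgue_measure]_(t in `]0%R, x]) g t.
Proof.
have [g1 [i1 h1]] := half (normr1 R).
have [|g2 [i2 h2]] := half (s := -1); first by rewrite normrN normr1.
have H (g : R -> R) x : lebesgue_measure.-integrable setT (EFin \o g) ->
    lebesgue_measure.-integrable `]0, x] (EFin \o g).
  by apply: integrableS => //; exact: measurable_itv.
exists (fun t => 2^-1 * (g1 t - g2 t)); split.
  have -> : EFin \o (fun t => 2^-1 * (g1 t - g2 t)) =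
    (fun t => (2^-1)%:E * ((EFin \o g1) t - (EFin \o g2) t))%E by [].
  by apply: integrableZl => //; exact: integrableB.
move=> x x01; rewrite RintegralZl//; last first.
  have -> : EFin \o (fun t => (g1 t - g2 t)) =
    (fun t => ((EFin \o g1) t - (EFin \o g2) t))%E by [].
  by apply: integrableB; [exact: measurable_itv | exact: H ..].
rewrite RintegralB//; [|exact: H ..].
by rewrite /Rintegral -(h1 _ x01) -(h2 _ x01)/=; field.
Qed.
End Density.

(** The integral of a nonnegative function, measurable or not, is the supremum of
    those of the simple functions below it. *)
Lemma le_integral_pointwise d (T : measurableType d) (R : realType)
  (mu : {measure set T -> \bar R}) (D : set T) (f g : T -> \bar R) :
  (forall x, D x -> 0 <= f x)%E -> (forall x, D x -> f x <= g x)%E ->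
  (\int[mu]_(x in D) f x <= \int[mu]_(x in D) g x)%E.
Proof.
move=> f0 fg; have g0 x : D x -> (0 <= g x)%E.
  by move=> Dx; apply: le_trans (fg _ Dx); exact: f0.
rewrite !ge0_integralE//; apply: ereal_sup_le => _ [h hf <-]; exists h => // x.
by apply: le_trans (hf x) _; rewrite !patchE; case: ifPn => // /set_mem; exact: fg.
Qed.

Section Inequality.
Variables (R : realType) (f : R -> R).
Hypothesis hac : dyadic_ac f.
Hypothesis hc : forall e : R, 0 < e -> exists2 d : R, 0 < d &
  forall a b : R, 0 <= a -> a <= b -> b <= 1 -> b - a < d -> `|f b - f a| < e.

(** The integrand J stands for the speed of a path, which need not be
    measurable; it is compared with the density of f, equal almost everywhere
    to the derivative by Lebesgue differentiation. *)
Lemma ac_le_integral (J : R -> \bar R) (c : R) : 0 < c ->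
  (forall t, 0 <= J t)%E ->
  (forall t : R, 0 <= t <= 1 -> ((`|derive1 f t|)%:E <= c%:E * J t)%E) ->
  forall x : R, 0 <= x <= 1 ->
    ((`|f x - f 0| / c)%:E <= \int[lebesgue_measure]_(t in `[0%R, 1%R]) J t)%E.
Proof.
move=> c0 J0 hJ x /[dup] x01 /andP[x0 x1].
have [g [ig hg]] := ac_density hac hc.
have igS (D : set R) : measurable D -> lebesgue_measure.-integrable D (EFin \o g).
  by move=> mD; apply: integrableS ig.
have lg : locally_integrable setT g.
  by apply: open_integrable_locally => //; exact: openT.
have [N [mN N0 hN]] := @FTC1 R g (BRight 0) (fun y => igS _ (measurable_itv _)) lg.
have dg (t : R) : 0 < t < 1 -> ~ N t -> derive1 f t = g t.
  move=> /andP[t0 t1] Nt.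
  have [dF <-] : derivable (fun y : R => \int[lebesgue_measure]_(t in `]0%R, y]) g t) t 1 /\
     derive1 (fun y : R => \int[lebesgue_measure]_(t in `]0%R, y]) g t) t = g t.
    by apply: contrapT => H; apply: Nt; apply: hN => /= /(_ t0).
  rewrite !derive1E; transitivity ('D_1 (fun y : R => \int[lebesgue_measure]_(t in `]0%R, y]) g t + f 0) t).
    apply: near_eq_derive.
    near=> y; rewrite -hg ?subrK//.
    have : y \in `]0, 1[ by near: y; apply: near_in_itvoo; rewrite in_itv/= t0.
    by rewrite in_itv/= => /andP[/ltW-> /ltW->].
  by rewrite deriveD// derive_cst addr0.
pose h (t : R) := ((c^-1)%:E * `|g t|%:E)%E.
have h0 t : (0 <= h t)%E by rewrite /h -EFinM lee_fin mulr_ge0// invr_ge0 ltW.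
have mg : measurable_fun setT (fun t => `|g t|%:E).
  apply/measurable_EFinP; apply: measurableT_comp => //; apply/measurable_EFinP; exact: measurable_int ig.
pose N' := N `|` [set 1].
have mN' : measurable N' by apply: measurableU.
have N'0 : lebesgue_measure N' = 0%E.
  apply/eqP; rewrite eq_le measure_ge0 andbT.
  have m1 : measurable ([set 1] : set (measurableTypeR R)) by [].
  have := measureU2 lebesgue_measure mN m1 => /le_trans; apply.
  have h1 : lebesgue_measure [set (1:R)] = 0%E by rewrite lebesgue_measure_set1.
  by rewrite [X in (X + _)%E]N0 add0e [X in (X <= _)%E]h1.
have mh : measurable_fun setT h.
  exact: measurable_funeM.
apply: (@le_trans _ _ (\int[lebesgue_measure]_(t in `]0%R, x]) h t)%E).
  rewrite hg// EFinM EFin_normr_Rintegral; [|exact: measurable_itv|exact: igS].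
  rewrite /h ge0_integralZl_EFin//; last 2 first.
  - exact: measurable_funS mg.
  - by rewrite invr_ge0 ltW.
  rewrite muleC; apply: lee_wpmul2l; first by rewrite lee_fin invr_ge0 ltW.
  apply: (le_trans (le_abse_integral _ _ _)) => //.
  by apply: measurable_funS (measurable_int _ ig).
apply: (@le_trans _ _ (\int[lebesgue_measure]_(t in `]0%R, 1%R]) h t)%E).
  apply: ge0_subset_integral => //.
  - exact: measurable_funS mh.
  - by move=> t /=; rewrite !in_itv/= => /andP[-> /le_trans]; apply.
rewrite (ge0_negligible_integral mN')//; last first.
- exact: measurable_funS mh.
have -> : `]0, 1] `\` N' = `[0, 1] `&` (`]0, 1] `\` N').
  apply/seteqP; split => t; last by case.
  by move=> H; split => //; case: H => /=; rewrite !in_itv/= => /andP[t0 t1] _; rewrite t1 ltW.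
rewrite integral_mkcondr; apply: le_integral_pointwise => t /=.
  by move=> _; rewrite patchE; case: ifP => // _; exact: h0.
rewrite in_itv/= => t01; rewrite patchE; case: ifPn => // /set_mem[/=].
rewrite in_itv/= => /andP[t0 t1] /not_orP[Nt t1'].
have t1n : t < 1 by rewrite lt_neqAle t1 andbT; apply/eqP.
have := hJ t t01; rewrite dg ?t0// => H.
by rewrite /h lee_pdivrMl.
Unshelve. all: by end_near. Qed.
End Inequality.

(** * Grushin lengths and admissible pairs *)

(** A path of length L that starts at p stays where |x1| <= |p.1| + L, and there
    moving x2 costs at least 1 / (|p.1| + L)^alpha per unit. *)
Definition admissible (R : realType) (alpha : R) (p q : R * R) (L : R) : Prop :=
  `|p.1 - q.1| <= L /\ `|p.2 - q.2| <= (`|p.1| + L) `^ alpha * L.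

Section EuclideanDist.
Variable R : realType.
Implicit Types p q r : R * R.

Lemma euclidean_dist_ge0 p q : 0 <= euclidean_dist p q.
Proof. exact: sqrtr_ge0. Qed.

Lemma dist1_le p q : `|p.1 - q.1| <= euclidean_dist p q.
Proof. by rewrite /euclidean_dist -sqrtr_sqr ler_wsqrtr// lerDl sqr_ge0. Qed.

Lemma dist2_le p q : `|p.2 - q.2| <= euclidean_dist p q.
Proof. by rewrite /euclidean_dist -sqrtr_sqr ler_wsqrtr// lerDr sqr_ge0. Qed.

Lemma euclidean_dist_le p q (a b : R) : `|p.1 - q.1| <= a -> `|p.2 - q.2| <= b ->
  euclidean_dist p q <= a + b.
Proof.
move=> ha hb; have a0 : 0 <= a := le_trans (normr_ge0 _) ha.
have b0 : 0 <= b := le_trans (normr_ge0 _) hb.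
rewrite -[leRHS]ger0_norm ?addr_ge0// -sqrtr_sqr ler_wsqrtr//.
have := ler_pM (normr_ge0 _) (normr_ge0 _) ha ha.
have := ler_pM (normr_ge0 _) (normr_ge0 _) hb hb.
rewrite -!normrM -!expr2 !ger0_norm ?sqr_ge0//; nra.
Qed.
End EuclideanDist.

Section PathCoordinates.
Variables (R : realType) (g : R -> R * R).
Hypothesis hg : abs_continuous_path g.

Let coord (pr : R * R -> R) :
  (forall p q, `|pr p - pr q| <= euclidean_dist p q) ->
  dyadic_ac (pr \o g) /\
  forall e : R, 0 < e -> exists2 d : R, 0 < d &
  forall a b : R, 0 <= a -> a <= b -> b <= 1 -> b - a < d -> `|pr (g b) - pr (g a)| < e.
Proof.
move=> hpr; split=> e e0; have [d d0 hd] := hg e0; exists d => //.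
  move=> m P hP.
  pose b (k : 'I_(2 ^ m)) := if P k then dyad R m k.+1 else dyad R m k.
  have le1 (k : 'I_(2 ^ m)) : dyad R m k.+1 <= 1 by exact: dyad_le1.
  have leS (k : nat) : dyad R m k <= dyad R m k.+1 by exact: dyad_le.
  have : \sum_(k < 2 ^ m) euclidean_dist (g (dyad R m k)) (g (b k)) < e.
  apply: (hd _ (fun k : 'I_(2 ^ m) => dyad R m k) b).
  - move=> k; rewrite dyad_ge0 /b; case: ifP => _; rewrite ?leS ?le1//.
    by rewrite lexx; split=> //; split => //; exact: le_trans (leS k) (le1 k).
  - have H (i j : 'I_(2 ^ m)) : (i < j)%N ->
      `]dyad R m i, b i[%classic `&` `]dyad R m j, b j[ = set0.
      move=> ij; rewrite -subset0 => x [] /=; rewrite !in_itv/= => /andP[_ xi] /andP[xj _].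
      have bi : b i <= dyad R m i.+1 by rewrite /b; case: ifP.
      have := lt_le_trans (lt_trans xj xi) bi.
      by rewrite ltNge dyad_le.
    apply/trivIsetP => i j _ _ ij.
    have : val i != val j by [].
    rewrite neq_ltn => /orP[/H//|/H]; by rewrite setIC.
  - rewrite big_mkcond/= in hP; apply: le_lt_trans hP; apply: ler_sum => k _.
    by rewrite /b; case: ifP => _; rewrite ?subrr// dyadS addrAC subrr add0r.
  move=> /ltW; apply: le_trans; rewrite big_mkcond/=; apply: ler_sum => k _.
  rewrite /b; case: ifP => _; last exact: euclidean_dist_ge0.
  by rewrite distrC; exact: hpr.
move=> a b a0 ab b1 bad.
have := hd 1%N (fun=> a) (fun=> b); rewrite !big_ord1 => H.
apply: le_lt_trans (H _ _ _) => //; first by rewrite distrC; exact: hpr.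
by apply/trivIsetP => i j _ _; rewrite !ord1 eqxx.
Qed.

Let c1 := coord (fun p q => dist1_le p q).
Let c2 := coord (fun p q => dist2_le p q).

Variables (alpha : R) (a0 : 0 <= alpha).
Let I t := (sqrte ((derive1 (fun t => (g t).1) t ^+ 2)%:E +
   grushin_quotient alpha (g t).1 (derive1 (fun t => (g t).2) t)))%E.

Let quot_ge0 x v : (0 <= grushin_quotient alpha x v)%E.
Proof.
rewrite /grushin_quotient; case: ifP => _; first by case: ifP.
by rewrite lee_fin divr_ge0 ?sqr_ge0// powR_ge0.
Qed.

Let I_ge1 t : ((`|derive1 (fun t => (g t).1) t|)%:E <= I t)%E.
Proof.
rewrite /I; case: (grushin_quotient _ _ _) (quot_ge0 (g t).1 (derive1 (fun t => (g t).2) t)) => [r||]//=.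
  by rewrite lee_fin => r0; rewrite -sqrtr_sqr lee_fin ler_wsqrtr// lerDl.
by move=> _; rewrite leey.
Qed.

Let I_ge2 t (c : R) : 0 < c -> `|(g t).1| `^ alpha <= c ->
  ((`|derive1 (fun t => (g t).2) t|)%:E <= c%:E * I t)%E.
Proof.
move=> c0 hc; rewrite /I; set v := derive1 _ t; set w := derive1 _ t.
have aE : `|(g t).1| `^ (2 * alpha) = (`|(g t).1| `^ alpha) ^+ 2.
  by rewrite mulrC powRrM powR_mulrn// powR_ge0.
rewrite /grushin_quotient aE sqrf_eq0; case: ifPn => [_|n0].
  case: ifPn => [/eqP->|_].
    by rewrite normr0; apply: mule_ge0; [rewrite lee_fin ltW | exact: sqrte_ge0].
  by rewrite /= gt0_muley ?lte_fin// leey.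
set a := _ `^ alpha in hc n0 *.
have ap : 0 < a by rewrite lt_neqAle eq_sym n0 powR_ge0.
rewrite /= -EFinM lee_fin.
apply: (@le_trans _ _ (c * (`|v| / a))).
  by rewrite mulrCA ler_peMr// ler_pdivlMr// mul1r.
rewrite ler_wpM2l ?(ltW c0)//.
have -> : `|v| / a = Num.sqrt ((v / a) ^+ 2) by rewrite sqrtr_sqr normrM normfV (gtr0_norm ap).
by rewrite ler_wsqrtr// expr_div_n lerDr sqr_ge0.
Qed.

Lemma length_admissible (L : R) : (grushin_length alpha g <= L%:E)%E ->
  admissible alpha (g 0) (g 1) L.
Proof.
move=> hL; have I0 t : (0 <= I t)%E by exact: sqrte_ge0.
have {}hL : (\int[lebesgue_measure]_(t in `[0%R, 1%R]) I t <= L%:E)%E by [].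
have x1 (t : R) : 0 <= t <= 1 -> `|(g t).1 - (g 0).1| <= L.
  move=> t01; rewrite -lee_fin; apply: le_trans hL.
  have [A B] := c1; have := ac_le_integral A B ltr01 I0 _ t01.
  rewrite divr1; apply => u _; rewrite mul1e; exact: I_ge1.
have L0 : 0 <= L by apply: le_trans (x1 0 _); rewrite ?lexx ?ler01.
have one : 0 <= (1:R) <= 1 by rewrite ler01 lexx.
split; first by rewrite distrC; exact: x1.
set h := `|(g 0).1| + L; have h0 : 0 <= h by rewrite addr_ge0.
have hx (t : R) : 0 <= t <= 1 -> `|(g t).1| `^ alpha <= h `^ alpha.
  move=> t01; apply: ge0_ler_powR => //; rewrite ?nnegrE//.
  by have := x1 t t01; rewrite /h; have := ler_normD ((g t).1 - (g 0).1) (g 0).1; rewrite subrK; lra.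
have [A B] := c2.
have [c [cp hc cL]] : exists c, [/\ 0 < c, h `^ alpha <= c & c * L <= h `^ alpha * L].
  have [e|n] := eqVneq (h `^ alpha) 0; last first.
    by exists (h `^ alpha); split => //; rewrite lt_neqAle eq_sym n powR_ge0.
  exists 1; rewrite e ltr01 ler01; split => //; rewrite mul0r mul1r.
  move: e => /eqP; rewrite powR_eq0 => /andP[/eqP + _]; rewrite /h.
  have := normr_ge0 (g 0).1; lra.
apply: le_trans cL; rewrite mulrC -ler_pdivrMr// distrC -lee_fin; apply: le_trans hL.
have := ac_le_integral A B cp I0 _ one; apply => t t01.
by apply: I_ge2 => //; apply: le_trans hc; exact: hx.
Qed.
End PathCoordinates.

(** Each simple function below the integrand, which may fail to be measurable, can
    be set to 0 on the null set. *)
Lemma le_integral_off_null (R : realType) (N : set R) (f : R -> \bar R) (B : R) :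
  measurable N -> lebesgue_measure N = 0%E -> 0 <= B ->
  (forall t : R, 0 <= f t)%E ->
  (forall t : R, 0 <= t <= 1 -> ~ N t -> (f t <= B%:E)%E) ->
  (\int[lebesgue_measure]_(t in `[0%R, 1%R]) f t <= B%:E)%E.
Proof.
move=> mN N0 B0 f0 fB; rewrite ge0_integralE//.
apply: ge_ereal_sup => _ [h hf <-]; rewrite -integralT_nnsfun.
have mh : measurable_fun setT (fun x => (h x)%:E) by apply/measurable_EFinP.
have h0 x : setT x -> (0 <= (h x)%:E)%E by move=> _; rewrite lee_fin.
have hN := ge0_negligible_integral (mu := @lebesgue_measure R) mN measurableT mh h0 N0; rewrite hN.
have mB : measurable_fun setT (cst B%:E \_ `[0%R, 1%R] : R -> \bar R).
  by apply/(measurable_restrictT _ _).1 => //; exact: measurable_itv.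
have B01 (x : R) : (0 <= (cst B%:E \_ (`[0%R, 1%R]%classic : set R)) x)%E by rewrite patchE; case: ifP => //; rewrite lee_fin.
apply: (@le_trans _ _ (\int[lebesgue_measure]_(x in setT `\` N) ((cst B%:E \_ `[0%R, 1%R]) x))%E).
  apply: le_integral_pointwise => x; first by rewrite lee_fin.
  move=> [_ Nx]; apply: le_trans (hf x) _; rewrite !patchE; case: ifPn => // /set_mem/=.
  by rewrite in_itv/= => x01; exact: fB.
have hN2 := ge0_negligible_integral (mu := @lebesgue_measure R) mN measurableT mB (fun x _ => B01 x) N0; rewrite -hN2.
rewrite -integral_mkcond integral_cst; last exact: measurable_itv.
have h01 : lebesgue_measure (`[0%R, 1%R]%classic : set R) = 1%E.
  by rewrite lebesgue_measure_itv/= lte_fin ltr01 sube0.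
by rewrite [X in (_ * X <= _)%E]h01 mule1.
Qed.

Section ThreeLegs.
Variables (R : realType) (p q : R * R) (h : R).
Let c := @clamp01 R.

(** The path goes horizontally to the abscissa h, then vertically, then
    horizontally to q; each leg takes a third of the time, whence the clamped
    linear functions of the parameter. *)
Definition three_legs (u : R) : R * R :=
  (p.1 + (h - p.1) * c (3 * u) + (q.1 - h) * c (3 * u - 2),
   p.2 + (q.2 - p.2) * c (3 * u - 1)).

Let c0 x : x <= 0 -> c x = 0.
Proof. by move=> x0; rewrite /c /clamp01 min_l ?max_l//; lra. Qed.

Let c1 x : 1 <= x -> c x = 1.
Proof. by move=> x1; rewrite /c /clamp01 min_r// max_r//; lra. Qed.

Let cid x : 0 <= x <= 1 -> c x = x. Proof. exact: clamp01_id. Qed.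

Lemma three_legs0 : three_legs 0 = p.
Proof. by rewrite /three_legs !c0 ?mulr0 ?addr0//; [case: p|lra..]. Qed.

Lemma three_legs1 : three_legs 1 = q.
Proof.
rewrite /three_legs !c1; [|lra..].
by case: q => a b /=; congr pair; ring.
Qed.

Let clip a b : a <= b -> `|c b - c a| <= b - a.
Proof.
by move=> ab; rewrite ger0_norm ?subr_ge0 ?clamp01_le//; exact: clamp01_lip.
Qed.

Lemma three_legs_ac : abs_continuous_path three_legs.
Proof.
pose K := 1 + 3 * (`|h - p.1| + `|q.1 - h| + `|q.2 - p.2|).
have K0 : 0 < K by rewrite ltr_wpDr// mulr_ge0// !addr_ge0.
have lip a b : a <= b -> euclidean_dist (three_legs a) (three_legs b) <= K * (b - a).
  move=> ab.
  have e1 : `|c (3 * b) - c (3 * a)| <= 3 * (b - a).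
    by apply: le_trans (clip _) _; lra.
  have e2 : `|c (3 * b - 2) - c (3 * a - 2)| <= 3 * (b - a).
    by apply: le_trans (clip _) _; lra.
  have e3 : `|c (3 * b - 1) - c (3 * a - 1)| <= 3 * (b - a).
    by apply: le_trans (clip _) _; lra.
  apply: (@le_trans _ _ ((`|h - p.1| + `|q.1 - h|) * (3 * (b - a)) + `|q.2 - p.2| * (3 * (b - a)))).
    apply: euclidean_dist_le; rewrite distrC /three_legs/=.
      rewrite [X in `|X|](_ : _ = (h - p.1) * (c (3 * b) - c (3 * a)) +
         (q.1 - h) * (c (3 * b - 2) - c (3 * a - 2))); last by ring.
      apply: le_trans (ler_normD _ _) _; rewrite !normrM [leRHS]mulrDl.
      by apply: lerD; apply: ler_wpM2l.
    rewrite [X in `|X|](_ : _ = (q.2 - p.2) * (c (3 * b - 1) - c (3 * a - 1))); last by ring.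
    by rewrite normrM; apply: ler_wpM2l.
  rewrite /K; nra.
move=> e e0; exists (e / K) => [|n a b ab _]; first by rewrite divr_gt0.
rewrite ltr_pdivlMr// => s; apply: le_lt_trans s.
rewrite mulrC mulr_sumr; apply: ler_sum => k _; apply: lip.
by have [_ []] := ab k.
Qed.

Let x1 u := (three_legs u).1.
Let x2 u := (three_legs u).2.

Let near_affine (f : R -> R) (a b l m u : R) : (forall y, a < y < b -> f y = l * y + m) ->
  a < u < b -> derive1 f u = l.
Proof.
move=> hf uab; rewrite derive1E.
transitivity ('D_1 (fun y : R => l * y + m) u).
  apply: near_eq_derive; near=> y; apply: hf.
  have : y \in `]a, b[ by near: y; apply: near_in_itvoo; rewrite in_itv.
  by rewrite in_itv.
have h1 : is_derive u 1 (fun y : R => l * y + m) (l *: 1 + 0) by apply: is_deriveD.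
by case: h1 => _ ->; rewrite addr0 scaler1.
Unshelve. all: by end_near. Qed.

Let leg1 u : 0 < u < 1 / 3 -> derive1 x1 u = 3 * (h - p.1) /\ derive1 x2 u = 0.
Proof.
move=> u3; split; [apply: (near_affine (m := p.1)) u3|apply: (near_affine (m := p.2)) u3] => y y3.
  rewrite /x1 /three_legs/= cid ?c0; [ring|lra|lra].
rewrite /x2 /three_legs/= c0; [ring|lra].
Qed.

Let leg2 u : 1 / 3 < u < 2 / 3 -> derive1 x1 u = 0 /\ derive1 x2 u = 3 * (q.2 - p.2).
Proof.
move=> u3; split; [apply: (near_affine (m := h)) u3|apply: (near_affine (m := p.2 - (q.2 - p.2))) u3] => y y3.
  rewrite /x1 /three_legs/= c1 ?c0; [ring|lra|lra].
rewrite /x2 /three_legs/= cid; [ring|lra].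
Qed.

Let leg3 u : 2 / 3 < u < 1 -> derive1 x1 u = 3 * (q.1 - h) /\ derive1 x2 u = 0.
Proof.
move=> u3; split; [apply: (near_affine (m := h - 2 * (q.1 - h))) u3|apply: (near_affine (m := q.2)) u3] => y y3.
  rewrite /x1 /three_legs/= c1 ?cid; [ring|lra|lra].
rewrite /x2 /three_legs/= c1; [ring|lra].
Qed.

Let x1_leg2 u : 1 / 3 < u < 2 / 3 -> x1 u = h.
Proof. by move=> u3; rewrite /x1 /three_legs/= c1 ?c0; [ring|lra|lra]. Qed.

Lemma three_legs_length (alpha L : R) : 0 < `|h| ->
  `|h - p.1| <= L -> `|q.1 - h| <= 2 * L -> `|q.2 - p.2| <= `|h| `^ alpha * L ->
  (grushin_length alpha three_legs <= (6 * L)%:E)%E.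
Proof.
move=> h0 h1 h2 h3; have L0 : 0 <= L by exact: le_trans h1.
pose N : set R := [set 0] `|` [set 1/3] `|` [set 2/3] `|` [set 1].
have mN : measurable N by do 3 (apply: measurableU => //).
have N0 : lebesgue_measure N = 0%E.
  apply: countable_lebesgue_measure0; apply: finite_set_countable.
  by rewrite /N !finite_setU.
apply: (le_integral_off_null mN N0); first by lra.
  by move=> t; exact: sqrte_ge0.
have q0 x : grushin_quotient alpha x 0 = 0%E.
  by rewrite /grushin_quotient eqxx; case: ifP => // _; rewrite expr0n/= mul0r.
have single (r : R) x : `|r| <= 2 * L ->
    (sqrte (((3 * r) ^+ 2)%:E + grushin_quotient alpha x 0) <= (6 * L)%:E)%E.
  by move=> hr; rewrite q0 adde0 /= sqrtr_sqr lee_fin normrM ger0_norm//; lra.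
move=> t t01 Nt.
have [|t1] := ltP t (1/3).
  move=> t1; have t0 : 0 < t < 1/3.
    rewrite t1 andbT lt_neqAle; case/andP: t01 => -> _; rewrite andbT.
    by apply/eqP => E; apply: Nt; do 3 left.
  by have [-> ->] := leg1 t0; apply: single; lra.
have [t2|t2] := ltP (2/3) t.
  have t0 : 2/3 < t < 1.
    rewrite t2 lt_neqAle; case/andP: t01 => _ ->; rewrite andbT.
    by apply/eqP => E; apply: Nt; right.
  by have [-> ->] := leg3 t0; apply: single; lra.
have t0 : 1/3 < t < 2/3.
  rewrite !lt_neqAle t1 t2 !andbT; apply/andP; split; apply/eqP => E; apply: Nt.
    by left; left; right.
  by left; right.
have [-> ->] := leg2 t0; have := x1_leg2 t0; rewrite /x1 => ->.
have hp : 0 < `|h| `^ alpha by exact: powR_gt0.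
rewrite /grushin_quotient gt_eqF ?powR_gt0// expr0n/=.
rewrite [2 * alpha]mulrC powRrM powR_mulrn ?powR_ge0// -expr_div_n add0r sqrtr_sqr lee_fin.
rewrite normrM normfV (gtr0_norm hp) ler_pdivrMr// normrM ger0_norm//.
have := ler_wpM2l (ltW hp) (_ : L <= L + L); lra.
Qed.
End ThreeLegs.

(** The vertical leg is run at the distance |p.1| + L from the axis. *)
Lemma admissible_dist (R : realType) (alpha L : R) (p q : R * R) : 0 <= alpha -> 0 < L ->
  admissible alpha p q L -> (grushin_dist alpha p q <= (6 * L)%:E)%E.
Proof.
move=> a0 L0 [h1 h2].
pose h := if 0 <= p.1 then p.1 + L else p.1 - L.
have hE : `|h| = `|p.1| + L.
  rewrite /h; case: leP => p1; first by rewrite !ger0_norm//; lra.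
  by rewrite !ltr0_norm//; lra.
have hp : `|h - p.1| = L.
  rewrite /h; case: leP => p1; first by rewrite addrAC subrr add0r gtr0_norm.
  by rewrite addrAC subrr add0r normrN gtr0_norm.
apply: le_trans (three_legs_length (p := p) (q := q) (h := h) (alpha := alpha) _ _ _ _).
- apply: ereal_inf_lbound; exists (three_legs p q h) => //; split.
  + exact: three_legs_ac.
  + exact: three_legs0.
  + exact: three_legs1.
- by rewrite hE; have := normr_ge0 p.1; lra.
- by rewrite hp.
- have := ler_distD p.1 q.1 h; rewrite [`|p.1 - h|]distrC hp [`|q.1 - p.1|]distrC; lra.
- by rewrite hE distrC.
Qed.

Lemma admissible_mono (R : realType) (alpha : R) (p q : R * R) (L L' : R) : 0 <= alpha -> 0 <= L ->
  L <= L' -> admissible alpha p q L -> admissible alpha p q L'.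
Proof.
move=> a0 L0 LL [h1 h2]; split; first exact: le_trans LL.
apply: le_trans h2 _; apply: ler_pM => //; first exact: powR_ge0.
by rewrite ge0_ler_powR ?nnegrE ?addr_ge0 ?(le_trans L0 LL)// lerD2l.
Qed.

(** * Distances, limits and segments *)

(** The number s is the length of the sides of the isosceles triangle with basis 1
    and height k / 2, along which the two copies of the curve are laid. *)
Definition koch_ratio (R : realType) (k s : R) : Prop :=
  [/\ 0 <= k, k < 1, 0 < s & 4 * s ^+ 2 = 1 + k ^+ 2].

Definition taxi (R : realType) (p q : R * R) : R := `|p.1 - q.1| + `|p.2 - q.2|.

Lemma taxiC (R : realType) (p q : R * R) : taxi p q = taxi q p.
Proof. by rewrite /taxi distrC [X in _ + X]distrC. Qed.

Lemma taxi_triangle (R : realType) (p q r : R * R) : taxi p r <= taxi p q + taxi q r.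
Proof.
rewrite /taxi; have := ler_distD q.1 p.1 r.1; have := ler_distD q.2 p.2 r.2; lra.
Qed.

Lemma taxi_ge0 (R : realType) (p q : R * R) : 0 <= taxi p q.
Proof. by rewrite addr_ge0. Qed.

Lemma euclidean_distC (R : realType) (p q : R * R) : euclidean_dist p q = euclidean_dist q p.
Proof. by rewrite /euclidean_dist -sqrrN opprB -[X in _ + X]sqrrN opprB. Qed.

Lemma euclidean_dist_triangle (R : realType) (p q r : R * R) :
  euclidean_dist p r <= euclidean_dist p q + euclidean_dist q r.
Proof.
rewrite -(@ler_pXn2r _ 2)// ?nnegrE ?addr_ge0 ?euclidean_dist_ge0//.
rewrite sqrrD /euclidean_dist !sqr_sqrtr ?addr_ge0 ?sqr_ge0//.
rewrite -sqrtrM ?addr_ge0 ?sqr_ge0//.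
set a := p.1 - q.1; set b := p.2 - q.2; set a' := q.1 - r.1; set b' := q.2 - r.2.
have : a * a' + b * b' <= Num.sqrt ((a ^+ 2 + b ^+ 2) * (a' ^+ 2 + b' ^+ 2)).
  apply: le_trans (ler_norm _) _; rewrite -sqrtr_sqr ler_wsqrtr//.
  have := sqr_ge0 (a * b' - b * a'); nra.
have -> : p.1 - r.1 = a + a' by rewrite /a /a'; ring.
have -> : p.2 - r.2 = b + b' by rewrite /b /b'; ring.
nra.
Qed.

Lemma euclidean_dist_taxi (R : realType) (p q : R * R) :
  euclidean_dist p q <= taxi p q /\ taxi p q <= 2 * euclidean_dist p q.
Proof.
split; first by apply: euclidean_dist_le.
by rewrite mulr_natl mulr2n; apply: lerD; rewrite ?dist1_le ?dist2_le.
Qed.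

Lemma euclidean_dist_eq0 (R : realType) (p q : R * R) : euclidean_dist p q <= 0 -> p = q.
Proof.
move=> h; have := le_trans (dist1_le p q) h; have := le_trans (dist2_le p q) h.
rewrite !normr_le0 !subr_eq0; case: p q {h} => [a b] [c d] /= /eqP-> /eqP->//.
Qed.

(** Every estimate on the self-similar map below is first proved up to an error
    that shrinks geometrically with the number of foldings; this removes it. *)
Lemma le_geometric (R : realType) (s a b C : R) : 0 <= s -> s < 1 ->
  (forall n, a <= b + C * s ^+ n) -> a <= b.
Proof.
move=> s0 s1 h.
have /cvg_geometric -/(_ C) cv : `|s| < 1 by rewrite ger0_norm.
have cv' : (fun n => b + C * s ^+ n) @ \oo --> b.
  by rewrite -[X in _ --> X]addr0; apply: cvgD; [exact: cvg_cst|exact: cv].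
by apply: (ler_cvg_to (cvg_cst a) cv'); near=> n; exact: h.
Unshelve. all: by end_near. Qed.

Lemma le_from_power (R : realType) (s x B : R) : 0 <= s -> s < 1 -> 0 <= B ->
  (forall n, s ^+ n <= x -> x <= B) -> x <= B.
Proof.
move=> s0 s1 B0 h; apply: (@le_geometric _ s _ _ 1) => // n; rewrite mul1r.
have [/h xB|/ltW xs] := leP (s ^+ n) x; first by rewrite ler_wpDr// exprn_ge0.
by rewrite ler_wpDl.
Qed.

(** The limit of a sequence that converges at the rate C s^n, written without
    reference to a proof of convergence. *)
Definition geometric_limit (R : realType) (C s : R) (u : nat -> R) : R :=
  sup [set u n - C * s ^+ n | n in [set: nat]].

Lemma geometric_limitP (R : realType) (C s : R) (u : nat -> R) :
  (forall n m, `|u (n + m)%N - u n| <= C * s ^+ n) ->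
  forall n, `|geometric_limit C s u - u n| <= C * s ^+ n.
Proof.
move=> h n.
have ub m : u m - C * s ^+ m <= u n + C * s ^+ n.
  have [/subnKC mn|/ltnW/subnKC mn] := leqP m n.
    have := h m (n - m)%N; rewrite mn ler_norml => /andP[h1 h2].
    have := h n 0%N; rewrite addn0 subrr normr0 => h3; lra.
  have := h n (m - n)%N; rewrite mn ler_norml => /andP[h1 h2].
  have := h m 0%N; rewrite addn0 subrr normr0 => h3; lra.
rewrite ler_norml; apply/andP; split.
  suff : u n - C * s ^+ n <= geometric_limit C s u by lra.
  by apply: ub_le_sup; [exists (u n + C * s ^+ n) => _ [m _ <-]; exact: ub|exists n].
suff : geometric_limit C s u <= u n + C * s ^+ n by lra.
by apply: ge_sup => [|_ [m _ <-]]; [exists (u 0%N - C * s ^+ 0); exists 0%N|exact: ub].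
Qed.

Lemma lip_surj (R : realType) (f : R -> R) a b M y : a <= b -> 0 <= M ->
  (forall x x', a <= x <= b -> a <= x' <= b -> `|f x - f x'| <= M * `|x - x'|) ->
  f a <= y <= f b -> exists2 t, a <= t <= b & f t = y.
Proof.
move=> ab M0 lip /andP[y0 y1].
have cf : {within `[a, b], continuous f}.
  apply/subspace_continuousP => x /=; rewrite in_itv/= => x01.
  apply/cvgrPdist_le => eps eps0.
  rewrite near_withinE; near=> z; rewrite /= in_itv/= => z01.
  apply: le_trans (lip _ _ x01 z01) _.
  have : `|x - z| <= eps / (M + 1).
    near: z; apply/nbhs_normP; exists (eps / (M + 1)) => [|z /= /ltW//].
    by rewrite /= divr_gt0// ltr_wpDl.
  rewrite ler_pdivlMr; last by rewrite ltr_wpDl.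
  have := normr_ge0 (x - z); nra.
have [||t t01 ft] := @IVT _ f a b y _ cf; first exact: ab.
  by rewrite ge_min y0/= le_max y1 orbT.
by exists t => //; move: t01; rewrite in_itv.
Unshelve. all: by end_near. Qed.

(** Betweenness is taken in the metric sense because similarities then preserve
    and reflect it, and estimates linear in the distance add up along a
    subdivided segment. *)
Definition between (R : realType) (p q m : R * R) : Prop :=
  euclidean_dist p m + euclidean_dist m q <= euclidean_dist p q.

Definition along (R : realType) (p q : R * R) (u : R) : R * R :=
  ((1 - u) * p.1 + u * q.1, (1 - u) * p.2 + u * q.2).

Lemma between_along (R : realType) (p q : R * R) u : 0 <= u <= 1 -> between p q (along p q u).
Proof.
move=> /andP[u0 u1]; rewrite /between.
have S (a x y : R) : 0 <= a -> Num.sqrt ((a * x) ^+ 2 + (a * y) ^+ 2) = a * Num.sqrt (x ^+ 2 + y ^+ 2).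
  move=> a0; rewrite !exprMn -mulrDr sqrtrM ?sqr_ge0// sqrtr_sqr ger0_norm//.
have -> : euclidean_dist p (along p q u) = u * euclidean_dist p q.
  rewrite /euclidean_dist /along/= -S//; congr (Num.sqrt (_ ^+ 2 + _ ^+ 2)); ring.
have -> : euclidean_dist (along p q u) q = (1 - u) * euclidean_dist p q.
  rewrite /euclidean_dist /along/= -S ?subr_ge0//; congr (Num.sqrt (_ ^+ 2 + _ ^+ 2)); ring.
lra.
Qed.

Lemma between_l (R : realType) (p q m x : R * R) : between p q m -> between p m x -> between p q x.
Proof. rewrite /between; have := euclidean_dist_triangle x m q; lra. Qed.

Lemma between_r (R : realType) (p q m x : R * R) : between p q m -> between m q x -> between p q x.
Proof. rewrite /between; have := euclidean_dist_triangle p m x; lra. Qed.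

Lemma between_sym (R : realType) (p q m : R * R) : between p q m -> between q p m.
Proof.
rewrite /between => h.
by rewrite addrC [euclidean_dist m p]euclidean_distC [euclidean_dist q m]euclidean_distC [leRHS]euclidean_distC.
Qed.

Lemma between_end (R : realType) (p q : R * R) : between p q p.
Proof. by rewrite /between {1}/euclidean_dist !subrr expr0n/= addr0 sqrtr0 add0r. Qed.

Lemma cut_along (R : realType) (p q : R * R) (a b c : R) :
  0 <= a * p.1 + b * p.2 + c -> a * q.1 + b * q.2 + c <= 0 ->
  exists2 u, 0 <= u <= 1 & a * (along p q u).1 + b * (along p q u).2 + c = 0.
Proof.
set f := _ + c => f0; set g := _ + c => g0.
have fg : 0 <= f - g by lra.
have [z|z] := eqVneq (f - g) 0.
  exists 0; first by rewrite lexx ler01.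
  rewrite /along/= subr0 !mul1r !mul0r !addr0 -/f; lra.
have {}fg : 0 < f - g by rewrite lt_neqAle eq_sym z.
exists (f / (f - g)).
  by rewrite divr_ge0 ?(ltW fg)// ler_pdivrMr// mul1r; lra.
have -> : a * (along p q (f / (f - g))).1 + b * (along p q (f / (f - g))).2 + c = f - f / (f - g) * (f - g).
  by rewrite /along/= /f /g; ring.
by rewrite divfK ?subrr// gt_eqF.
Qed.

Lemma along_ge (R : realType) (p q : R * R) (a b c u : R) : 0 <= u <= 1 ->
  0 <= a * p.1 + b * p.2 + c -> 0 <= a * q.1 + b * q.2 + c ->
  0 <= a * (along p q u).1 + b * (along p q u).2 + c.
Proof.
move=> /andP[u0 u1] h1 h2; rewrite /along/=.
have -> : a * ((1 - u) * p.1 + u * q.1) + b * ((1 - u) * p.2 + u * q.2) + c =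
  (1 - u) * (a * p.1 + b * p.2 + c) + u * (a * q.1 + b * q.2 + c) by ring.
by rewrite addr_ge0// mulr_ge0// subr_ge0.
Qed.

Section Depth.
Variable R : realDomainType.
Implicit Types s u v w : R.

Lemma same_sign_pos s u v : 0 < s -> s <= u -> s <= v -> (0 <= u) = (0 <= v).
Proof. by move=> /ltW s0 su sv; rewrite (le_trans s0 su) (le_trans s0 sv). Qed.

Lemma same_sign_neg s u v : 0 < s -> u <= - s -> v <= - s -> (0 <= u) = (0 <= v).
Proof. by move=> s0 su sv; apply/idP/idP; lra. Qed.

Lemma depth_pos s u : s <= u -> s <= `|u|.
Proof. by move=> su; rewrite (le_trans su)// ler_norm. Qed.

Lemma depth_neg s u : u <= - s -> s <= `|u|.
Proof. by move=> su; rewrite -normrN; apply: le_trans (ler_norm _); rewrite lerNr. Qed.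

Lemma normB_chain u v w : u <= v -> v <= w -> `|w - u| = `|w - v| + `|v - u|.
Proof. by move=> uv vw; rewrite !ger0_norm ?subr_ge0 ?(le_trans uv vw)//; ring. Qed.
End Depth.

(** * The half box, its folds and its tiles *)

Section Koch.
Variables (R : realType) (k s : R).
Implicit Types (p q : R * R) (kap t v x y l : R).
Local Notation dist := (@euclidean_dist R).

(** The thickness of the box above and below the curve.  It has to vanish when k
    tends to 1, where the two halves of the curve touch. *)
Definition collar : R := (1 - k ^+ 2) / 16.

Local Notation e := collar.

(** The curve from (0, 0) to (1, 0) is symmetric in the line x = 1/2, and only its
    half from (0, 0) to (1/2, k/2) is considered.  The two folds place two copies
    of this half, in opposite directions, end to end at ((1 + k^2)/4, 0); they
    agree on the line x = 1/2, which they send to the axis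
    x + k y = (1 + k^2)/4, and each is the mirror image of the other in it. *)
Definition fold0 p : R * R := ((p.1 + k * p.2) / 2, (k * p.1 - p.2) / 2).
Definition fold1 p : R * R := fold0 (1 - p.1, p.2).

(** The left side of a box is carried by a line x = kap y.  The first fold sends
    the line of parameter [flip kap] to the one of parameter kap, so that kap
    cannot be the same for all boxes; [slant] is the interval with ends k and
    [flip k], stable under this involution. *)
Definition flip kap : R := (kap + k) / (k * kap - 1).
Definition slant kap : Prop := - (2 * k) <= (1 - k ^+ 2) * kap /\ kap <= k.
Definition box kap p : Prop :=
  [/\ - e <= p.2, p.2 <= k * p.1 + e, p.1 <= 1 / 2 & kap * p.2 <= p.1].

(** The abscissa of the common image under both folds of the upper right corner
    of a box, where the room below the small boxes has an angle. *)
Definition bend : R := (1 + k ^+ 2) / 4 + k * e / 2.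
Local Notation c := bend.

(** The line y = k x + w carries the images under both folds of the lower side of
    a box. *)
Definition shelf : R := e * (1 + k ^+ 2) / 2.

Local Notation w := shelf.
Local Notation Q := ((1 - k ^+ 2)^-1).

(** [top] and [bot] parametrize the upper and lower sides of a box.  They are not
    independent: [mid] is the parametrization of the line y = k x + w that the
    folds induce from [bot], and the lower tiles restrict on their upper edge to
    what the folds induce from [top]. *)
Definition top kap t : R := (1 - t) * (kap * e / (1 - k * kap)) + t / 2.
Definition bot kap t : R :=
  if t <= 1 / 2 then (1 - 2 * t) * - (kap * e) + 2 * t * c
  else c + (2 * t - 1) * (1 / 2 - c).
Definition mid kap t : R :=
  if t <= 1 / 2 then (bot (flip kap) (2 * t) - k * e) / 2
  else (1 - bot k (2 - 2 * t) - k * e) / 2.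

(** The upper tile interpolates linearly between the folded lower sides and the
    upper side of the box. *)
Definition upper kap t l : R * R :=
  let x := (1 - l) * mid kap t + l * top kap t in
  (x, k * x + ((1 - l) * w + l * e)).

(** The line that carries the image under the second fold of the upper side of a
    box. *)
Definition slope_in x : R := - (e / 2) + 2 * k * (x - c) / (1 - k ^+ 2).

(** Below the small boxes there are two tiles, separated by the vertical line
    x = c: the left one lies under the horizontal line y = - e / 2, the right one
    under the slanted line [slope_in]. *)
Definition lower kap t l : R * R :=
  if t <= 1 / 2 then
    let y := - (e / 2) * (1 + l) in ((1 - 2 * t) * (kap * y) + 2 * t * c, y)
  else let x := c + (2 * t - 1) * (1 / 2 - c) in
    (x, (1 - l) * slope_in x - l * e).
Definition tile kap t v : R * R :=
  if 0 <= v then upper kap t ((v - s) / (1 - s))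
  else lower kap t ((- v - s) / (1 - s)).

Section Folding.
Hypothesis K : koch_ratio k s.
Lemma k_ge0 : 0 <= k. Proof. by case: K. Qed.
Lemma k_lt1 : k < 1. Proof. by case: K. Qed.
Lemma s_gt0 : 0 < s. Proof. by case: K. Qed.
Lemma s_sqr : 4 * s ^+ 2 = 1 + k ^+ 2. Proof. by case: K. Qed.
Lemma k2_lt1 : 0 < 1 - k ^+ 2. Proof. have := k_ge0; have := k_lt1; nra. Qed.
Lemma s_ge_half : 1 / 2 <= s. Proof. have := s_sqr; have := s_gt0; have := sqr_ge0 k; nra. Qed.
Lemma s_lt1 : s < 1. Proof. have := s_sqr; have := s_gt0; have := k2_lt1; nra. Qed.
Lemma collarE : 16 * e = 1 - k ^+ 2. Proof. by rewrite /collar; field. Qed.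
Lemma collar_gt0 : 0 < e. Proof. have := collarE; have := k2_lt1; lra. Qed.
Lemma collar_le : e <= 1 / 16. Proof. have := collarE; have := sqr_ge0 k; lra. Qed.
Lemma kcollar_le : k * e <= 1 / 16.
Proof. have := collar_le; have := k_lt1; have := k_ge0; have := collar_gt0; nra. Qed.

Lemma slant_k : slant k.
Proof. split=> //; have := k_ge0; have := k_lt1; have := k2_lt1; nra. Qed.

Lemma slant_kap_lt1 kap : slant kap -> 0 < 1 - k * kap.
Proof. move=> [h1 h2]; have := k_ge0; have := k_lt1; have := k2_lt1; nra. Qed.

Lemma slant_kap_ge kap : slant kap -> 1 - k ^+ 2 <= 1 - k * kap.
Proof. move=> [h1 h2]; have := k_ge0; nra. Qed.

Lemma flip_eq kap : slant kap -> flip kap * (1 - k * kap) = - (kap + k).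
Proof.
move=> /slant_kap_lt1 h; rewrite /flip -[k * kap - 1]opprB invrN mulrN mulNr divfK//.
by rewrite gt_eqF.
Qed.

Lemma flip_prod kap : slant kap -> (1 - k * flip kap) * (1 - k * kap) = 1 + k ^+ 2.
Proof. by move=> h; rewrite mulrBl mul1r -mulrA flip_eq//; ring. Qed.

Lemma slant_flip kap : slant kap -> slant (flip kap).
Proof.
move=> h; have := flip_eq h; have := slant_kap_lt1 h; case: h => h1 h2.
have := k_ge0; have := k_lt1; have := k2_lt1; move: (flip kap) => f q0 k1 k0 p fe.
split.
  rewrite -subr_ge0 -(pmulr_lge0 _ p).
  have -> : ((1 - k ^+ 2) * f - - (2 * k)) * (1 - k * kap) = (1 - k ^+ 2) * (f * (1 - k * kap)) + 2 * k * (1 - k * kap) by ring.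
  rewrite fe; nra.
rewrite -subr_ge0 -(pmulr_lge0 _ p) mulrBl fe; nra.
Qed.

Lemma slant_collar kap : slant kap -> - (1 / 8) * k <= kap * e /\ kap * e <= k * e.
Proof.
move=> [h1 h2]; have := collarE; have := collar_gt0; have := k_ge0.
split; nra.
Qed.

Lemma top0_bounds kap : slant kap ->
  - (1 / 8) <= kap * e / (1 - k * kap) /\ kap * e / (1 - k * kap) <= 1 / 16.
Proof.
move=> h; have p := slant_kap_lt1 h; have pg := slant_kap_ge h.
rewrite ler_pdivlMr// ler_pdivrMr//; case: h => h1 h2.
have := collarE; have := collar_gt0; have := k_ge0; have := k_lt1; have := k2_lt1.
move=> q0 k1 k0 e0 eE; split; nra.
Qed.

Lemma bend_bounds : 1 / 4 <= c /\ c <= 1 / 2 - (1 - k ^+ 2) / 8.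
Proof.
rewrite /bend; have := collarE; have := collar_gt0; have := k_ge0; have := k_lt1; have := k2_lt1.
split; nra.
Qed.

Definition steep (a b : R) (f : R -> R) (m M : R) : Prop := forall t t' : R,
  a <= t -> t <= t' -> t' <= b -> m * (t' - t) <= f t' - f t /\ f t' - f t <= M * (t' - t).

Lemma steep_glue f m M : steep 0 (1 / 2) f m M -> steep (1 / 2) 1 f m M -> steep 0 1 f m M.
Proof.
move=> h1 h2 t t' t0 tt t1; have [a|a] := leP t' (1 / 2); first exact: h1.
have [b|b] := leP (1 / 2) t; first exact: h2.
have [x1 x2] := h1 t (1 / 2) t0 (ltW b) (lexx _).
have [x3 x4] := h2 (1 / 2) t' (lexx _) (ltW a) t1.
lra.
Qed.

Lemma steep_top kap : slant kap -> steep 0 1 (top kap) (1 / 4) 1.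
Proof. by move=> /top0_bounds[h1 h2] t t' t0 tt t1; rewrite /top; split; nra. Qed.

Lemma steep_bot kap : slant kap -> steep 0 1 (bot kap) ((1 - k ^+ 2) / 4) 2.
Proof.
move=> h; have [h1 h2] := slant_collar h; have [c1 c2] := bend_bounds.
have [q0 k0] := (k2_lt1, k_ge0); have := kcollar_le; have k1 := k_lt1 => ke.
have := sqr_ge0 k => k2.
apply: steep_glue => t t' t0 tt t1; last first.
  have B u : 1 / 2 <= u -> bot kap u = c + (2 * u - 1) * (1 / 2 - c).
    move=> u1; rewrite /bot; case: ifP => // u2.
    have -> : u = 1 / 2 by lra.
    by field.
  rewrite !B//; last by lra.
  split; nra.
rewrite /bot t1 (le_trans tt t1); split; nra.
Qed.

Lemma bot0 kap : bot kap 0 = - (kap * e).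
Proof. rewrite /bot divr_ge0//; ring. Qed.
Lemma bot1 kap : bot kap 1 = 1 / 2.
Proof. rewrite /bot; case: ifP => h; [lra|ring]. Qed.
Lemma top0 kap : top kap 0 = kap * e / (1 - k * kap).
Proof. rewrite /top; ring. Qed.
Lemma top1 kap : top kap 1 = 1 / 2.
Proof. rewrite /top; ring. Qed.

Lemma mid_right kap t : 1 / 2 <= t -> mid kap t = (1 - bot k (2 - 2 * t) - k * e) / 2.
Proof.
move=> t1; rewrite /mid; case: ifP => // t2.
have -> : t = 1 / 2 by lra.
have -> : 2 * (1 / 2) = 1 :> R by field.
have -> : 2 - 1 = 1 :> R by ring.
by rewrite !bot1; field.
Qed.

Lemma mid0 kap : slant kap -> mid kap 0 = kap * w / (1 - k * kap).
Proof.
move=> h; rewrite /mid divr_ge0// mulr0 bot0 /shelf.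
have p := slant_kap_lt1 h; apply: (mulIf (lt0r_neq0 p)); rewrite divfK ?gt_eqF//.
have f := flip_eq h.
have -> : (- (flip kap * e) - k * e) / 2 * (1 - k * kap) =
   - e / 2 * (flip kap * (1 - k * kap) + k * (1 - k * kap)) by field.
by rewrite f; field.
Qed.

Lemma mid1 kap : mid kap 1 = 1 / 2.
Proof.
rewrite mid_right; last by lra.
have -> : 2 - 2 * 1 = 0 :> R by ring.
by rewrite bot0; field.
Qed.

Lemma steep_mid kap : slant kap -> steep 0 1 (mid kap) ((1 - k ^+ 2) / 4) 2.
Proof.
move=> h; apply: steep_glue => t t' t0 tt t1.
  rewrite /mid t1 (le_trans tt t1).
  have [|||] := steep_bot (slant_flip h) (t := 2 * t) (t' := 2 * t'); [lra..|lra].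
rewrite !mid_right//; last by lra.
have [|||] := steep_bot slant_k (t := 2 - 2 * t') (t' := 2 - 2 * t); [lra..|lra].
Qed.

Lemma shelf_bounds : e / 2 <= w /\ w <= e - e * (1 - k ^+ 2) / 2.
Proof. rewrite /shelf; have := collar_gt0; have := sqr_ge0 k; split; nra. Qed.

Lemma box_fold0 kap p : slant kap -> box (flip kap) p -> box kap (fold0 p).
Proof.
move=> h [h1 h2 h3 h4]; have p0 := slant_kap_lt1 h; have f := flip_eq h.
have := k2_lt1; have := k_ge0; have := collar_gt0; have := collarE; have := kcollar_le; have := k_lt1.
move=> k1 ke eE e0 k0 q0; move: p h1 h2 h3 h4 => [x y] /= h1 h2 h3 h4.
rewrite /box /fold0 /=; split.
- lra.
- nra.
- nra.
- have := ler_wpM2r (ltW p0) h4; rewrite mulrAC f; lra.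
Qed.

Lemma box_fold1 kap p : slant kap -> box k p -> box kap (fold1 p).
Proof.
move=> h [h1 h2 h3 h4]; have p0 := slant_kap_lt1 h.
have := k2_lt1; have := k_ge0; have := collar_gt0; have := collarE; have := kcollar_le; have := k_lt1.
have := collar_le; have [g1 g2] := slant_collar h.
move=> el k1 ke eE e0 k0 q0; move: p h1 h2 h3 h4 => [x y] /= h1 h2 h3 h4.
rewrite /box /fold1 /fold0 /=; split.
- nra.
- nra.
- lra.
- suff : 0 <= (1 - k * kap) * (1 - x) + (k + kap) * y by lra.
  case: h => s1 s2.
  have [a|a] := leP 0 (k + kap).
    have : (k + kap) * - e <= (k + kap) * y by rewrite ler_wpM2l//; lra.
    have : (1 - k * kap) * (1 / 2) <= (1 - k * kap) * (1 - x) by rewrite ler_wpM2l ?(ltW p0)//; lra.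
    nra.
  have : (k + kap) * (k * x + e) <= (k + kap) * y by rewrite ler_wnM2l// ltW.
  have : 0 <= (1 - k * kap) * (1 / 2 - x) by rewrite mulr_ge0 ?(ltW p0)//; lra.
  have : 0 <= k * - (k + kap) * (1 / 2 - x) by rewrite mulr_ge0// ?mulr_ge0//; lra.
  nra.
Qed.
End Folding.

(** * The tiles and the folded boxes fill the box *)

Section TileSurjectivity.
Hypothesis K : koch_ratio k s.
Lemma steep_surj (f : R -> R) m M y : 0 <= m -> 0 <= M -> steep 0 1 f m M ->
  f 0 <= y <= f 1 -> exists2 t, 0 <= t <= 1 & f t = y.
Proof.
move=> m0 M0 hf; apply: (@lip_surj _ f 0 1 M) => // a b.
wlog ab : a b / a <= b.
  move=> H a01 b01; have [ab|/ltW ba] := leP a b; first exact: H.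
  by rewrite distrC [`|a - b|]distrC; exact: H.
move=> /andP[a0 _] /andP[_ b1]; have [h1 h2] := hf a b a0 ab b1.
rewrite [`|a - b|]distrC [`|f a - f b|]distrC !ger0_norm ?subr_ge0//.
by rewrite -subr_ge0 (le_trans _ h1)// mulr_ge0// subr_ge0.
Qed.

(** The middle region, between the upper and the lower tiles, is cut by the axis
    into two parts whose sides are carried by those of the folded boxes. *)
Lemma unfold0 kap p : slant kap -> box kap p -> p.2 <= k * p.1 + w ->
  - (e / 2) <= p.2 -> p.1 + k * p.2 <= (1 + k ^+ 2) / 4 ->
  exists2 q, box (flip kap) q & fold0 q = p.
Proof.
move=> h [h1 h2 h3 h4] h5 h6 h7.
have d0 : 0 < 1 + k ^+ 2 by have := sqr_ge0 k; lra.
have dn : 1 + k ^+ 2 != 0 by rewrite gt_eqF.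
pose X := 2 * (p.1 + k * p.2) / (1 + k ^+ 2).
pose Y := 2 * (k * p.1 - p.2) / (1 + k ^+ 2).
have XE : X * (1 + k ^+ 2) = 2 * (p.1 + k * p.2) by rewrite divfK.
have YE : Y * (1 + k ^+ 2) = 2 * (k * p.1 - p.2) by rewrite divfK.
exists (X, Y); last first.
  rewrite /fold0/=; case: p h1 h2 h3 h4 h5 h6 h7 @X @Y XE YE => a b /= _ _ _ _ _ _ _ _ _.
  by congr pair; field.
rewrite /box/=; move: X Y XE YE => X Y XE YE.
have := k_ge0 K; have := collar_gt0 K => e0 k0; rewrite /shelf in h5.
split.
- rewrite -subr_ge0 -(pmulr_lge0 _ d0); nra.
- rewrite -subr_ge0 -(pmulr_lge0 _ d0).
  have -> : (k * X + e - Y) * (1 + k ^+ 2) = k * (X * (1 + k ^+ 2)) - Y * (1 + k ^+ 2) + e * (1 + k ^+ 2) by ring.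
  rewrite XE YE; nra.
- rewrite -(ler_pM2r d0) XE; lra.
- have f := flip_eq K h; have p0 := slant_kap_lt1 K h.
  rewrite -(ler_pM2r d0) -(ler_pM2r p0) XE.
  have -> : flip kap * Y * (1 + k ^+ 2) * (1 - k * kap) =
    flip kap * (1 - k * kap) * (Y * (1 + k ^+ 2)) by ring.
  rewrite YE.
  rewrite f; nra.
Qed.

Lemma slope_inE x : (1 - k ^+ 2) * slope_in x = 2 * k * x - (k + e) * (1 + k ^+ 2) / 2.
Proof.
have q0 : 1 - k ^+ 2 != 0 by rewrite gt_eqF// (k2_lt1 K).
by rewrite /slope_in /bend; field.
Qed.

Lemma slope_in_c : slope_in c = - (e / 2).
Proof. by rewrite /slope_in subrr mulr0 mul0r addr0. Qed.

Lemma slope_in_lip x x' : x <= x' ->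
  0 <= slope_in x' - slope_in x /\
  slope_in x' - slope_in x <= 2 / (1 - k ^+ 2) * (x' - x).
Proof.
move=> xx; have q0 := k2_lt1 K; have k0 := k_ge0 K; have k1 := k_lt1 K.
have -> : slope_in x' - slope_in x = 2 / (1 - k ^+ 2) * (k * (x' - x)).
  by rewrite /slope_in; field; rewrite gt_eqF.
have g : 0 <= 2 / (1 - k ^+ 2) by rewrite divr_ge0// ltW.
split; first by apply: mulr_ge0 => //; apply: mulr_ge0 => //; rewrite subr_ge0.
by rewrite ler_wpM2l// ler_piMl ?subr_ge0// ltW.
Qed.

Lemma unfold1 kap p : slant kap -> box kap p -> p.2 <= k * p.1 + w ->
  slope_in p.1 <= p.2 -> (1 + k ^+ 2) / 4 <= p.1 + k * p.2 ->
  exists2 q, box k q & fold1 q = p.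
Proof.
move=> h [h1 h2 h3 h4] h5 h6 h7.
have d0 : 0 < 1 + k ^+ 2 by have := sqr_ge0 k; lra.
have dn : 1 + k ^+ 2 != 0 by rewrite gt_eqF.
have := slope_inE p.1; have := k2_lt1 K => q0 sE.
have {h6} h6 : 2 * k * p.1 - (k + e) * (1 + k ^+ 2) / 2 <= (1 - k ^+ 2) * p.2.
  by rewrite -sE ler_pM2l.
pose X := 2 * (p.1 + k * p.2) / (1 + k ^+ 2).
pose Y := 2 * (k * p.1 - p.2) / (1 + k ^+ 2).
have XE : X * (1 + k ^+ 2) = 2 * (p.1 + k * p.2) by rewrite divfK.
have YE : Y * (1 + k ^+ 2) = 2 * (k * p.1 - p.2) by rewrite divfK.
exists (1 - X, Y); last first.
  rewrite /fold1 /fold0/=; case: p h1 h2 h3 h4 h5 h6 h7 sE @X @Y XE YE => a b /= _ _ _ _ _ _ _ _ _ _.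
  by congr pair; field.
rewrite /box/=; move: X Y XE YE => X Y XE YE.
have := k_ge0 K; have := collar_gt0 K => e0 k0; rewrite /shelf in h5.
split.
- rewrite -subr_ge0 -(pmulr_lge0 _ d0); nra.
- rewrite -subr_ge0 -(pmulr_lge0 _ d0).
  have -> : (k * (1 - X) + e - Y) * (1 + k ^+ 2) = (k + e) * (1 + k ^+ 2) - k * (X * (1 + k ^+ 2)) - Y * (1 + k ^+ 2) by ring.
  rewrite XE YE; nra.
- rewrite -subr_ge0 -(pmulr_lge0 _ d0); nra.
- rewrite -subr_ge0 -(pmulr_lge0 _ d0).
  have -> : (1 - X - k * Y) * (1 + k ^+ 2) = (1 + k ^+ 2) - X * (1 + k ^+ 2) - k * (Y * (1 + k ^+ 2)) by ring.
  rewrite XE YE; nra.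
Qed.

Lemma lower_right kap t l : 1 / 2 <= t ->
  lower kap t l = (c + (2 * t - 1) * (1 / 2 - c),
    (1 - l) * slope_in (c + (2 * t - 1) * (1 / 2 - c)) - l * e).
Proof.
move=> t1; rewrite /lower; case: ifP => // t2.
have -> : t = 1 / 2 by lra.
have -> : c + (2 * (1 / 2) - 1) * (1 / 2 - c) = c by field.
by rewrite slope_in_c; congr pair; field.
Qed.

Lemma upper_surj kap p : slant kap -> box kap p -> k * p.1 + w <= p.2 ->
  exists t l, [/\ 0 <= t <= 1, 0 <= l <= 1 & upper kap t l = p].
Proof.
move=> h [h1 h2 h3 h4] h5.
have [w1 w2] := shelf_bounds K; have q0 := k2_lt1 K; have e0 := collar_gt0 K.
have we : 0 < e - w by nra.
pose l := (p.2 - k * p.1 - w) / (e - w).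
have lE : l * (e - w) = p.2 - k * p.1 - w by rewrite divfK// gt_eqF.
have l01 : 0 <= l <= 1 by rewrite ler_pdivlMr// ler_pdivrMr// ; apply/andP; split; lra.
have p0 := slant_kap_lt1 K h.
have [] := @steep_surj (fun t => (1 - l) * mid kap t + l * top kap t) ((1 - k ^+ 2) / 4) 2 p.1.
- lra.
- lra.
- move=> t t' t0 tt t1; case/andP: l01 => l0 l1.
  have [a1 a2] := steep_mid K h t0 tt t1; have [b1 b2] := steep_top K h t0 tt t1.
  have := sqr_ge0 k => k2.
  have : (1 - k ^+ 2) / 4 * (t' - t) <= 1 / 4 * (t' - t) by rewrite ler_wpM2r; lra.
  split; nra.
- rewrite (mid0 K h) top0 mid1 // top1.
  have -> : (1 - l) * (kap * w / (1 - k * kap)) + l * (kap * e / (1 - k * kap)) =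
     kap * (p.2 - k * p.1) / (1 - k * kap).
    have -> : p.2 - k * p.1 = l * (e - w) + w by rewrite lE; ring.
    by field; rewrite gt_eqF.
  by rewrite ler_pdivrMr//; apply/andP; split; lra.
move=> t t01 ft; exists t, l; split => //.
rewrite /upper/= ft.
have -> : (1 - l) * w + l * e = l * (e - w) + w by ring.
by rewrite lE; case: (p) => a b /=; congr pair; ring.
Qed.

Lemma lower_surj kap p : slant kap -> box kap p ->
  p.2 <= - (e / 2) \/ p.2 <= slope_in p.1 ->
  exists t l, [/\ 0 <= t <= 1, 0 <= l <= 1 & lower kap t l = p].
Proof.
move=> h [h1 h2 h3 h4] h5.
have e0 := collar_gt0 K; have [c1 c2] := bend_bounds K; have q0 := k2_lt1 K.
have [xc|cx] := leP p.1 c.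
  have y2 : p.2 <= - (e / 2).
    case: h5 => // h5; apply: le_trans h5 _; rewrite -slope_in_c.
    by have [+ _] := slope_in_lip xc; rewrite subr_ge0.
  have kc : 0 < c - kap * p.2.
    have := slant_collar K h; have := k_lt1 K; have := k_ge0 K => k0 k1 [g1 g2].
    have : kap * p.2 <= 1 / 8.
      have [a|a] := leP 0 kap; first by have := mulr_ge0_le0 a (_ : p.2 <= 0); lra.
      have : kap * p.2 <= kap * - e by rewrite ler_wnM2l// ltW.
      lra.
    lra.
  exists ((p.1 - kap * p.2) / (2 * (c - kap * p.2))), (- (2 * p.2 + e) / e).
  have t0 : 0 <= (p.1 - kap * p.2) / (2 * (c - kap * p.2)) <= 1 / 2.
    rewrite ler_pdivlMr ?ler_pdivrMr; [|lra..].
    by apply/andP; split; lra.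
  split.
  - lra.
  - by rewrite ler_pdivlMr// ler_pdivrMr//; apply/andP; split; lra.
  rewrite /lower; case/andP: t0 => _ ->.
  have y : - (e / 2) * (1 + - (2 * p.2 + e) / e) = p.2 by field; rewrite gt_eqF.
  rewrite y; case: (p) kc => a b /= kc; congr pair; field.
  by rewrite gt_eqF.
have y2 : p.2 <= slope_in p.1.
  case: h5 => // h5; apply: le_trans h5 _; rewrite -slope_in_c.
  by have [+ _] := slope_in_lip (ltW cx); rewrite subr_ge0.
have s0 : 0 < slope_in p.1 + e.
  by have [+ _] := slope_in_lip (ltW cx); rewrite slope_in_c; lra.
have c0 : 0 < 1 / 2 - c by lra.
exists (1 / 2 + (p.1 - c) / (2 * (1 / 2 - c))), ((slope_in p.1 - p.2) / (slope_in p.1 + e)).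
have t0 : 0 <= (p.1 - c) / (2 * (1 / 2 - c)) <= 1 / 2.
  rewrite ler_pdivlMr ?ler_pdivrMr; [|lra..].
  by apply/andP; split; lra.
split.
- lra.
- by rewrite ler_pdivlMr// ler_pdivrMr//; apply/andP; split; lra.
rewrite lower_right; last by lra.
have x : c + (2 * (1 / 2 + (p.1 - c) / (2 * (1 / 2 - c))) - 1) * (1 / 2 - c) = p.1.
  by move: (1 / 2 - c) c0 => D D0; field; rewrite gt_eqF.
rewrite x; case: (p) s0 => a b /= s0; congr pair; field.
by rewrite gt_eqF.
Qed.
End TileSurjectivity.

(** * Position and distortion of the tiles *)

Section TileEstimates.
Hypothesis K : koch_ratio k s.
Lemma steep_bounds f m M t : 0 <= m -> steep 0 1 f m M -> 0 <= t <= 1 -> f 0 <= f t <= f 1.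
Proof.
move=> m0 h /andP[t0 t1].
have [a _] := h 0 t (lexx _) t0 t1; have [b _] := h t 1 t0 t1 (lexx _).
have := mulr_ge0 m0 (_ : 0 <= t - 0); have := mulr_ge0 m0 (_ : 0 <= 1 - t); lra.
Qed.

Lemma steep_norm f m M t t' : 0 <= m -> steep 0 1 f m M -> 0 <= t <= 1 -> 0 <= t' <= 1 ->
  m * `|t - t'| <= `|f t - f t'| /\ `|f t - f t'| <= M * `|t - t'|.
Proof.
move=> m0 h; wlog tt : t t' / t <= t'.
  move=> H t01 t01'; have [a|a] := leP t t'; first exact: H.
  by rewrite distrC [`|f t - _|]distrC; apply: H => //; exact: ltW.
move=> /andP[t0 _] /andP[_ t1]; rewrite distrC [`|f t - _|]distrC.
have [a b] := h t t' t0 tt t1.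
have c0 : 0 <= t' - t by rewrite subr_ge0.
have := mulr_ge0 m0 c0 => d0.
by rewrite !ger0_norm//; lra.
Qed.

Let q4 : 0 <= (1 - k ^+ 2) / 4. Proof. have := k2_lt1 K; lra. Qed.
Let q4' : 0 <= 1 / 4 :> R. Proof. lra. Qed.

Lemma mid_bounds kap t : slant kap -> 0 <= t <= 1 -> kap * w / (1 - k * kap) <= mid kap t <= 1 / 2.
Proof.
move=> h t01; rewrite -(mid0 K h) -(mid1 kap).
exact: steep_bounds (steep_mid K h) t01.
Qed.

Lemma top_bounds kap t : slant kap -> 0 <= t <= 1 -> kap * e / (1 - k * kap) <= top kap t <= 1 / 2.
Proof.
move=> h t01; rewrite -(top0 kap) -(top1 kap).
exact: steep_bounds (steep_top K h) t01.
Qed.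

Lemma mid0_bounds kap : slant kap ->
  - (1 / 8) <= kap * w / (1 - k * kap) /\ kap * w / (1 - k * kap) <= 1 / 16.
Proof.
move=> h; have [a b] := top0_bounds K h; have [w1 w2] := shelf_bounds K.
have e0 := collar_gt0 K; have q0 := k2_lt1 K; have p0 := slant_kap_lt1 K h.
have we : w / e <= 1 by rewrite ler_pdivrMr// mul1r; nra.
have we0 : 0 <= w / e by rewrite divr_ge0//; lra.
have -> : kap * w / (1 - k * kap) = kap * e / (1 - k * kap) * (w / e) by field; rewrite !gt_eqF.
nra.
Qed.

Lemma upper_box kap t l : slant kap -> 0 <= t <= 1 -> 0 <= l <= 1 ->
  box kap (upper kap t l) /\ k * (upper kap t l).1 + w <= (upper kap t l).2.
Proof.
move=> h t01 /andP[l0 l1]; have p0 := slant_kap_lt1 K h.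
have /andP[m1 m2] := mid_bounds h t01; have /andP[t1 t2] := top_bounds h t01.
have [w1 w2] := shelf_bounds K; have e0 := collar_gt0 K; have q0 := k2_lt1 K.
have [a b] := top0_bounds K h; have [a' b'] := mid0_bounds h.
have we : w <= e by nra.
rewrite /upper/=; set x := (1 - l) * _ + _.
have wl : w <= (1 - l) * w + l * e by nra.
have le : (1 - l) * w + l * e <= e by nra.
have xge : kap * ((1 - l) * w + l * e) / (1 - k * kap) <= x.
  have -> : kap * ((1 - l) * w + l * e) / (1 - k * kap) =
    (1 - l) * (kap * w / (1 - k * kap)) + l * (kap * e / (1 - k * kap)) by field; rewrite gt_eqF.
  by rewrite /x lerD// ler_wpM2l//; lra.
have x2 : x <= 1 / 2 by rewrite /x; nra.
have x8 : - (1 / 8) <= x by rewrite /x; nra.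
split; last lra.
rewrite /box/=; split.
- have := k_ge0 K; have := k_lt1 K => k1 k0.
  rewrite ler_pdivrMr// in xge.
  have [z|z] := leP 0 x; first by have := mulr_ge0 k0 z; lra.
  have kap0 : kap < 0.
    rewrite ltNge; apply/negP => kap0.
    have : 0 <= kap * ((1 - l) * w + l * e) by rewrite mulr_ge0//; lra.
    have : x * (1 - k * kap) < 0 by rewrite nmulr_rlt0.
    lra.
  case: h => g1 g2; have d0 : 0 < 1 + k ^+ 2 by have := sqr_ge0 k; lra.
  have z1 : - x * (1 - k * kap) <= - kap * e.
    have : - kap * ((1 - l) * w + l * e) <= - kap * e by rewrite ler_wpM2l//; lra.
    lra.
  have z2 : - kap * (1 + k ^+ 2) <= 2 * k * (1 - k * kap) by lra.
  have z3 : - x * (1 + k ^+ 2) <= 2 * k * e.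
    rewrite -(ler_pM2r p0).
    have : - x * (1 - k * kap) * (1 + k ^+ 2) <= - kap * e * (1 + k ^+ 2) by rewrite ler_wpM2r// ltW.
    have : - kap * (1 + k ^+ 2) * e <= 2 * k * (1 - k * kap) * e by rewrite ler_wpM2r// ltW.
    lra.
  have z4 : k * (- x) <= e.
    rewrite -(ler_pM2r d0).
    have : k * (- x * (1 + k ^+ 2)) <= k * (2 * k * e) by rewrite ler_wpM2l.
    have : 0 <= (1 - k ^+ 2) * e by rewrite mulr_ge0// ltW.
    lra.
  lra.
- lra.
- exact: x2.
- rewrite ler_pdivrMr// in xge; lra.
Qed.

Lemma kap_bounds kap : slant kap -> `|kap| <= 2 / (1 - k ^+ 2).
Proof.
move=> [g1 g2]; have q0 := k2_lt1 K; have := k_ge0 K; have := k_lt1 K => k1 k0.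
rewrite ler_pdivlMr//; have [a|a] := leP 0 kap.
  rewrite ger0_norm//; nra.
rewrite ltr0_norm//; lra.
Qed.

Lemma kap_shelf kap y : slant kap -> - e <= y <= 0 -> `|kap * y| <= 1 / 8.
Proof.
move=> h /andP[y1 y2]; have q0 := k2_lt1 K; have eE := collarE; have := kap_bounds h.
rewrite ler_pdivlMr// => kq; rewrite normrM (ler0_norm y2).
have n0 := normr_ge0 kap.
have : `|kap| * - y <= `|kap| * e by rewrite ler_wpM2l//; lra.
have : `|kap| * (16 * e) = `|kap| * (1 - k ^+ 2) by rewrite eE.
lra.
Qed.

Lemma kap_shelf_x kap y : slant kap -> - e <= y <= 0 -> - (k * e) <= kap * y.
Proof.
move=> [g1 g2] /andP[y1 y2]; have k0 := k_ge0 K.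
have [a|a] := leP 0 kap.
  have : kap * - y <= kap * e by rewrite ler_wpM2l//; lra.
  have : kap * e <= k * e by rewrite ler_wpM2r// ltW// (collar_gt0 K).
  lra.
have : 0 <= kap * y by rewrite mulr_le0// ltW.
have : 0 <= k * e by rewrite mulr_ge0// ltW// (collar_gt0 K).
lra.
Qed.

Lemma slope_in_le x : x <= 1 / 2 -> slope_in x <= k * x.
Proof.
move=> x2; have q0 := k2_lt1 K; rewrite -(ler_pM2l q0) (slope_inE K).
have : 0 <= k * (1 + k ^+ 2) * (1 / 2 - x).
  rewrite !mulr_ge0 ?(k_ge0 K)//; [have := sqr_ge0 k; lra|lra].
have : 0 <= e * (1 + k ^+ 2) by rewrite mulr_ge0 ?ltW ?(collar_gt0 K)//; have := sqr_ge0 k; lra.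
lra.
Qed.

Lemma lower_left_box kap t l : slant kap -> 0 <= t <= 1 / 2 -> 0 <= l <= 1 ->
  [/\ box kap (lower kap t l), (lower kap t l).2 <= - (e / 2) & (lower kap t l).1 <= c].
Proof.
move=> h /andP[t0 t1] /andP[l0 l1]; rewrite /lower t1/=.
have e0 := collar_gt0 K; have q0 := k2_lt1 K; have [c1 c2] := bend_bounds K.
set y := - (e / 2) * (1 + l).
have y1 : - e <= y by rewrite /y; nra.
have y2 : y <= - (e / 2) by rewrite /y; nra.
have yy : - e <= y <= 0 by lra.
have a8 := kap_shelf h yy; have ax := kap_shelf_x h yy.
rewrite ler_norml in a8; case/andP: a8 => b1 b2.
rewrite /box/=; move: (kap * y) ax b1 b2 => z ax b1 b2.
have xc : (1 - 2 * t) * z + 2 * t * c <= c by nra.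
have xz : z <= (1 - 2 * t) * z + 2 * t * c by nra.
have xk : - (k * e) <= (1 - 2 * t) * z + 2 * t * c by lra.
split => //; split => //; [|lra].
have k0 := k_ge0 K; have k1 := k_lt1 K.
have : k * - (k * e) <= k * ((1 - 2 * t) * z + 2 * t * c) by rewrite ler_wpM2l.
have : 0 <= (1 - k ^+ 2) * e by rewrite mulr_ge0// ltW.
lra.
Qed.

Lemma lower_right_box kap t l : slant kap -> 1 / 2 <= t <= 1 -> 0 <= l <= 1 ->
  [/\ box kap (lower kap t l), (lower kap t l).2 <= slope_in (lower kap t l).1 &
      c <= (lower kap t l).1].
Proof.
move=> h /andP[t0 t1] /andP[l0 l1]; rewrite lower_right//=.
have e0 := collar_gt0 K; have q0 := k2_lt1 K; have [c1 c2] := bend_bounds K.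
set x := c + _.
have xc : c <= x by rewrite /x; nra.
have x2 : x <= 1 / 2 by rewrite /x; nra.
have [+ _] := slope_in_lip K xc; rewrite slope_in_c subr_ge0 => sc.
have := slope_in_le x2; move: (slope_in x) sc => S sc sx.
have y1 : - e <= (1 - l) * S - l * e by nra.
have y2 : (1 - l) * S - l * e <= S by nra.
split => //; rewrite /box/=; split => //; first by lra.
have k0 := k_ge0 K; have k1 := k_lt1 K.
move: y1 y2; move: (_ - l * e) => y y1 y2.
case: (h) => g1 g2.
have [a|a] := leP 0 y.
  have : kap * y <= k * y by rewrite ler_wpM2r.
  have : k * y <= k * (k * x) by rewrite ler_wpM2l//; lra.
  have : 0 <= (1 - k ^+ 2) * x by rewrite mulr_ge0//; lra.
  lra.
have := kap_shelf h (_ : - e <= y <= 0); rewrite ler_norml => H.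
have := H _; lra.
Qed.

Lemma lower_box kap t l : slant kap -> 0 <= t <= 1 -> 0 <= l <= 1 ->
  box kap (lower kap t l) /\ (lower kap t l).2 <= k * (lower kap t l).1 + w.
Proof.
move=> h /andP[t0 t1] l01.
have q0 := k2_lt1 K; have k0 := k_ge0 K; have e0 := collar_gt0 K.
have [w1 w2] := shelf_bounds K.
have [a|a] := leP t (1 / 2).
  have [] := lower_left_box (t := t) h _ l01; first by lra.
  move: (lower kap t l) => p [h1 h2 h3 h4] h5 h6; split => //.
  have := kap_shelf_x (y := p.2) h _ => kx.
  have {}kx : - (k * e) <= kap * p.2 by apply: kx; lra.
  have : k * - (k * e) <= k * p.1 by rewrite ler_wpM2l//; lra.
  have : 0 <= (1 - k ^+ 2) * e by rewrite mulr_ge0// ltW.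
  rewrite /shelf; lra.
have [] := lower_right_box (t := t) h _ l01; first by lra.
move: (lower kap t l) => p [h1 h2 h3 h4] h5 h6; split => //.
have := slope_in_le h3; lra.
Qed.

Lemma upper_top kap t : upper kap t 1 = (top kap t, k * top kap t + e).
Proof. by rewrite /upper; congr pair; ring. Qed.

Lemma lower_bot kap t : lower kap t 1 = (bot kap t, - e).
Proof.
rewrite /lower /bot; case: ifP => _; congr pair; try by field.
Qed.

(** On the edges that they share with the folded boxes, the tiles are what the
    folds induce from the opposite edges; this and the next lemmas are the gluing
    conditions of the self-similar map. *)
Lemma upper_inl kap t : t <= 1 / 2 ->
  upper kap t 0 = fold0 (bot (flip kap) (2 * t), - e).
Proof.
by move=> t1; rewrite /upper /mid t1 /fold0/= /shelf; congr pair; field.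
Qed.

Lemma upper_inr kap t : 1 / 2 <= t ->
  upper kap t 0 = fold1 (bot k (2 - 2 * t), - e).
Proof.
by move=> t1; rewrite /upper mid_right// /fold1 /fold0/= /shelf; congr pair; field.
Qed.

Lemma lower_inl kap t : slant kap -> t <= 1 / 2 ->
  lower kap t 0 = fold0 (top (flip kap) (2 * t), k * top (flip kap) (2 * t) + e).
Proof.
move=> h t1; rewrite /lower t1 /fold0/= /top.
have p0 := slant_kap_lt1 K (slant_flip K h).
have f1 : flip kap / (1 - k * flip kap) * (1 + k ^+ 2) = - (kap + k).
  rewrite -(flip_eq K h) -(flip_prod K h); field; by rewrite gt_eqF.
congr pair; last by field; rewrite gt_eqF.
have -> : flip kap * e / (1 - k * flip kap) = flip kap / (1 - k * flip kap) * e.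
  by field; rewrite gt_eqF.
have -> (z : R) : ((1 - 2 * t) * (z * e) + 2 * t / 2 +
   k * (k * ((1 - 2 * t) * (z * e) + 2 * t / 2) + e)) / 2 =
   ((1 - 2 * t) * (z * (1 + k ^+ 2)) * e + t * (1 + k ^+ 2) + k * e) / 2 by field.
rewrite f1 /bend; by field.
Qed.

Lemma lower_inr kap t : slant kap -> 1 / 2 <= t ->
  lower kap t 0 = fold1 (top k (2 - 2 * t), k * top k (2 - 2 * t) + e).
Proof.
move=> h t1; rewrite lower_right// /fold1 /fold0/= /top /slope_in /bend.
have q0 := k2_lt1 K.
congr pair; field; rewrite -?expr2 ?gt_eqF//.
Qed.

Lemma upper_col kap l : slant kap -> (upper kap 0 l).1 = kap * (upper kap 0 l).2.
Proof.
move=> h; rewrite /upper/= (mid0 K h) top0; field.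
by rewrite gt_eqF// (slant_kap_lt1 K h).
Qed.

Lemma lower_col kap l : (lower kap 0 l).1 = kap * (lower kap 0 l).2.
Proof. by rewrite /lower divr_ge0//=; ring. Qed.

Lemma upper_axis kap l : upper kap 1 l = (1 / 2, k / 2 + ((1 - l) * w + l * e)).
Proof. by rewrite /upper mid1 top1; congr pair; field. Qed.

Lemma lower_axis kap l : lower kap 1 l = (1 / 2, (1 - l) * slope_in (1 / 2) - l * e).
Proof.
rewrite lower_right; last by lra.
have -> : c + (2 * 1 - 1) * (1 / 2 - c) = 1 / 2 by ring.
by [].
Qed.
End TileEstimates.

Section TileDistortion.
Hypothesis K : koch_ratio k s.
Let Q1 : 1 <= Q.
Proof. by rewrite invf_ge1 ?(k2_lt1 K)//; have := sqr_ge0 k; lra. Qed.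

Let QE : Q * (1 - k ^+ 2) = 1.
Proof. by rewrite mulVf// gt_eqF// (k2_lt1 K). Qed.

Let top_mid kap t : slant kap -> 0 <= t <= 1 -> `|top kap t - mid kap t| <= 1.
Proof.
move=> h t01; have /andP[m1 m2] := mid_bounds K h t01; have /andP[t1 t2] := top_bounds K h t01.
have [a b] := top0_bounds K h; have [a' b'] := mid0_bounds K h.
rewrite ler_norml; lra.
Qed.

Let q4 : 0 <= (1 - k ^+ 2) / 4. Proof. have := k2_lt1 K; lra. Qed.
Let q14 : 0 <= 1 / 4 :> R. Proof. lra. Qed.

Lemma upper_lip kap t t' l l' : slant kap -> 0 <= t <= 1 -> 0 <= t' <= 1 ->
  0 <= l <= 1 -> 0 <= l' <= 1 ->
  taxi (upper kap t l) (upper kap t' l') <= 6 * (`|t - t'| + `|l - l'|).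
Proof.
move=> h t01 t01' l01 l01'.
have [_ d1] := steep_norm q4 (steep_mid K h) t01 t01'.
have [_ d2] := steep_norm q14 (steep_top K h) t01 t01'.
have tm := top_mid h t01'.
have [w1 w2] := shelf_bounds K; have e0 := collar_gt0 K; have e16 := collar_le.
have q0 := k2_lt1 K; have k0 := k_ge0 K; have k1 := k_lt1 K.
have we : `|e - w| <= 1 by rewrite ler_norml; nra.
rewrite /taxi /upper/=.
have xE : (1 - l) * mid kap t + l * top kap t - ((1 - l') * mid kap t' + l' * top kap t') =
  (1 - l) * (mid kap t - mid kap t') + l * (top kap t - top kap t') + (l - l') * (top kap t' - mid kap t').
  by ring.
have xb : `|(1 - l) * mid kap t + l * top kap t - ((1 - l') * mid kap t' + l' * top kap t')| <=
   2 * `|t - t'| + `|l - l'|.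
  rewrite xE; apply: le_trans (ler_normD _ _) _; apply: lerD; last by rewrite normrM ler_piMr.
  apply: le_trans (ler_normD _ _) _; rewrite !normrM.
  case/andP: l01 => l0 l1; rewrite [`|l|]ger0_norm// [`|1 - l|]ger0_norm ?subr_ge0//.
  have : (1 - l) * `|mid kap t - mid kap t'| <= (1 - l) * (2 * `|t - t'|) by rewrite ler_wpM2l// subr_ge0.
  have : l * `|top kap t - top kap t'| <= l * (2 * `|t - t'|).
    by rewrite ler_wpM2l//; apply: le_trans d2 _; rewrite ler_wpM2r//; lra.
  lra.
move: xb; set x := (1 - l) * _ + _; set x' := (1 - l') * _ + _ => xb.
have -> : k * x + ((1 - l) * w + l * e) - (k * x' + ((1 - l') * w + l' * e)) =
   k * (x - x') + (l - l') * (e - w) by ring.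
have : `|k * (x - x') + (l - l') * (e - w)| <= `|x - x'| + `|l - l'|.
  apply: le_trans (ler_normD _ _) _; rewrite !normrM; apply: lerD.
    by rewrite ler_piMl// ger0_norm// ltW.
  by rewrite ler_piMr.
have := normr_ge0 (t - t'); have := normr_ge0 (l - l'); lra.
Qed.

(** The ordinate relative to the line y = k x gives l; at fixed l, the abscissa is
    a convex combination of two steep functions of t. *)
Lemma upper_colip : exists2 C : R, 0 < C & forall kap t t' l l', slant kap ->
  0 <= t <= 1 -> 0 <= t' <= 1 -> 0 <= l <= 1 -> 0 <= l' <= 1 ->
  `|t - t'| <= C * taxi (upper kap t l) (upper kap t' l') /\
  `|l - l'| <= C * taxi (upper kap t l) (upper kap t' l').
Proof.
have [w1 w2] := shelf_bounds K; have e0 := collar_gt0 K; have e16 := collar_le.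
have q0 := k2_lt1 K; have k0 := k_ge0 K; have k1 := k_lt1 K.
have D0 : 0 < e - w by nra.
pose D := (e - w)^-1; have Dp : 0 < D by rewrite invr_gt0.
exists (4 * Q * (1 + D)); first by rewrite !mulr_gt0// ?invr_gt0// addr_gt0.
move=> kap t t' l l' h t01 t01' l01 l01'; set T := taxi _ _.
have lb : `|l - l'| <= D * T.
  rewrite mulrC ler_pdivlMr// -[X in _ * X]gtr0_norm// -normrM.
  have -> : (l - l') * (e - w) = ((upper kap t l).2 - (upper kap t' l').2) -
    k * ((upper kap t l).1 - (upper kap t' l').1) by rewrite /upper/=; ring.
  apply: le_trans (ler_normB _ _) _; rewrite normrM /T /taxi addrC lerD2r.
  by rewrite ler_piMl// ger0_norm// ltW.
have T0 : 0 <= T by exact: taxi_ge0.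
have [d1 _] := steep_norm q4 (steep_mid K h) t01 t01'.
have tb : (1 - k ^+ 2) / 4 * `|t - t'| <= (1 + D) * T.
  have S : steep 0 1 (fun t => (1 - l) * mid kap t + l * top kap t) ((1 - k ^+ 2) / 4) 2.
    move=> u u' u0 uu u1; case/andP: l01 => l0 l1.
    have [a1 a2] := steep_mid K h u0 uu u1; have [b1 b2] := steep_top K h u0 uu u1.
    have := sqr_ge0 k => k2.
    have : (1 - k ^+ 2) / 4 * (u' - u) <= 1 / 4 * (u' - u) by rewrite ler_wpM2r; lra.
    split; nra.
  have [+ _] := steep_norm q4 S t01 t01' => /le_trans; apply.
  have -> : (1 - l) * mid kap t + l * top kap t - ((1 - l) * mid kap t' + l * top kap t') =
    ((upper kap t l).1 - (upper kap t' l').1) - (l - l') * (top kap t' - mid kap t').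
    by rewrite /upper/=; ring.
  apply: le_trans (ler_normB _ _) _; rewrite [leRHS]mulrDl mul1r; apply: lerD.
    by rewrite /T /taxi lerDl.
  by rewrite normrM; apply: le_trans lb; rewrite ler_piMr// top_mid.
split.
  have -> : `|t - t'| = 4 * Q * ((1 - k ^+ 2) / 4 * `|t - t'|).
    by field; rewrite gt_eqF.
  by rewrite -[leRHS]mulrA ler_wpM2l// mulr_ge0// invr_ge0 ltW.
apply: le_trans lb _; rewrite ler_wpM2r//.
have q1 := Q1; have : 1 * (1 + D) <= (4 * Q) * (1 + D).
  by apply: ler_wpM2r; lra.
lra.
Qed.

Let left_lip kap t t' l l' : slant kap -> 0 <= t <= 1 / 2 -> 0 <= t' <= 1 / 2 ->
  0 <= l <= 1 -> 0 <= l' <= 1 ->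
  taxi (lower kap t l) (lower kap t' l') <= 6 * Q * (`|t - t'| + `|l - l'|).
Proof.
move=> h /andP[t0 t1] /andP[t0' t1'] /andP[l0 l1] /andP[l0' l1'].
have e0 := collar_gt0 K; have e16 := collar_le; have q0 := k2_lt1 K.
have [c1 c2] := bend_bounds K.
rewrite /taxi /lower t1 t1'/=.
set y := - (e / 2) * (1 + l); set y' := - (e / 2) * (1 + l').
have ky : `|kap * y| <= 1 / 8 by apply: (kap_shelf K) => //; rewrite /y; apply/andP; split; nra.
have yE : y - y' = - (e / 2) * (l - l') by rewrite /y /y'; ring.
have yb : `|y - y'| <= `|l - l'|.
  by rewrite yE normrM normrN ler_piMl// ger0_norm; lra.
have -> : (1 - 2 * t) * (kap * y) + 2 * t * c - ((1 - 2 * t') * (kap * y') + 2 * t' * c) =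
   2 * (t - t') * (c - kap * y) + (1 - 2 * t') * (kap * (y - y')) by ring.
have b1 : `|2 * (t - t') * (c - kap * y)| <= 2 * `|t - t'|.
  rewrite !normrM [`|2|]ger0_norm//; apply: ler_piMr; first by rewrite mulr_ge0.
  by move: ky; rewrite !ler_norml; lra.
have kq := kap_bounds K h.
have b2 : `|(1 - 2 * t') * (kap * (y - y'))| <= 2 * Q * `|l - l'|.
  rewrite !normrM; apply: (@le_trans _ _ (1 * (2 * Q * `|l - l'|))); last by rewrite mul1r.
  have nk : 0 <= `|kap| * `|y - y'| by rewrite mulr_ge0.
  apply: ler_pM => //; first by rewrite ler_norml; lra.
  by apply: ler_pM.
have n1 := normr_ge0 (t - t'); have n2 := normr_ge0 (l - l').
have : 1 * (`|t - t'| + `|l - l'|) <= Q * (`|t - t'| + `|l - l'|) by rewrite ler_wpM2r// addr_ge0.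
have : 0 <= Q * `|t - t'| by rewrite mulr_ge0// invr_ge0 ltW.
have := ler_normD (2 * (t - t') * (c - kap * y)) ((1 - 2 * t') * (kap * (y - y'))).
lra.
Qed.

Let slope_norm x x' : `|slope_in x - slope_in x'| <= 2 * Q * `|x - x'|.
Proof.
wlog xx : x x' / x <= x'.
  move=> H; have [a|a] := leP x x'; first exact: H.
  by rewrite distrC [`|x - _|]distrC; apply: H; exact: ltW.
have [a b] := slope_in_lip K xx.
by rewrite distrC [`|x - _|]distrC !ger0_norm// subr_ge0.
Qed.

Let right_lip kap t t' l l' : slant kap -> 1 / 2 <= t <= 1 -> 1 / 2 <= t' <= 1 ->
  0 <= l <= 1 -> 0 <= l' <= 1 ->
  taxi (lower kap t l) (lower kap t' l') <= 6 * Q * (`|t - t'| + `|l - l'|).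
Proof.
move=> h /andP[t0 t1] /andP[t0' t1'] /andP[l0 l1] /andP[l0' l1'].
have e0 := collar_gt0 K; have e16 := collar_le; have q0 := k2_lt1 K.
have [c1 c2] := bend_bounds K; have k0 := k_ge0 K; have k1 := k_lt1 K.
rewrite /taxi !lower_right//=.
set x := c + _; set x' := c + _.
have xE : x - x' = 2 * (t - t') * (1 / 2 - c) by rewrite /x /x'; ring.
have xb : `|x - x'| <= `|t - t'| / 2.
  rewrite xE !normrM [`|2|]ger0_norm// [`|1 / 2 - c|]ger0_norm; last by lra.
  have := normr_ge0 (t - t') => n.
  have : `|t - t'| * (1 / 2 - c) <= `|t - t'| * (1 / 4) by rewrite ler_wpM2l//; lra.
  lra.
have [xc x2] : c <= x' /\ x' <= 1 / 2 by rewrite /x'; split; nra.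
have sb : `|slope_in x' + e| <= 1.
  have := slope_in_le K x2; have [+ _] := slope_in_lip K xc; rewrite slope_in_c ler_norml => a b.
  have : k * x' <= 1 / 2 by nra.
  lra.
have -> : (1 - l) * slope_in x - l * e - ((1 - l') * slope_in x' - l' * e) =
   (1 - l) * (slope_in x - slope_in x') - (l - l') * (slope_in x' + e) by ring.
have b1 : `|(1 - l) * (slope_in x - slope_in x')| <= 2 * Q * `|x - x'|.
  rewrite normrM; apply: le_trans (slope_norm x x'); apply: ler_piMl => //.
  by rewrite ler_norml; lra.
have b2 : `|(l - l') * (slope_in x' + e)| <= `|l - l'| by rewrite normrM ler_piMr.
have n1 := normr_ge0 (t - t'); have n2 := normr_ge0 (l - l').
have : 1 * (`|t - t'| + `|l - l'|) <= Q * (`|t - t'| + `|l - l'|) by rewrite ler_wpM2r// addr_ge0.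
have : Q * `|x - x'| <= Q * (`|t - t'| / 2) by rewrite ler_wpM2l// invr_ge0 ltW.
have : 0 <= Q * `|l - l'| by rewrite mulr_ge0// invr_ge0 ltW.
have := ler_normB ((1 - l) * (slope_in x - slope_in x')) ((l - l') * (slope_in x' + e)).
lra.
Qed.

Lemma lower_lip kap t t' l l' : slant kap -> 0 <= t <= 1 -> 0 <= t' <= 1 ->
  0 <= l <= 1 -> 0 <= l' <= 1 ->
  taxi (lower kap t l) (lower kap t' l') <= 6 * Q * (`|t - t'| + `|l - l'|).
Proof.
move=> h; wlog tt : t t' l l' / t <= t'.
  move=> H t01 t01' l01 l01'; have [a|a] := leP t t'; first exact: H.
  by rewrite taxiC distrC [`|l - _|]distrC; apply: H => //; exact: ltW.
move=> /andP[t0 t1] /andP[t0' t1'] l01 l01'.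
have [a|a] := leP t' (1 / 2); first by apply: left_lip => //; rewrite ?t0 ?t0'//=; lra.
have [b|b] := leP (1 / 2) t; first by apply: right_lip => //; rewrite ?b//=; lra.
have := left_lip (t := t) (t' := 1 / 2) h _ _ l01 l01.
have := right_lip (t := 1 / 2) (t' := t') h _ _ l01 l01'.
rewrite subrr normr0 addr0 => H1 H2.
have {}H1 := H1 (_ : 1 / 2 <= 1 / 2 <= 1) (_ : 1 / 2 <= t' <= 1).
have {}H2 := H2 (_ : 0 <= t <= 1 / 2) (_ : 0 <= 1 / 2 <= 1 / 2).
apply: le_trans (taxi_triangle _ (lower kap (1 / 2) l) _) _.
have -> : `|t - t'| = `|t - 1 / 2| + `|1 / 2 - t'|.
  by rewrite !ler0_norm; lra.
have {}H1 := H1 _ _; have {}H2 := H2 _ _.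
have : taxi (lower kap t l) (lower kap (1 / 2) l) <= 6 * Q * `|t - 1 / 2|.
  by apply: H2; lra.
have : taxi (lower kap (1 / 2) l) (lower kap t' l') <= 6 * Q * (`|1 / 2 - t'| + `|l - l'|).
  by apply: H1; lra.
lra.
Qed.

Let C1 := (4 * Q + 2 / e) * (1 + 2 * Q).
Let C1_pos : 0 < C1.
Proof.
have := Q1; have e0 := collar_gt0 K => q1.
have d0 : 0 < 2 / e by rewrite divr_gt0.
by rewrite /C1; apply: mulr_gt0; lra.
Qed.

Let C1_ge T : 0 <= T -> (4 * (1 + 2 * Q) * T <= C1 * T) /\ (2 / e * (1 + 2 * Q) * T <= C1 * T).
Proof.
move=> T0; have q1 := Q1; have e0 := collar_gt0 K.
have d0 : 0 <= 2 / e by rewrite divr_ge0// ltW.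
rewrite /C1; split; apply: ler_wpM2r => //; apply: ler_wpM2r; lra.
Qed.

Let left_colip kap t t' l l' : slant kap -> 0 <= t <= 1 / 2 -> 0 <= t' <= 1 / 2 ->
  0 <= l <= 1 -> 0 <= l' <= 1 ->
  `|t - t'| <= C1 * taxi (lower kap t l) (lower kap t' l') /\
  `|l - l'| <= C1 * taxi (lower kap t l) (lower kap t' l').
Proof.
move=> h /andP[t0 t1] /andP[t0' t1'] /andP[l0 l1] /andP[l0' l1'].
have e0 := collar_gt0 K; have e16 := collar_le; have q0 := k2_lt1 K.
have [c1 c2] := bend_bounds K; have q1 := Q1.
have T0 := taxi_ge0 (lower kap t l) (lower kap t' l').
have [g1 g2] := C1_ge T0.
move: T0 g1 g2; rewrite /taxi /lower t1 t1'/=.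
set y := - (e / 2) * (1 + l); set y' := - (e / 2) * (1 + l').
have ky : `|kap * y| <= 1 / 8 by apply: (kap_shelf K) => //; rewrite /y; apply/andP; split; nra.
have yE : y - y' = - (e / 2) * (l - l') by rewrite /y /y'; ring.
set x := (1 - 2 * t) * _ + _; set x' := (1 - 2 * t') * _ + _.
have xE : 2 * (t - t') * (c - kap * y) = (x - x') - (1 - 2 * t') * (kap * (y - y')) by rewrite /x /x'; ring.
set T := `|x - x'| + `|y - y'| => T0 g1 g2.
have nx := normr_ge0 (x - x'); have ny := normr_ge0 (y - y').
have kq := kap_bounds K h.
have b2 : `|(1 - 2 * t') * (kap * (y - y'))| <= 2 * Q * `|y - y'|.
  rewrite !normrM; apply: (@le_trans _ _ (1 * (2 * Q * `|y - y'|))); last by rewrite mul1r.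
  have nk : 0 <= `|kap| * `|y - y'| by rewrite mulr_ge0.
  apply: ler_pM => //; first by rewrite ler_norml; lra.
  by apply: ler_pM.
have b3 : 1 / 4 * `|t - t'| <= `|2 * (t - t') * (c - kap * y)|.
  rewrite !normrM [`|2|]ger0_norm// [leRHS]mulrAC; apply: ler_wpM2r => //.
  move: ky; rewrite ler_norml => /andP[ky1 ky2].
  rewrite ger0_norm; lra.
have b4 : `|2 * (t - t') * (c - kap * y)| <= `|x - x'| + 2 * Q * `|y - y'|.
  by rewrite xE; apply: le_trans (ler_normB _ _) _; rewrite lerD2l.
have qx : 0 <= Q * `|x - x'| by rewrite mulr_ge0//; lra.
have qy : 0 <= Q * `|y - y'| by rewrite mulr_ge0//; lra.
have b5 : `|x - x'| + 2 * Q * `|y - y'| <= (1 + 2 * Q) * T by rewrite /T; lra.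
split; first by apply: le_trans g1; lra.
apply: le_trans g2.
have -> : `|l - l'| = 2 / e * `|y - y'|.
  by rewrite yE normrM normrN [`|e / 2|]ger0_norm ?divr_ge0 ?ltW//; field; rewrite gt_eqF.
rewrite -[leRHS]mulrA; apply: ler_wpM2l; first by rewrite divr_ge0// ltW.
by rewrite /T; lra.
Qed.

Let right_colip kap t t' l l' : slant kap -> 1 / 2 <= t <= 1 -> 1 / 2 <= t' <= 1 ->
  0 <= l <= 1 -> 0 <= l' <= 1 ->
  `|t - t'| <= C1 * taxi (lower kap t l) (lower kap t' l') /\
  `|l - l'| <= C1 * taxi (lower kap t l) (lower kap t' l').
Proof.
move=> h /andP[t0 t1] /andP[t0' t1'] /andP[l0 l1] /andP[l0' l1'].
have e0 := collar_gt0 K; have e16 := collar_le; have q0 := k2_lt1 K.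
have [c1 c2] := bend_bounds K; have k0 := k_ge0 K; have k1 := k_lt1 K; have q1 := Q1.
have T0 := taxi_ge0 (lower kap t l) (lower kap t' l').
have [g1 g2] := C1_ge T0.
move: T0 g1 g2; rewrite /taxi !lower_right//=.
set x := c + (2 * t - 1) * _; set x' := c + _.
have xE : x - x' = 2 * (t - t') * (1 / 2 - c) by rewrite /x /x'; ring.
set y := (1 - l) * _ - _; set y' := (1 - l') * _ - _.
have yE : (l - l') * (slope_in x' + e) = (1 - l) * (slope_in x - slope_in x') - (y - y').
  by rewrite /y /y'; ring.
set T := `|x - x'| + `|y - y'| => T0 g1 g2.
have nx := normr_ge0 (x - x'); have ny := normr_ge0 (y - y').
have qx : 0 <= Q * `|x - x'| by rewrite mulr_ge0//; lra.
have qy : 0 <= Q * `|y - y'| by rewrite mulr_ge0//; lra.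
have tb : `|t - t'| <= 4 * Q * `|x - x'|.
  have : (1 - k ^+ 2) / 4 * `|t - t'| <= `|x - x'|.
    rewrite xE !normrM [`|2|]ger0_norm// [`|1 / 2 - c|]ger0_norm; last by lra.
    by rewrite [leRHS]mulrAC; apply: ler_wpM2r => //; lra.
  move=> H; have : 4 * Q * ((1 - k ^+ 2) / 4 * `|t - t'|) <= 4 * Q * `|x - x'|.
    by rewrite ler_wpM2l//; lra.
  have -> // : 4 * Q * ((1 - k ^+ 2) / 4 * `|t - t'|) = `|t - t'| by field; rewrite gt_eqF.
split; first by apply: le_trans tb (le_trans _ g1); rewrite /T; lra.
apply: le_trans g2.
have xc : c <= x' by rewrite /x'; nra.
have s2 : e / 2 <= slope_in x' + e.
  by have [+ _] := slope_in_lip K xc; rewrite slope_in_c; lra.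
have lb : `|l - l'| * (e / 2) <= (1 + 2 * Q) * T.
  have : `|l - l'| * (e / 2) <= `|(l - l') * (slope_in x' + e)|.
    by rewrite normrM ler_wpM2l// ger0_norm//; lra.
  rewrite yE.
  have : `|(1 - l) * (slope_in x - slope_in x')| <= 2 * Q * `|x - x'|.
    rewrite normrM; apply: le_trans (slope_norm x x'); apply: ler_piMl => //.
    by rewrite ler_norml; lra.
  have := ler_normB ((1 - l) * (slope_in x - slope_in x')) (y - y').
  rewrite /T; lra.
have -> : `|l - l'| = 2 / e * (`|l - l'| * (e / 2)) by field; rewrite gt_eqF.
by rewrite -[leRHS]mulrA; apply: ler_wpM2l => //; rewrite divr_ge0// ltW.
Qed.

Lemma lower_colip : exists2 C : R, 0 < C & forall kap t t' l l', slant kap ->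
  0 <= t <= 1 -> 0 <= t' <= 1 -> 0 <= l <= 1 -> 0 <= l' <= 1 ->
  `|t - t'| <= C * taxi (lower kap t l) (lower kap t' l') /\
  `|l - l'| <= C * taxi (lower kap t l) (lower kap t' l').
Proof.
exists (3 * C1) => [|kap t t' l l' h]; first by rewrite mulr_gt0.
have c0 := C1_pos.
wlog tt : t t' l l' / t <= t'.
  move=> H t01 t01' l01 l01'; have [a|a] := leP t t'; first exact: H.
  by rewrite taxiC distrC [`|l - _|]distrC; apply: H => //; exact: ltW.
move=> /andP[t0 t1] /andP[t0' t1'] l01 l01'.
have T0 := taxi_ge0 (lower kap t l) (lower kap t' l').
have CT : 0 <= C1 * taxi (lower kap t l) (lower kap t' l') by rewrite mulr_ge0// ltW.
have [a|a] := leP t' (1 / 2).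
  have i1 : 0 <= t <= 1 / 2 by lra.
  have i2 : 0 <= t' <= 1 / 2 by lra.
  by have [? ?] := left_colip h i1 i2 l01 l01'; split; lra.
have [b|b] := leP (1 / 2) t.
  have i1 : 1 / 2 <= t <= 1 by lra.
  have i2 : 1 / 2 <= t' <= 1 by lra.
  by have [? ?] := right_colip h i1 i2 l01 l01'; split; lra.
have i1 : 0 <= t <= 1 / 2 by lra.
have i2 : 1 / 2 <= t' <= 1 by lra.
have i3 : 0 <= (1 / 2 : R) <= 1 / 2 by lra.
have i4 : 1 / 2 <= (1 / 2 : R) <= 1 by lra.
(* cross the line x = c at the height of the left point: neither leg is longer than the whole *)
have [_ _ pc] := lower_left_box K h i1 l01.
have [_ _ qc] := lower_right_box K h i2 l01'.
have mE : lower kap (1 / 2) l = (c, (lower kap t l).2).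
  by rewrite /lower lexx (ltW b)/=; congr pair; field.
have d1 : taxi (lower kap t l) (lower kap (1 / 2) l) <= taxi (lower kap t l) (lower kap t' l').
  rewrite mE /taxi/= subrr normr0 addr0.
  have := normr_ge0 ((lower kap t l).2 - (lower kap t' l').2).
  have -> : `|(lower kap t l).1 - c| = c - (lower kap t l).1 by rewrite ler0_norm; lra.
  have -> : `|(lower kap t l).1 - (lower kap t' l').1| = (lower kap t' l').1 - (lower kap t l).1.
    by rewrite ler0_norm; lra.
  lra.
have d2 : taxi (lower kap (1 / 2) l) (lower kap t' l') <= taxi (lower kap t l) (lower kap t' l').
  rewrite mE /taxi/= lerD2r !ler0_norm; lra.
have [e1 e2] := left_colip h i1 i3 l01 l01.
have [e3 e4] := right_colip h i4 i2 l01 l01'.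
have := ler_wpM2l (ltW c0) d1; have := ler_wpM2l (ltW c0) d2 => f1 f2.
split.
  have := ler_distD (1 / 2) t t'; lra.
lra.
Qed.
End TileDistortion.

(** * The self-similar map of the half box *)

Section KochMap.
Hypothesis K : koch_ratio k s.
Lemma fold0_dist p q : dist (fold0 p) (fold0 q) = s * dist p q.
Proof.
have s0 := s_gt0 K; rewrite /euclidean_dist /fold0/=.
have -> : s = Num.sqrt (s ^+ 2) by rewrite sqrtr_sqr gtr0_norm.
rewrite -sqrtrM ?sqr_ge0//; congr Num.sqrt; have := s_sqr K => sE.
have -> : s ^+ 2 = (1 + k ^+ 2) / 4 by lra.
by field.
Qed.

Lemma fold1_dist p q : dist (fold1 p) (fold1 q) = s * dist p q.
Proof.
rewrite /fold1 fold0_dist /euclidean_dist/=; congr (_ * Num.sqrt (_ + _)).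
by rewrite -sqrrN; congr (_ ^+ 2); ring.
Qed.

Lemma box_norm kap p : slant kap -> box kap p -> `|p.1| <= 1 / 2 /\ `|p.2| <= 1.
Proof.
move=> h [h1 h2 h3 h4]; have p0 := slant_kap_lt1 K h; have [a b] := top0_bounds K h.
have [e0 eE] := (collar_gt0 K, collarE); have k0 := k_ge0 K; have k1 := k_lt1 K.
have [c1 c2] := slant_collar K h; have el := collar_le.
have x1 : - (1 / 8) <= p.1.
  have [kp|kp] := leP 0 kap.
    have : kap * - e <= kap * p.2 by rewrite ler_wpM2l.
    have : k * e <= 1 * (1 / 16) by apply: ler_pM => //; exact: ltW.
    lra.
  have : kap * (k * p.1 + e) <= kap * p.2 by rewrite ler_wnM2l// ltW.
  move=> h5; have : kap * e <= p.1 * (1 - k * kap) by lra.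
  by rewrite -ler_pdivrMr// => h6; exact: le_trans a h6.
have : k * p.1 <= k * (1 / 2) by rewrite ler_wpM2l.
split; rewrite ler_norml; lra.
Qed.

Lemma box_dist kap p q : slant kap -> box kap p -> box kap q -> dist p q <= 3.
Proof.
move=> h /(box_norm h)[]; rewrite !ler_norml => p1 p2 /(box_norm h)[]; rewrite !ler_norml => q1 q2.
have -> : 3 = 1 + 2 :> R by ring.
by apply: euclidean_dist_le; rewrite ler_norml; lra.
Qed.

Lemma box00 kap : box kap (0, 0).
Proof. by have e0 := collar_gt0 K; split=> /=; rewrite ?mulr0//; lra. Qed.

(** On a tile the approximations are final from the first step that reaches it;
    the initial value only has to lie in all boxes. *)
Fixpoint koch_step (n : nat) kap t v : R * R :=
  if n is n'.+1 then
    if s <= `|v| then tile kap t v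
    else if t <= 1 / 2 then fold0 (koch_step n' (flip kap) (2 * t) (- v / s))
    else fold1 (koch_step n' k (2 - 2 * t) (- v / s))
  else (0, 0).

Definition koch kap t v : R * R :=
  (geometric_limit 3 s (fun n => (koch_step n kap t v).1),
   geometric_limit 3 s (fun n => (koch_step n kap t v).2)).

Arguments koch : simpl never.

Definition strip t v := (0 <= t <= 1) && (`|v| <= 1).

Lemma strip_tile t v : strip t v -> s <= `|v| ->
  [/\ 0 <= t <= 1, 0 <= (`|v| - s) / (1 - s) <= 1 &
    tile = fun kap t v => if 0 <= v then upper kap t ((`|v| - s) / (1 - s))
                          else lower kap t ((`|v| - s) / (1 - s))].
Proof.
have s1 : 0 < 1 - s by rewrite subr_gt0; exact: s_lt1 K.
move=> /andP[t01 v1] sv; split => //.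
  by rewrite ler_pdivlMr// ler_pdivrMr// mul0r mul1r subr_ge0 sv lerD2r.
apply/funext => kap'; apply/funext => t'; apply/funext => v'; rewrite /tile.
by case: leP => a; [rewrite ger0_norm|rewrite ltr0_norm].
Qed.

Lemma tile_box kap t v : slant kap -> strip t v -> s <= `|v| -> box kap (tile kap t v).
Proof.
move=> h st sv; have [t01 l01 ->] := strip_tile st sv.
by case: ifP => _; [have [] := upper_box K h t01 l01|have [] := lower_box K h t01 l01].
Qed.

Lemma strip_shrink v : `|v| <= s -> `|- v / s| <= 1.
Proof. by have s0 := s_gt0 K => h; rewrite normrM normrN normfV (gtr0_norm s0) ler_pdivrMr// mul1r. Qed.

Lemma strip_child0 t v : strip t v -> `|v| <= s -> t <= 1 / 2 -> strip (2 * t) (- v / s).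
Proof. by move=> /andP[t01 _] /strip_shrink v1 th; rewrite /strip v1 andbT; lra. Qed.

Lemma strip_child1 t v : strip t v -> `|v| <= s -> 1 / 2 <= t -> strip (2 - 2 * t) (- v / s).
Proof. by move=> /andP[t01 _] /strip_shrink v1 th; rewrite /strip v1 andbT; lra. Qed.

Lemma koch_step_box n kap t v : slant kap -> strip t v -> box kap (koch_step n kap t v).
Proof.
elim: n kap t v => [|n IH] kap t v h st /=; first exact: box00.
have [sv|/ltW sv] := leP s `|v|; first exact: tile_box.
have [th|/ltW th] := leP t (1 / 2).
  by apply: (box_fold0 K) => //; apply: IH; [exact: slant_flip K _ h|exact: strip_child0].
by apply: (box_fold1 K) => //; apply: IH; [exact: slant_k K|exact: strip_child1].
Qed.

Lemma koch_step_cauchy n m kap t v : slant kap -> strip t v ->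
  dist (koch_step (n + m) kap t v) (koch_step n kap t v) <= 3 * s ^+ n.
Proof.
have s0 := s_gt0 K.
elim: n kap t v => [|n IH] kap t v h st.
  by rewrite expr0 mulr1 (box_dist h)//; [exact: koch_step_box|exact: box00].
rewrite addSn /= exprS mulrCA.
have [sv|/ltW sv] := leP s `|v|.
  by rewrite /euclidean_dist !subrr expr0n/= addr0 sqrtr0 !mulr_ge0// ?exprn_ge0// ltW.
have [th|/ltW th] := leP t (1 / 2).
  by rewrite fold0_dist ler_pM2l// IH//; [exact: slant_flip K _ h|exact: strip_child0].
by rewrite fold1_dist ler_pM2l// IH//; [exact: slant_k K|exact: strip_child1].
Qed.

Lemma koch_close n kap t v : slant kap -> strip t v ->
  dist (koch kap t v) (koch_step n kap t v) <= 6 * s ^+ n.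
Proof.
move=> h st; have -> : 6 * s ^+ n = 3 * s ^+ n + 3 * s ^+ n by ring.
by apply: euclidean_dist_le; apply: geometric_limitP => i j;
  apply: le_trans (koch_step_cauchy i j h st); rewrite ?dist1_le ?dist2_le.
Qed.

Lemma koch_unique kap t v p : slant kap -> strip t v ->
  (exists C, forall n, dist p (koch_step n kap t v) <= C * s ^+ n) -> p = koch kap t v.
Proof.
move=> h st [C hC]; apply: euclidean_dist_eq0.
apply: (@le_geometric _ s _ _ (C + 6)); [exact: ltW (s_gt0 K)|exact: s_lt1 K|move=> n].
rewrite add0r mulrDl; apply: le_trans (euclidean_dist_triangle _ (koch_step n kap t v) _) _.
by apply: lerD => //; rewrite euclidean_distC koch_close.
Qed.

Lemma koch_tile kap t v : slant kap -> strip t v -> s <= `|v| -> koch kap t v = tile kap t v.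
Proof.
move=> h st sv; apply/esym/koch_unique => //; exists 3 => -[|n] /=.
  by rewrite expr0 mulr1 (box_dist h)//; [exact: tile_box|exact: box00].
by rewrite sv /euclidean_dist !subrr expr0n/= addr0 sqrtr0 mulr_ge0// ?exprn_ge0// ltW// (s_gt0 K).
Qed.

Lemma koch_lim_le (a b C : R) kap t v : slant kap -> strip t v ->
  (forall n, a * (koch_step n kap t v).1 + b * (koch_step n kap t v).2 <= C) ->
  a * (koch kap t v).1 + b * (koch kap t v).2 <= C.
Proof.
move=> h st hn.
apply: (@le_geometric _ s _ _ (6 * (`|a| + `|b|))); [exact: ltW (s_gt0 K)|exact: s_lt1 K|move=> n].
have := koch_close n h st; set q := koch_step n kap t v; set p := koch kap t v => d.
have := hn n; rewrite -/q => hq.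
have A : a * (p.1 - q.1) <= `|a| * (6 * s ^+ n).
  by apply: le_trans (ler_norm _) _; rewrite normrM ler_wpM2l// (le_trans (dist1_le _ _)).
have B : b * (p.2 - q.2) <= `|b| * (6 * s ^+ n).
  by apply: le_trans (ler_norm _) _; rewrite normrM ler_wpM2l// (le_trans (dist2_le _ _)).
lra.
Qed.

Lemma koch_box kap t v : slant kap -> strip t v -> box kap (koch kap t v).
Proof.
move=> h st; have B n : box kap (koch_step n kap t v) by exact: koch_step_box.
split.
- have : 0 * (koch kap t v).1 + (-1) * (koch kap t v).2 <= e.
    by apply: koch_lim_le => // n; have [? _ _ _] := B n; lra.
  lra.
- have : (- k) * (koch kap t v).1 + 1 * (koch kap t v).2 <= e.
    by apply: koch_lim_le => // n; have [_ ? _ _] := B n; lra.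
  lra.
- have : 1 * (koch kap t v).1 + 0 * (koch kap t v).2 <= 1 / 2.
    by apply: koch_lim_le => // n; have [_ _ ? _] := B n; lra.
  lra.
- have : (-1) * (koch kap t v).1 + kap * (koch kap t v).2 <= 0.
    by apply: koch_lim_le => // n; have [_ _ _ ?] := B n; lra.
  lra.
Qed.

(** The definition of [flip] is what propagates this from the folded box. *)
Lemma koch_column_step n kap v : slant kap -> `|v| <= 1 ->
  (koch_step n kap 0 v).1 = kap * (koch_step n kap 0 v).2.
Proof.
elim: n kap v => [|n IH] kap v h v1 /=; first by rewrite mulr0.
have [sv|/ltW sv] := leP s `|v|.
  by rewrite /tile; case: ifP => _; [exact: upper_col K _ _ h|exact: lower_col].
have -> : 0 <= 1 / 2 :> R by lra.
have IH' := IH _ _ (slant_flip K h) (strip_shrink sv).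
rewrite mulr0 /fold0/= IH'; have := flip_eq K h; set f := flip kap.
set y := (koch_step _ _ _ _).2 => fE.
suff : y * (f * (1 - k * kap)) = y * - (kap + k) by lra.
by rewrite fE.
Qed.

Lemma koch_column kap v : slant kap -> `|v| <= 1 -> (koch kap 0 v).1 = kap * (koch kap 0 v).2.
Proof.
move=> h v1; have st : strip 0 v by rewrite /strip v1 andbT; lra.
have a : 1 * (koch kap 0 v).1 + (- kap) * (koch kap 0 v).2 <= 0.
  by apply: koch_lim_le => // n; rewrite koch_column_step//; lra.
have b : (-1) * (koch kap 0 v).1 + kap * (koch kap 0 v).2 <= 0.
  by apply: koch_lim_le => // n; rewrite koch_column_step//; lra.
lra.
Qed.

Let koch_fold0_lt kap t v : slant kap -> strip t v -> `|v| < s -> t <= 1 / 2 ->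
  koch kap t v = fold0 (koch (flip kap) (2 * t) (- v / s)).
Proof.
move=> h st sv th; apply/esym/koch_unique => //.
have st' := strip_child0 st (ltW sv) th; have h' := slant_flip K h.
exists 6 => -[|n] /=.
  rewrite expr0 mulr1; have -> : 6 = 3 + 3 :> R by ring.
  by rewrite ler_wpDr// (box_dist h)//; [apply: (box_fold0 K) => //; exact: koch_box|exact: box00].
have -> : (s <= `|v|) = false by rewrite leNgt sv.
rewrite th fold0_dist exprS mulrCA ler_pM2l ?(s_gt0 K)//.
exact: koch_close.
Qed.

Let koch_fold1_lt kap t v : slant kap -> strip t v -> `|v| < s -> 1 / 2 < t ->
  koch kap t v = fold1 (koch k (2 - 2 * t) (- v / s)).
Proof.
move=> h st sv th; apply/esym/koch_unique => //.
have st' := strip_child1 st (ltW sv) (ltW th); have h' := slant_k K.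
exists 6 => -[|n] /=.
  rewrite expr0 mulr1; have -> : 6 = 3 + 3 :> R by ring.
  by rewrite ler_wpDr// (box_dist h)//; [apply: (box_fold1 K) => //; exact: koch_box|exact: box00].
have -> : (s <= `|v|) = false by rewrite leNgt sv.
have -> : (t <= 1 / 2) = false by rewrite leNgt th.
rewrite fold1_dist exprS mulrCA ler_pM2l ?(s_gt0 K)//.
exact: koch_close.
Qed.

(** Off the tiles, at t = 1 the second fold applies, which uses the box of slant k
    whatever kap is; and this fold sends the left side x = k y to the line x = 1/2. *)
Lemma koch_axis kap v : slant kap -> `|v| <= 1 ->
  (koch kap 1 v).1 = 1 / 2 /\ koch kap 1 v = koch k 1 v.
Proof.
have h' := slant_k K.
move=> h v1; have st : strip 1 v by rewrite /strip v1 andbT; lra.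
have [sv|sv] := leP s `|v|.
  rewrite !koch_tile// /tile; case: ifP => _; first by rewrite !upper_axis.
  by rewrite !lower_axis.
have o : 1 / 2 < 1 :> R by lra.
rewrite koch_fold1_lt//; split; last by rewrite [RHS]koch_fold1_lt.
have -> : 2 - 2 * 1 = 0 :> R by ring.
have := koch_column h' (strip_shrink (ltW sv)).
by case: (koch k 0 _) => x y /= ->; field.
Qed.

Let norm_s v : `|v| = s -> v = s \/ v = - s.
Proof.
by have := s_gt0 K; case: (leP 0 v) => a; [rewrite ger0_norm//; left|rewrite ltr0_norm//; right; lra].
Qed.

Let one_strip t : 0 <= t <= 1 -> strip t 1 /\ strip t (- 1).
Proof. by move=> t1; rewrite /strip t1 normrN normr1 lexx. Qed.

Lemma koch_top kap t : slant kap -> 0 <= t <= 1 -> koch kap t 1 = (top kap t, k * top kap t + e).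
Proof.
have s1 := s_lt1 K.
move=> h /one_strip[st _]; rewrite koch_tile//; last by rewrite normr1 ltW.
rewrite /tile ler01 divff ?upper_top// gt_eqF// subr_gt0//.
Qed.

Lemma koch_bot kap t : slant kap -> 0 <= t <= 1 -> koch kap t (- 1) = (bot kap t, - e).
Proof.
have s1 := s_lt1 K.
move=> h /one_strip[_ st]; rewrite koch_tile//; last by rewrite normrN normr1 ltW.
rewrite /tile ler0N1 opprK divff ?lower_bot// gt_eqF// subr_gt0//.
Qed.

(** On |v| = s, where the tile applies as well, this is the gluing condition of
    the tiles. *)
Lemma koch_fold0 kap t v : slant kap -> strip t v -> `|v| <= s -> t <= 1 / 2 ->
  koch kap t v = fold0 (koch (flip kap) (2 * t) (- v / s)).
Proof.
have s0 := s_gt0 K.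
move=> h st; rewrite le_eqVlt => /predU1P[|] sv th; last exact: koch_fold0_lt.
have /andP[t01 _] := st; have t2 : 0 <= 2 * t <= 1 by lra.
have h' := slant_flip K h.
rewrite koch_tile ?sv//; have [->|->] := norm_s sv; rewrite /tile.
  by rewrite (ltW s0) subrr mul0r mulNr divff ?gt_eqF// koch_bot// upper_inl.
by rewrite oppr_ge0 leNgt s0/= opprK subrr mul0r divff ?gt_eqF// koch_top// (lower_inl K).
Qed.

(** For t = 1/2 the two folds agree because the values at t = 1 lie on x = 1/2 and
    do not depend on the slant. *)
Lemma koch_fold1 kap t v : slant kap -> strip t v -> `|v| <= s -> 1 / 2 <= t ->
  koch kap t v = fold1 (koch k (2 - 2 * t) (- v / s)).
Proof.
have s0 := s_gt0 K; have h' := slant_k K.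
move=> h st sv; rewrite le_eqVlt => /predU1P[th|th].
  have th' : t <= 1 / 2 by rewrite th.
  rewrite koch_fold0// -th.
  have -> : 2 - 2 * (1 / 2) = 1 :> R by field.
  have -> : 2 * (1 / 2) = 1 :> R by field.
  have sv' := strip_shrink sv.
  have [x ->] := koch_axis (slant_flip K h) sv'; have [+ _] := koch_axis h' sv'.
  by case: (koch k 1 _) => a b /= ->; rewrite /fold1 /fold0/=; congr pair; field.
move: sv; rewrite le_eqVlt => /predU1P[|] sv; last exact: koch_fold1_lt.
have /andP[t01 _] := st; have t2 : 0 <= 2 - 2 * t <= 1 by lra.
rewrite koch_tile ?sv//; have [->|->] := norm_s sv; rewrite /tile.
  by rewrite (ltW s0) subrr mul0r mulNr divff ?gt_eqF// koch_bot// upper_inr// ltW.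
by rewrite oppr_ge0 leNgt s0/= opprK subrr mul0r divff ?gt_eqF// koch_top// (lower_inr K)// ltW.
Qed.
Lemma lift_depth v : `|- (s * v)| = s * `|v|.
Proof. by rewrite normrN normrM (gtr0_norm (s_gt0 K)). Qed.

Let lift_depthK v : - - (s * v) / s = v.
Proof. by field; exact: lt0r_neq0 (s_gt0 K). Qed.

Let lift_depth_le v : `|v| <= 1 -> `|- (s * v)| <= s /\ `|- (s * v)| <= 1.
Proof.
have [s0 s1] := (s_gt0 K, s_lt1 K); rewrite lift_depth => v1.
have sv : s * `|v| <= s by rewrite ler_piMr// ltW.
by split => //; rewrite (le_trans sv)// ltW.
Qed.

Lemma koch_lift0 kap t v : slant kap -> strip t v ->
  strip (t / 2) (- (s * v)) /\ koch kap (t / 2) (- (s * v)) = fold0 (koch (flip kap) t v).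
Proof.
move=> h /andP[t01 /lift_depth_le[v1 v2]]; have t2 : t / 2 <= 1 / 2 by lra.
have st : strip (t / 2) (- (s * v)) by rewrite /strip v2 andbT; lra.
by split => //; rewrite (koch_fold0 h st v1 t2) lift_depthK mulrC divfK.
Qed.

Lemma koch_lift1 kap t v : slant kap -> strip t v ->
  strip (1 - t / 2) (- (s * v)) /\ koch kap (1 - t / 2) (- (s * v)) = fold1 (koch k t v).
Proof.
move=> h /andP[t01 /lift_depth_le[v1 v2]]; have t2 : 1 / 2 <= 1 - t / 2 by lra.
have st : strip (1 - t / 2) (- (s * v)) by rewrite /strip v2 andbT; lra.
split => //; rewrite (koch_fold1 h st v1 t2) lift_depthK.
by have -> : 2 - 2 * (1 - t / 2) = t by field.
Qed.

End KochMap.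

(** * Lipschitz bounds *)

Section LipschitzBounds.
Hypothesis K : koch_ratio k s.
Lemma tile_lip : exists2 C : R, 1 <= C & forall kap t t' v v', slant kap ->
  strip t v -> strip t' v' -> s <= `|v| -> s <= `|v'| -> (0 <= v) = (0 <= v') ->
  dist (tile kap t v) (tile kap t' v') <= C * (`|t - t'| + `|v - v'|).
Proof.
have s1 : 0 < 1 - s by rewrite subr_gt0 (s_lt1 K).
have q0 := k2_lt1 K; have k2 := sqr_ge0 k.
have i1 : 1 <= (1 - s)^-1 by rewrite invf_ge1//; have := s_gt0 K; lra.
have i2 : 1 <= (1 - k ^+ 2)^-1 by rewrite invf_ge1//; lra.
have i3 : 1 <= (1 - k ^+ 2)^-1 * (1 - s)^-1 by rewrite -[X in X <= _]mulr1; apply: ler_pM.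
exists (6 * ((1 - k ^+ 2)^-1 * (1 - s)^-1)) => [|kap t t' v v' h st st' sv sv' sg]; first lra.
have [t01 l01 E1] := strip_tile K st sv; have [t01' l01' E2] := strip_tile K st' sv'.
have lE : `|(`|v| - s) / (1 - s) - (`|v'| - s) / (1 - s)| = (1 - s)^-1 * `|v - v'|.
  rewrite -mulrBl normrM mulrC normfV (gtr0_norm s1); congr (_ * _).
  have -> : `|v| - s - (`|v'| - s) = `|v| - `|v'| by ring.
  have [a|a] := leP 0 v; first by move: sg; rewrite a => /esym b; rewrite (ger0_norm a) (ger0_norm b).
  move: sg; rewrite leNgt a => /esym/negbT; rewrite -ltNge => b.
  by rewrite (ltr0_norm a) (ltr0_norm b) distrC; congr (`|_|); ring.
rewrite (congr1 (fun f => f kap t v) E1) (congr1 (fun f => f kap t' v') E2) sg.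
have B a b : taxi a b <= 6 * (1 - k ^+ 2)^-1 * (`|t - t'| + (1 - s)^-1 * `|v - v'|) ->
    dist a b <= 6 * ((1 - k ^+ 2)^-1 * (1 - s)^-1) * (`|t - t'| + `|v - v'|).
  move=> H; have [d _] := euclidean_dist_taxi a b; apply: le_trans d (le_trans H _).
  have : (1 - k ^+ 2)^-1 * `|t - t'| <= (1 - k ^+ 2)^-1 * (1 - s)^-1 * `|t - t'|.
    by rewrite ler_wpM2r// ler_peMr//; exact: le_trans ler01 i2.
  lra.
apply: B; rewrite -lE; case: ifP => _; last exact: (lower_lip K h t01 t01' l01 l01').
apply: le_trans (upper_lip K h t01 t01' l01 l01') _; rewrite ler_wpM2r ?addr_ge0//; lra.
Qed.

Lemma tile_colip : exists2 C : R, 1 <= C & forall kap t t' v v', slant kap ->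
  strip t v -> strip t' v' -> s <= `|v| -> s <= `|v'| -> (0 <= v) = (0 <= v') ->
  `|t - t'| <= C * dist (tile kap t v) (tile kap t' v') /\
  `|v - v'| <= C * dist (tile kap t v) (tile kap t' v').
Proof.
have s1 : 0 < 1 - s by rewrite subr_gt0 (s_lt1 K).
have s0 := s_gt0 K.
have [A A0 hA] := upper_colip K; have [B B0 hB] := lower_colip K.
exists (2 * (A + B) + 1) => [|kap t t' v v' h st st' sv sv' sg]; first lra.
have [t01 l01 E1] := strip_tile K st sv; have [t01' l01' E2] := strip_tile K st' sv'.
have lE : `|v - v'| = (1 - s) * `|(`|v| - s) / (1 - s) - (`|v'| - s) / (1 - s)|.
  rewrite -mulrBl normrM [RHS]mulrC normfV (gtr0_norm s1) divfK ?gt_eqF//.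
  have -> : `|v| - s - (`|v'| - s) = `|v| - `|v'| by ring.
  have [a|a] := leP 0 v; first by move: sg; rewrite a => /esym b; rewrite (ger0_norm a) (ger0_norm b).
  move: sg; rewrite leNgt a => /esym/negbT; rewrite -ltNge => b.
  by rewrite (ltr0_norm a) (ltr0_norm b) distrC; congr (`|_|); ring.
rewrite (congr1 (fun f => f kap t v) E1) (congr1 (fun f => f kap t' v') E2) sg lE.
set l := _ / _ in l01 E1 lE *; set l' := _ / _ in l01' E2 lE *.
have Z a b C : 0 <= C -> C <= A + B -> `|t - t'| <= C * taxi a b /\ `|l - l'| <= C * taxi a b ->
    `|t - t'| <= (2 * (A + B) + 1) * dist a b /\ (1 - s) * `|l - l'| <= (2 * (A + B) + 1) * dist a b.
  move=> C0 CA [H1 H2]; have [_ d] := euclidean_dist_taxi a b.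
  have H : C * taxi a b <= (2 * (A + B) + 1) * dist a b.
    apply: (@le_trans _ _ ((A + B) * (2 * dist a b))); first by apply: ler_pM => //; exact: taxi_ge0.
    by rewrite mulrA [_ * 2]mulrC ler_wpM2r ?euclidean_dist_ge0// lerDl.
  split; first exact: le_trans H1 H.
  by apply: le_trans (le_trans _ H2) H; rewrite ler_piMl// gerBl ltW.
case: ifP => _; first by apply: (Z _ _ A); [exact: ltW|rewrite lerDl ltW|exact: hA].
by apply: (Z _ _ B); [exact: ltW|rewrite lerDr ltW|exact: hB].
Qed.

(** Folding multiplies both |v - v'| and distances by s, so the constant of the
    tiles is not deteriorated; and a vertical segment that crosses |v| = s is cut
    there, where distances in v add up. *)
Lemma koch_vertical : exists2 C : R, 1 <= C & forall kap t v v', slant kap ->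
  strip t v -> strip t v' -> dist (koch kap t v) (koch kap t v') <= C * `|v - v'|.
Proof.
have s0 := s_gt0 K; have sh := s_ge_half K; have s1 := s_lt1 K.
have [A A1 hA] := tile_lip; exists (A + 3) => [|kap t v v' h st st']; first lra.
apply: (@le_geometric _ s _ _ 3) => [||N]; [exact: ltW|by []|].
elim: N kap t v v' h st st' => [|N IH] kap t v v' h st st'.
  by rewrite expr0 mulr1 ler_wpDl ?mulr_ge0//; [lra|apply: (box_dist K h); exact: (koch_box K)].
wlog vv : v v' st st' / v' <= v.
  move=> H; have [a|/ltW a] := leP v' v; first exact: H.
  by rewrite euclidean_distC distrC; exact: H.
have child u u' : strip t u -> strip t u' -> `|u| <= s -> `|u'| <= s ->
    dist (koch kap t u) (koch kap t u') <= (A + 3) * `|u - u'| + 3 * s ^+ N.+1.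
  move=> su su' us us'.
  have E : (A + 3) * `|u - u'| + 3 * s ^+ N.+1 = s * ((A + 3) * `|- u / s - - u' / s| + 3 * s ^+ N).
    have -> : - u / s - - u' / s = (u' - u) / s by field; rewrite gt_eqF.
    rewrite normrM normfV (gtr0_norm s0) distrC exprS; field; exact: lt0r_neq0.
  have [th|/ltW th] := leP t (1 / 2).
    rewrite (koch_fold0 K h su us th) (koch_fold0 K h su' us' th) (fold0_dist K) E ler_pM2l//.
    by apply: IH; [exact: slant_flip K _ h|exact: (strip_child0 K)..].
  rewrite (koch_fold1 K h su us th) (koch_fold1 K h su' us' th) (fold1_dist K) E ler_pM2l//.
  by apply: IH; [exact: slant_k K|exact: (strip_child1 K)..].
have same u u' : strip t u -> strip t u' -> s <= `|u| -> s <= `|u'| -> (0 <= u) = (0 <= u') ->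
    dist (koch kap t u) (koch kap t u') <= (A + 3) * `|u - u'|.
  move=> su su' us us' sg; rewrite !(koch_tile K)//; apply: le_trans (hA _ _ _ _ _ h su su' us us' sg) _.
  by rewrite subrr normr0 add0r ler_wpM2r//; lra.
have err : 0 <= 3 * s ^+ N.+1 by rewrite mulr_ge0// exprn_ge0// ltW.
have /andP[t01 _] := st.
have ns : `|s| = s by exact: gtr0_norm.
have nm : `|- s| = s by rewrite normrN.
have sts : strip t s by rewrite /strip t01 ns ltW.
have stm : strip t (- s) by rewrite /strip t01 nm ltW.
have [a|/ltW a] := leP s v.
  have [b|/ltW b] := leP s v'.
    by rewrite ler_wpDr// same//; [exact: depth_pos|exact: depth_pos|exact: same_sign_pos s0 a b].
  have [d|/ltW d] := leP v' (- s).
    have far : 1 <= `|v - v'| by apply: le_trans (ler_norm _); lra.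
    apply: (@le_trans _ _ (3 * 1)).
      by rewrite mulr1; apply: (box_dist K h); exact: (koch_box K).
    by rewrite ler_wpDr//; apply: ler_pM => //; rewrite lerDr; exact: le_trans A1.
  rewrite (normB_chain b a) mulrDr -addrA.
  apply: le_trans (euclidean_dist_triangle _ (koch kap t s) _) (lerD _ _).
    by apply: same; rewrite ?ns//; [exact: depth_pos|exact: same_sign_pos s0 a (lexx s)].
  by apply: child; rewrite ?ns// ler_norml d b.
have [d|/ltW d] := leP (- s) v'.
  by apply: child; rewrite // ler_norml ?d ?a ?(le_trans vv a) ?(le_trans d vv).
have [b|/ltW b] := leP v (- s).
  by rewrite ler_wpDr// same//; [exact: depth_neg|exact: depth_neg|exact: same_sign_neg s0 b d].
rewrite (normB_chain d b) mulrDr addrAC.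
apply: le_trans (euclidean_dist_triangle _ (koch kap t (- s)) _) (lerD _ _).
  by apply: child; rewrite ?nm// ler_norml a b.
by apply: same; rewrite ?nm//; [exact: depth_neg|exact: same_sign_neg s0 (lexx _) d].
Qed.

(** A fold halves t and multiplies distances by s, so that it multiplies the
    Lipschitz constant by 2 s; for |v| >= s^(m + 1) there are at most m folds. *)
Lemma koch_horizontal : exists2 C : R, 1 <= C & forall m kap t t' v, slant kap ->
  strip t v -> strip t' v -> s ^+ m.+1 <= `|v| ->
  dist (koch kap t v) (koch kap t' v) <= C * (2 * s) ^+ m * `|t - t'|.
Proof.
have s0 := s_gt0 K; have sh := s_ge_half K; have s1 := s_lt1 K.
have [A A1 hA] := tile_lip; exists A => // m kap t t' v.
elim: m kap t t' v => [|m IH] kap t t' v h st st' sv.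
  rewrite expr1 in sv; rewrite expr0 mulr1 !(koch_tile K)//.
  by apply: le_trans (hA _ _ _ _ _ h st st' sv sv erefl) _; rewrite subrr normr0 addr0.
have [a|/ltW a] := leP s `|v|.
  rewrite !(koch_tile K)//; apply: le_trans (hA _ _ _ _ _ h st st' a a erefl) _.
  rewrite subrr normr0 addr0 ler_wpM2r// ler_peMr//; first lra.
  by rewrite exprn_ege1//; lra.
wlog tt : t t' st st' / t <= t'.
  move=> H; have [b|/ltW b] := leP t t'; first exact: H.
  by rewrite euclidean_distC distrC; exact: H.
have sv' : s ^+ m.+1 <= `|- v / s|.
  by rewrite normrM normrN normfV (gtr0_norm s0) ler_pdivlMr// mulrC -exprS.
have left u u' : strip u v -> strip u' v -> u <= 1 / 2 -> u' <= 1 / 2 ->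
    dist (koch kap u v) (koch kap u' v) <= A * (2 * s) ^+ m.+1 * `|u - u'|.
  move=> su su' uh uh'; rewrite (koch_fold0 K h su a uh) (koch_fold0 K h su' a uh') (fold0_dist K).
  have -> : A * (2 * s) ^+ m.+1 * `|u - u'| = s * (A * (2 * s) ^+ m * `|2 * u - 2 * u'|).
    by rewrite -mulrBr normrM [`|2|]ger0_norm// exprS; ring.
  by rewrite ler_pM2l// IH//; [exact: slant_flip K _ h|exact: (strip_child0 K)..].
have right u u' : strip u v -> strip u' v -> 1 / 2 <= u -> 1 / 2 <= u' ->
    dist (koch kap u v) (koch kap u' v) <= A * (2 * s) ^+ m.+1 * `|u - u'|.
  move=> su su' uh uh'; rewrite (koch_fold1 K h su a uh) (koch_fold1 K h su' a uh') (fold1_dist K).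
  have -> : A * (2 * s) ^+ m.+1 * `|u - u'| = s * (A * (2 * s) ^+ m * `|2 - 2 * u - (2 - 2 * u')|).
    have -> : 2 - 2 * u - (2 - 2 * u') = - (2 * (u - u')) by ring.
    by rewrite normrN normrM [`|2|]ger0_norm// exprS; ring.
  by rewrite ler_pM2l// IH//; [exact: slant_k K|exact: (strip_child1 K)..].
have [b|/ltW b] := leP t' (1 / 2); first by apply: left => //; lra.
have [d|/ltW d] := leP (1 / 2) t; first by apply: right => //; lra.
have st2 : strip (1 / 2) v by case/andP: st => _ v1; rewrite /strip v1 andbT; lra.
apply: le_trans (euclidean_dist_triangle _ (koch kap (1 / 2) v) _) _.
have -> : `|t - t'| = `|t - 1 / 2| + `|1 / 2 - t'|.
  by rewrite distrC (normB_chain d b) addrC [`|_ - t|]distrC [`|t' - _|]distrC.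
by rewrite [leRHS]mulrDr; apply: lerD; [exact: left|exact: right].
Qed.
End LipschitzBounds.

Local Notation curve t := (koch k t 0).

(** * The curve and the distance to it *)

Section CurveSeparation.
Hypothesis K : koch_ratio k s.
(** A triangle that contains its two folded images, hence the curve. *)
Definition hull p : Prop := [/\ 0 <= p.1, 0 <= p.2, p.2 <= k * p.1 & p.1 <= 1 / 2].

Lemma hull_fold0 p : hull p -> hull (fold0 p).
Proof.
case=> h1 h2 h3 h4; have k0 := k_ge0 K; have k1 := k_lt1 K; have q0 := k2_lt1 K.
rewrite /hull /fold0/=; split; nra.
Qed.

Lemma hull_fold1 p : hull p -> hull (fold1 p).
Proof.
case=> h1 h2 h3 h4; have k0 := k_ge0 K; have k1 := k_lt1 K; have q0 := k2_lt1 K.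
rewrite /hull /fold1 /fold0/=; split; nra.
Qed.

Let s00 : (s <= `|0 : R|) = false. Proof. by rewrite normr0 leNgt (s_gt0 K). Qed.
Let strip0 t : 0 <= t <= 1 -> strip t 0.
Proof. by rewrite /strip normr0 ler01 andbT. Qed.
Let s0le : `|0 : R| <= s. Proof. by rewrite normr0 ltW// (s_gt0 K). Qed.

Lemma curve_hull t : 0 <= t <= 1 -> hull (curve t).
Proof.
move=> t01; have h := slant_k K; have st := strip0 t01.
have B n : hull (koch_step n k t 0).
  elim: n (k) t {h st} t01 => [|n IH] kap u u01 /=.
    by have k0 := k_ge0 K; rewrite /hull/= mulr0; split => //; lra.
  rewrite s00 oppr0 mul0r; case: (leP u (1 / 2)) => a.
    by apply/hull_fold0/IH; lra.
  by apply/hull_fold1/IH; lra.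
split.
- have : (-1) * (curve t).1 + 0 * (curve t).2 <= 0.
    by apply: (koch_lim_le K) => // n; have [? _ _ _] := B n; lra.
  lra.
- have : 0 * (curve t).1 + (-1) * (curve t).2 <= 0.
    by apply: (koch_lim_le K) => // n; have [_ ? _ _] := B n; lra.
  lra.
- have : (- k) * (curve t).1 + 1 * (curve t).2 <= 0.
    by apply: (koch_lim_le K) => // n; have [_ _ ? _] := B n; lra.
  lra.
- have : 1 * (curve t).1 + 0 * (curve t).2 <= 1 / 2.
    by apply: (koch_lim_le K) => // n; have [_ _ _ ?] := B n; lra.
  lra.
Qed.

(** Folding never lets the slant act on the central line. *)
Lemma curve_slant kap t : slant kap -> 0 <= t <= 1 -> koch kap t 0 = curve t.
Proof.
move=> h t01; apply: euclidean_dist_eq0.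
apply: (@le_geometric _ s _ _ 3) => [||n]; [exact: ltW (s_gt0 K)|exact: s_lt1 K|rewrite add0r].
suff A kap' : slant kap' -> dist (koch kap t 0) (koch kap' t 0) <= 3 * s ^+ n by exact: A (slant_k K).
elim: n kap kap' t h t01 => [|n IH] kap kap' t h t01 h'.
  rewrite expr0 mulr1; apply: le_trans (euclidean_dist_triangle _ (0, 0) _) _.
  have [x1 x2] := box_norm K h (koch_box K h (strip0 t01)).
  have [y1 y2] := box_norm K h' (koch_box K h' (strip0 t01)).
  have -> : 3 = (1 / 2 + 1) + (1 / 2 + 1) :> R by field.
  by apply: lerD; apply: euclidean_dist_le; rewrite /= ?subr0 ?sub0r ?normrN.
have st := strip0 t01.
have [a|/ltW a] := leP t (1 / 2).
  rewrite (koch_fold0 K h st s0le a) (koch_fold0 K h' st s0le a) (fold0_dist K) oppr0 mul0r exprS mulrCA ler_pM2l ?(s_gt0 K)//.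
  by apply: IH; [exact: slant_flip K _ h|lra|exact: slant_flip K _ h'].
rewrite (koch_fold1 K h st s0le a) (koch_fold1 K h' st s0le a) (fold1_dist K) oppr0 mul0r exprS mulrCA ler_pM2l ?(s_gt0 K)//.
by apply: IH; [exact: slant_k K|lra|exact: slant_k K].
Qed.

Lemma curve_fold0 t : 0 <= t <= 1 / 2 -> curve t = fold0 (curve (2 * t)).
Proof.
move=> t01; have t02 : 0 <= t <= 1 by lra.
rewrite (koch_fold0 K (slant_k K) (strip0 t02))//; last by lra.
by rewrite oppr0 mul0r (curve_slant (slant_flip K (slant_k K)))//; lra.
Qed.

Lemma curve_fold1 t : 1 / 2 <= t <= 1 -> curve t = fold1 (curve (2 - 2 * t)).
Proof.
move=> t01; have t02 : 0 <= t <= 1 by lra.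
by rewrite (koch_fold1 K (slant_k K) (strip0 t02))// ?oppr0 ?mul0r//; lra.
Qed.

(** Both folded boxes lie on their own side of the axis, so that a point of one is
    closer to the mirror image of a point of the other than to the point. *)
Lemma fold_reflect p q : p.1 <= 1 / 2 -> q.1 <= 1 / 2 ->
  s * dist p q <= dist (fold0 p) (fold1 q) /\ s * dist p q <= dist (fold1 p) (fold0 q).
Proof.
move=> p1 q1; have A (a b : R * R) : a.1 <= 1 / 2 -> b.1 <= 1 / 2 -> s * dist a b <= dist (fold0 a) (fold1 b).
  move=> a1 b1; rewrite /fold1 (fold0_dist K) ler_pM2l ?(s_gt0 K)// /euclidean_dist/=.
  by rewrite ler_wsqrtr// lerD2r; nra.
by split; [exact: A|rewrite euclidean_distC [leRHS]euclidean_distC; exact: A].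
Qed.

(** The curve is in the two folded triangles, which stay away from the outer
    sides of the folded boxes. *)
Lemma tile_hull_gap kap t t' v : slant kap -> strip t v -> s <= `|v| -> 0 <= t' <= 1 ->
  e <= 6 * dist (tile kap t v) (curve t').
Proof.
move=> h st sv t01'; have [t01 l01 ->] := strip_tile K st sv.
have k0 := k_ge0 K; have k1 := k_lt1 K; have q0 := k2_lt1 K; have k2 := sqr_ge0 k.
have e0 := collar_gt0 K; have [w1 _] := shelf_bounds K.
have [g1 g2 g3 g4] := curve_hull t01'.
set l := _ / _ in l01 *; set g := curve t' in g1 g2 g3 g4 *.
set p := if _ then _ else _.
have := dist1_le p g; have := dist2_le p g; set d := dist p g.
rewrite !ler_norml => /andP[y1 y2] /andP[x1 x2].
have kx : k * (p.1 - g.1) <= 1 * d by nra.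
have kx' : k * (g.1 - p.1) <= 1 * d by nra.
have [v0|v0] := leP 0 v.
  have pE : p = upper kap t l by rewrite /p v0.
  by have [_] := upper_box K h t01 l01; rewrite -pE => u; lra.
have pE : p = lower kap t l by rewrite /p leNgt v0.
have [th|th] := leP t (1 / 2).
  have th' : 0 <= t <= 1 / 2 by lra.
  by have [_ u _] := lower_left_box K h th' l01; rewrite -pE in u; lra.
have th' : 1 / 2 <= t <= 1 by lra.
have [_ u _] := lower_right_box K h th' l01; rewrite -pE in u.
have {}u : (1 - k ^+ 2) * p.2 <= (1 - k ^+ 2) * slope_in p.1 by rewrite ler_wpM2l// ltW.
rewrite (slope_inE K) in u.
have G : (1 + k ^+ 2) / 2 * e <= (1 - k ^+ 2) * g.2 - (2 * k * g.1 - (k + e) * (1 + k ^+ 2) / 2).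
  have [a|a] := leP t' (1 / 2).
    have t0 : 0 <= t' <= 1 / 2 by lra.
    have t02 : 0 <= 2 * t' <= 1 by lra.
    have [] := curve_hull t02; rewrite /g (curve_fold0 t0); case: (curve _) => x y /= h1 h2 h3 h4.
    have : (1 + k ^+ 2) / 2 * (k * x + y) <= (1 + k ^+ 2) / 2 * k by apply: ler_wpM2l; nra.
    lra.
  have t0 : 1 / 2 <= t' <= 1 by lra.
  have t02 : 0 <= 2 - 2 * t' <= 1 by lra.
  have [] := curve_hull t02; rewrite /g (curve_fold1 t0); case: (curve _) => x y /= h1 h2 h3 h4.
  have : 0 <= (1 + k ^+ 2) / 2 * (k * x - y) by apply: mulr_ge0; lra.
  lra.
have yy : (1 - k ^+ 2) * (g.2 - p.2) <= 1 * d by nra.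
have ek : 0 <= k ^+ 2 * e by rewrite mulr_ge0// ltW.
lra.
Qed.

(** If the curve point is in the other half, its mirror image is also on the curve,
    and closer; so a fold transports the estimate, until a tile is reached. *)
Lemma koch_separation : exists2 C : R, 1 <= C & forall kap t t' v, slant kap ->
  strip t v -> 0 <= t' <= 1 -> `|v| <= C * dist (koch kap t v) (curve t').
Proof.
have e0 := collar_gt0 K; have e1 := collar_le; have s0 := s_gt0 K; have s1 := s_lt1 K.
have C1 : 1 <= 6 / e by rewrite ler_pdivlMr//; lra.
exists (6 / e) => // kap t t' v h st t01'.
have C0 p q : 0 <= 6 / e * dist p q by rewrite mulr_ge0 ?euclidean_dist_ge0//; lra.
apply: (@le_from_power _ s) => //; first exact: ltW.
move=> n; elim: n kap t t' v h st t01' => [|n IH] kap t t' v h st t01' sn.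
  rewrite (koch_tile K)//; last by rewrite expr0 in sn; lra.
  have sv : s <= `|v| by rewrite expr0 in sn; lra.
  case/andP: (st) => _ v1; apply: le_trans v1 _.
  by rewrite mulrAC ler_pdivlMr// mul1r tile_hull_gap.
have [sv|/ltW sv] := leP s `|v|.
  rewrite (koch_tile K)//; case/andP: (st) => _ v1; apply: le_trans v1 _.
  by rewrite mulrAC ler_pdivlMr// mul1r tile_hull_gap.
have sn' : s ^+ n <= `|- v / s|.
  by rewrite normrM normrN normfV (gtr0_norm s0) ler_pdivlMr// mulrC -exprS.
have vE : `|v| = s * `|- v / s|.
  by rewrite normrM normrN normfV (gtr0_norm s0) mulrC divfK// gt_eqF.
have E p q d : `|- v / s| <= 6 / e * dist p q -> s * dist p q <= d -> `|v| <= 6 / e * d.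
  move=> H1 H2; have : 6 / e * (s * dist p q) <= 6 / e * d by rewrite ler_wpM2l//; lra.
  have : s * `|- v / s| <= s * (6 / e * dist p q) by rewrite ler_wpM2l// ltW.
  rewrite vE; lra.
have hk := slant_k K; have hf := slant_flip K h.
have bx kap' t1 v1 : slant kap' -> strip t1 v1 -> (koch kap' t1 v1).1 <= 1 / 2.
  by move=> h1 st1; have [] := koch_box K h1 st1.
have [a|/ltW a] := leP t (1 / 2).
  rewrite (koch_fold0 K)//; have st1 := strip_child0 K st sv a.
  have [b|/ltW b] := leP t' (1 / 2).
    have t2 : 0 <= t' <= 1 / 2 by lra.
    have t3 : 0 <= 2 * t' <= 1 by lra.
    by apply: (E _ _ _ (IH _ _ _ _ hf st1 t3 sn')); rewrite (curve_fold0 t2) (fold0_dist K).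
  have t2 : 1 / 2 <= t' <= 1 by lra.
  have t3 : 0 <= 2 - 2 * t' <= 1 by lra.
  apply: (E _ _ _ (IH _ _ _ _ hf st1 t3 sn')); rewrite (curve_fold1 t2).
  by have [] := fold_reflect (bx _ _ _ hf st1) (bx _ _ _ hk (strip0 t3)).
rewrite (koch_fold1 K)//; have st1 := strip_child1 K st sv a.
have [b|/ltW b] := leP t' (1 / 2).
  have t2 : 0 <= t' <= 1 / 2 by lra.
  have t3 : 0 <= 2 * t' <= 1 by lra.
  apply: (E _ _ _ (IH _ _ _ _ hk st1 t3 sn')); rewrite (curve_fold0 t2).
  by have [] := fold_reflect (bx _ _ _ hk st1) (bx _ _ _ hk (strip0 t3)).
have t2 : 1 / 2 <= t' <= 1 by lra.
have t3 : 0 <= 2 - 2 * t' <= 1 by lra.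
by apply: (E _ _ _ (IH _ _ _ _ hk st1 t3 sn')); rewrite (curve_fold1 t2) (fold1_dist K).
Qed.
End CurveSeparation.

(** * The curve is a snowflake *)

Section CurveExpansion.
Hypothesis K : koch_ratio k s.
Variable alpha : R.
Hypothesis alpha0 : 0 <= alpha.
Hypothesis s_alpha : s `^ (1 + alpha) = 1 / 2.
Local Notation beta := (1 + alpha).

Let powR_mono (x y : R) : 0 <= x -> x <= y -> x `^ beta <= y `^ beta.
Proof. by move=> x0 xy; rewrite ge0_ler_powR ?nnegrE ?addr_ge0 ?(le_trans x0 xy)//. Qed.

Let powR_scale (x : R) : 0 <= x -> (s * x) `^ beta = x `^ beta / 2.
Proof. by move=> x0; rewrite powRM// ?s_alpha ?(ltW (s_gt0 K))//; ring. Qed.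

Let one_powR (x : R) : 1 <= x -> 1 <= x `^ beta.
Proof. by move=> x1; have := powR_mono ler01 x1; rewrite powR1. Qed.

(** Near its origin the curve is invariant under the first fold, which halves t
    and multiplies distances by s. *)
Lemma curve_root t : 0 <= t <= 1 -> t <= (4 * dist (curve t) (0, 0)) `^ beta.
Proof.
have far u : 1 / 2 <= u <= 1 -> u <= (4 * dist (curve u) (0, 0)) `^ beta.
  move=> u2; apply: le_trans (one_powR _); first lra.
  have u3 : 0 <= 2 - 2 * u <= 1 by lra.
  have k0 := k_ge0 K.
  have [] := curve_hull K u3; rewrite (curve_fold1 K u2); move: (curve _) => q h1 h2 h3 h4.
  have := dist1_le (fold1 q) (0, 0); rewrite /= subr0 ler_norml => /andP[_].
  have : 0 <= k * q.2 by rewrite mulr_ge0.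
  lra.
move=> t01; apply: (@le_from_power _ (1 / 2)); [lra|lra|exact: powR_ge0|move=> n].
elim: n t t01 => [|n IH] t t01 tn; first by apply: far; rewrite expr0 in tn; lra.
have [a|/ltW a] := leP t (1 / 2); last by apply: far; lra.
have t2 : 0 <= t <= 1 / 2 by lra.
have t3 : 0 <= 2 * t <= 1 by lra.
have tn' : (1 / 2) ^+ n <= 2 * t by rewrite exprS in tn; lra.
have z : (0, 0) = fold0 (0, 0) by rewrite /fold0/=; congr pair; ring.
rewrite (curve_fold0 K t2) z (fold0_dist K) mulrCA powR_scale ?mulr_ge0 ?euclidean_dist_ge0//.
have := IH _ t3 tn'; lra.
Qed.

(** Near its tip the curve is the second fold of its part near the origin, in the
    angle 0 <= y <= k x, whose image is transverse to the line x = 1/2. *)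
Lemma curve_tip t : 0 <= t <= 1 -> 1 - t <= (16 * Q * (1 / 2 - (curve t).1)) `^ beta.
Proof.
move=> t01; have k0 := k_ge0 K; have k1 := k_lt1 K; have q0 := k2_lt1 K; have k2 := sqr_ge0 k.
have QE : Q * (1 - k ^+ 2) = 1 by rewrite mulVf// gt_eqF.
have Q0 : 0 <= Q by rewrite invr_ge0 ltW.
have [a|/ltW a] := leP t (1 / 2).
  have t2 : 0 <= t <= 1 / 2 by lra.
  have t3 : 0 <= 2 * t <= 1 by lra.
  apply: le_trans (one_powR _); first lra.
  have [] := curve_hull K t3; rewrite (curve_fold0 K t2); move: (curve _) => q h1 h2 h3 h4 /=.
  have : k * q.2 <= k * (k * (1 / 2)) by apply: ler_wpM2l => //; nra.
  move=> kq; have : Q * ((1 - k ^+ 2) / 4) <= Q * (1 / 2 - (q.1 + k * q.2) / 2) by apply: ler_wpM2l => //; lra.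
  lra.
have t2 : 1 / 2 <= t <= 1 by lra.
have t3 : 0 <= 2 - 2 * t <= 1 by lra.
have := curve_root t3; have [] := curve_hull K t3; rewrite (curve_fold1 K t2).
move: (curve _) => q h1 h2 h3 h4 /= r.
have : 2 - 2 * t <= (16 * Q * (1 / 2 - (1 - q.1 + k * q.2) / 2)) `^ beta.
  apply: le_trans r _; apply: powR_mono; first by rewrite mulr_ge0 ?euclidean_dist_ge0.
  have : dist q (0, 0) <= q.1 + k * q.1.
    by apply: euclidean_dist_le; rewrite /= subr0 ger0_norm.
  have : k * q.2 <= k * (k * q.1) by apply: ler_wpM2l.
  move=> kq; have : Q * (q.1 * (1 - k ^+ 2)) <= Q * (q.1 - k * q.2) by apply: ler_wpM2l => //; lra.
  have : k * q.1 <= 1 * q.1 by rewrite ler_wpM2r// ltW.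
  have -> : Q * (q.1 * (1 - k ^+ 2)) = q.1 by rewrite mulrCA QE mulr1.
  lra.
lra.
Qed.

(** Unfolding the two points until they are in different halves, their distance is
    at least the sum of those to the axis, which [curve_tip] bounds. *)
Lemma curve_colip t t' : 0 <= t <= 1 -> 0 <= t' <= 1 ->
  `|t - t'| <= (32 * Q * dist (curve t) (curve t')) `^ beta.
Proof.
move=> t01 t01'.
have Q0 : 0 <= Q by rewrite invr_ge0 ltW// (k2_lt1 K).
have sh := s_ge_half K.
apply: (@le_from_power _ (1 / 2)); [lra|lra|exact: powR_ge0|move=> n].
have opposite u u' : 0 <= u <= 1 / 2 -> 1 / 2 <= u' <= 1 ->
    u' - u <= (32 * Q * dist (curve u) (curve u')) `^ beta.
  move=> u1 u1'; have u2 : 0 <= 2 * u <= 1 by lra.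
  have u2' : 0 <= 2 - 2 * u' <= 1 by lra.
  have r := curve_tip u2; have r' := curve_tip u2'.
  have [_ _ _ x] := curve_hull K u2; have [_ _ _ x'] := curve_hull K u2'.
  rewrite (curve_fold0 K u1) (curve_fold1 K u1') /fold1 (fold0_dist K).
  move: (curve (2 * u)) (curve (2 - 2 * u')) r r' x x' => p q r r' x x'.
  have := dist1_le p (1 - q.1, q.2); set d := dist _ _ => /=.
  rewrite ler_norml => /andP[d1 _]; have d0 : 0 <= d by exact: euclidean_dist_ge0.
  have sd : d <= 2 * (s * d) by have := ler_wpM2r d0 sh; lra.
  have C y : 0 <= y -> y <= d -> (16 * Q * y) `^ beta <= (32 * Q * (s * d)) `^ beta.
    move=> y0 yd; apply: powR_mono; first by rewrite !mulr_ge0.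
    have : Q * y <= Q * (2 * (s * d)) by rewrite ler_wpM2l//; lra.
    lra.
  have := C (1 / 2 - p.1); have := C (1 / 2 - q.1) => c1 c2.
  have {}c1 := c1 _ _; have {}c2 := c2 _ _.
  have : (16 * Q * (1 / 2 - p.1)) `^ beta <= (32 * Q * (s * d)) `^ beta by apply: c2; lra.
  have : (16 * Q * (1 / 2 - q.1)) `^ beta <= (32 * Q * (s * d)) `^ beta by apply: c1; lra.
  lra.
have scale d : 0 <= d -> (32 * Q * (s * d)) `^ beta = (32 * Q * d) `^ beta / 2.
  by move=> d0; rewrite mulrCA powR_scale// !mulr_ge0.
elim: n t t' t01 t01' => [|n IH] t t'; wlog tt : t t' / t <= t'.
- move=> H t01 t01'; have [a|/ltW a] := leP t t'; first exact: H.
  by rewrite distrC euclidean_distC; exact: H.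
- rewrite expr0 ler0_norm ?subr_le0// opprB => t01 t01' tn.
  by apply: opposite; lra.
- move=> H t01 t01'; have [a|/ltW a] := leP t t'; first exact: H.
  by rewrite distrC euclidean_distC; exact: H.
rewrite exprS => t01 t01' tn; have [a|/ltW a] := leP t' (1 / 2).
  have u : 0 <= t <= 1 / 2 by lra.
  have u' : 0 <= t' <= 1 / 2 by lra.
  have [v v'] : 0 <= 2 * t <= 1 /\ 0 <= 2 * t' <= 1 by split; lra.
  have E : `|2 * t - 2 * t'| = 2 * `|t - t'| by rewrite -mulrBr normrM [`|2|]ger0_norm.
  rewrite (curve_fold0 K u) (curve_fold0 K u') (fold0_dist K) scale ?euclidean_dist_ge0//.
  have := IH _ _ v v'; rewrite E => {}IH; have {}IH := IH _.
  have : 2 * `|t - t'| <= (32 * Q * dist (curve (2 * t)) (curve (2 * t'))) `^ beta by apply: IH; lra.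
  lra.
have [b|/ltW b] := leP (1 / 2) t.
  have u : 1 / 2 <= t <= 1 by lra.
  have u' : 1 / 2 <= t' <= 1 by lra.
  have [v v'] : 0 <= 2 - 2 * t <= 1 /\ 0 <= 2 - 2 * t' <= 1 by split; lra.
  have E : `|2 - 2 * t - (2 - 2 * t')| = 2 * `|t - t'|.
    have -> : 2 - 2 * t - (2 - 2 * t') = - (2 * (t - t')) by ring.
    by rewrite normrN normrM [`|2|]ger0_norm.
  rewrite (curve_fold1 K u) (curve_fold1 K u') (fold1_dist K) scale ?euclidean_dist_ge0//.
  have := IH _ _ v v'; rewrite E => {}IH; have {}IH := IH _.
  have : 2 * `|t - t'| <= (32 * Q * dist (curve (2 - 2 * t)) (curve (2 - 2 * t'))) `^ beta.
    by apply: IH; lra.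
  lra.
by rewrite ler0_norm ?subr_le0// opprB; apply: opposite; lra.
Qed.
End CurveExpansion.

(** * Cutting segments at the boundaries of the pieces *)

Section Cuts.
Hypothesis K : koch_ratio k s.
Lemma box_along kap p q u : 0 <= u <= 1 -> box kap p -> box kap q -> box kap (along p q u).
Proof.
move=> u01 [h1 h2 h3 h4] [g1 g2 g3 g4]; split.
- have : 0 <= 0 * (along p q u).1 + 1 * (along p q u).2 + e by apply: along_ge => //; lra.
  lra.
- have : 0 <= k * (along p q u).1 + (-1) * (along p q u).2 + e by apply: along_ge => //; lra.
  lra.
- have : 0 <= (-1) * (along p q u).1 + 0 * (along p q u).2 + 1 / 2 by apply: along_ge => //; lra.
  lra.
- have : 0 <= 1 * (along p q u).1 + (- kap) * (along p q u).2 + 0 by apply: along_ge => //; lra.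
  lra.
Qed.

(** The intermediate value theorem along t = 1. *)
Lemma koch_axis_surj kap y : slant kap -> - e <= y <= k / 2 + e ->
  exists2 v, `|v| <= 1 & koch kap 1 v = (1 / 2, y).
Proof.
move=> h /andP[y0 y1]; have [C C1 hC] := koch_vertical K.
have st v : -1 <= v <= 1 -> strip 1 v by move=> v1; rewrite /strip ler_norml v1 andbT; lra.
have o1 : 0 <= (1 : R) <= 1 by lra.
have [||||v v1 vE] := @lip_surj R (fun v => (koch kap 1 v).2) (-1) 1 C y; [lra|lra| | |].
- move=> v v' /st sv /st sv'; apply: le_trans (dist2_le _ _) _; exact: hC.
- by rewrite (koch_bot K h o1) (koch_top K h o1)/= top1; lra.
have nv : `|v| <= 1 by rewrite ler_norml.
exists v => //; have [x _] := koch_axis K h nv.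
by rewrite -vE -x; case: (koch _ _ _).
Qed.

(** The region left by the tiles, that is the union of the two folded boxes. *)
Definition middle p : Prop :=
  [/\ p.2 <= k * p.1 + w, - (e / 2) <= p.2 & slope_in p.1 <= p.2].

Lemma koch_above kap t v : slant kap -> strip t v -> s <= v -> k * (koch kap t v).1 + w <= (koch kap t v).2.
Proof.
move=> h st sv; have s0 := s_gt0 K; have v0 : 0 <= v by lra.
have sv' : s <= `|v| by rewrite ger0_norm.
by rewrite (koch_tile K)//; have [t01 l01 ->] := strip_tile K st sv'; rewrite v0; have [] := upper_box K h t01 l01.
Qed.

Lemma koch_below kap t v : slant kap -> strip t v -> v <= - s ->
  (koch kap t v).2 <= k * (koch kap t v).1 + w /\
  ((koch kap t v).2 <= - (e / 2) \/ (koch kap t v).2 <= slope_in (koch kap t v).1).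
Proof.
move=> h st sv; have s0 := s_gt0 K; have v0 : v < 0 by lra.
have sv' : s <= `|v| by rewrite ltr0_norm//; lra.
rewrite (koch_tile K)//; have [t01 l01 ->] := strip_tile K st sv'.
have -> : (0 <= v) = false by rewrite leNgt v0.
split; first by have [] := lower_box K h t01 l01.
have [th|th] := leP t (1 / 2).
  have th' : 0 <= t <= 1 / 2 by lra.
  by left; have [] := lower_left_box K h th' l01.
have th' : 1 / 2 <= t <= 1 by lra.
by right; have [] := lower_right_box K h th' l01.
Qed.

Lemma middle_fold0 kap q : slant kap -> box (flip kap) q ->
  middle (fold0 q) /\ (fold0 q).1 + k * (fold0 q).2 <= (1 + k ^+ 2) / 4.
Proof.
move=> h [h1 h2 h3 h4]; have e0 := collar_gt0 K; have q0 := k2_lt1 K; have k0 := k_ge0 K; have k2 := sqr_ge0 k.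
have E : (1 - k ^+ 2) * (fold0 q).2 - (1 - k ^+ 2) * slope_in (fold0 q).1 =
   (1 + k ^+ 2) / 2 * (k + e - k * q.1 - q.2) by rewrite (slope_inE K) /fold0/=; field.
rewrite /middle; split; last by rewrite /fold0/=; nra.
split; try by rewrite /fold0 /shelf/=; nra.
rewrite -subr_ge0 -(pmulr_rge0 _ q0) mulrBr E mulr_ge0//; first lra.
have : k * q.1 <= k * (1 / 2) by rewrite ler_wpM2l.
lra.
Qed.

Lemma middle_fold1 q : box k q ->
  middle (fold1 q) /\ (1 + k ^+ 2) / 4 <= (fold1 q).1 + k * (fold1 q).2.
Proof.
move=> [h1 h2 h3 h4]; have e0 := collar_gt0 K; have q0 := k2_lt1 K; have k0 := k_ge0 K; have k2 := sqr_ge0 k.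
have E : (1 - k ^+ 2) * (fold1 q).2 - (1 - k ^+ 2) * slope_in (fold1 q).1 =
   (1 + k ^+ 2) / 2 * (k * q.1 - q.2 + e) by rewrite (slope_inE K) /fold1 /fold0/=; field.
have kq : k * q.1 <= k * (1 / 2) by rewrite ler_wpM2l.
rewrite /middle; split; last by rewrite /fold1 /fold0/=; nra.
split; try by rewrite /fold1 /fold0 /shelf/=; nra.
by rewrite -subr_ge0 -(pmulr_rge0 _ q0) mulrBr E mulr_ge0//; lra.
Qed.

Lemma koch_middle kap t v : slant kap -> strip t v -> `|v| <= s -> middle (koch kap t v).
Proof.
move=> h st sv; have [th|/ltW th] := leP t (1 / 2).
  rewrite (koch_fold0 K)//.
  by have [] := middle_fold0 h (koch_box K (slant_flip K h) (strip_child0 K st sv th)).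
rewrite (koch_fold1 K)//.
by have [] := middle_fold1 (koch_box K (slant_k K) (strip_child1 K st sv th)).
Qed.

Let slope_inP p : (slope_in p.1 <= p.2) =
  (0 <= - (2 * k) * p.1 + (1 - k ^+ 2) * p.2 + (k + e) * (1 + k ^+ 2) / 2).
Proof. by rewrite -(ler_pM2l (k2_lt1 K)) (slope_inE K) -subr_ge0; congr (0 <= _); ring. Qed.

Let slope_in_line p : - (2 * k) * p.1 + (1 - k ^+ 2) * p.2 + (k + e) * (1 + k ^+ 2) / 2 = 0 ->
  p.2 = slope_in p.1.
Proof. by move=> h; apply: (mulfI (lt0r_neq0 (k2_lt1 K))); rewrite (slope_inE K); lra. Qed.

Lemma middle_along p q u : 0 <= u <= 1 -> middle p -> middle q -> middle (along p q u).
Proof.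
move=> u01 [h1 h2 h3] [g1 g2 g3]; split.
- have : 0 <= k * (along p q u).1 + (-1) * (along p q u).2 + w by apply: along_ge => //; lra.
  lra.
- have : 0 <= 0 * (along p q u).1 + 1 * (along p q u).2 + e / 2 by apply: along_ge => //; lra.
  lra.
- by rewrite slope_inP; apply: along_ge; rewrite -?slope_inP.
Qed.

Lemma segment_meets_shelf kap p q : box kap p -> box kap q ->
  k * p.1 + w <= p.2 -> q.2 <= k * q.1 + w ->
  exists m, [/\ box kap m, between p q m & m.2 = k * m.1 + w].
Proof.
move=> bp bq h1 h2; have [||u u01 uE] := @cut_along R p q (- k) 1 (- w); [lra|lra|].
exists (along p q u); split; [exact: box_along|exact: between_along|lra].
Qed.

Lemma segment_meets_axis kap p q : box kap p -> box kap q -> middle p -> middle q ->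
  p.1 + k * p.2 <= (1 + k ^+ 2) / 4 -> (1 + k ^+ 2) / 4 <= q.1 + k * q.2 ->
  exists m, [/\ box kap m, middle m, between p q m & m.1 + k * m.2 = (1 + k ^+ 2) / 4].
Proof.
move=> bp bq mp mq h1 h2.
have [||u u01 uE] := @cut_along R p q (-1) (- k) ((1 + k ^+ 2) / 4); [lra|lra|].
by exists (along p q u); split; [exact: box_along|exact: middle_along|exact: between_along|lra].
Qed.

(** The region below the middle one is not convex: the segment is first stopped at
    the flat side, and then, if it has crossed the slanted side before, at the
    slanted side. *)
Lemma segment_meets_floor kap p q : box kap p -> box kap q -> middle p -> q.2 <= k * q.1 + w ->
  q.2 <= - (e / 2) \/ q.2 <= slope_in q.1 ->
  exists m, [/\ box kap m, middle m, between p q m & m.2 = - (e / 2) \/ m.2 = slope_in m.1].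
Proof.
move=> bp bq mp qw ql; have [p1 p2 p3] := mp.
have under u r : 0 <= u <= 1 -> r.2 <= k * r.1 + w -> (along p r u).2 <= k * (along p r u).1 + w.
  move=> u01 rw.
  have : 0 <= k * (along p r u).1 + (-1) * (along p r u).2 + w by apply: along_ge => //; lra.
  lra.
have over u r : 0 <= u <= 1 -> - (e / 2) <= r.2 -> - (e / 2) <= (along p r u).2.
  move=> u01 re.
  have : 0 <= 0 * (along p r u).1 + 1 * (along p r u).2 + e / 2 by apply: along_ge => //; lra.
  lra.
have slanted r : box kap r -> between p q r -> r.2 <= k * r.1 + w -> - (e / 2) <= r.2 -> r.2 <= slope_in r.1 ->
    exists m, [/\ box kap m, middle m, between p q m & m.2 = - (e / 2) \/ m.2 = slope_in m.1].
  move=> br pqr rw re rs; rewrite slope_inP in p3.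
  have rs' : - (2 * k) * r.1 + (1 - k ^+ 2) * r.2 + (k + e) * (1 + k ^+ 2) / 2 <= 0.
    have := ler_wpM2l (ltW (k2_lt1 K)) rs; rewrite (slope_inE K); lra.
  have [u u01 /slope_in_line uE] := cut_along p3 rs'.
  exists (along p r u); split; [exact: box_along| |exact: between_l pqr (between_along _ _ u01)|by right].
  by split; [exact: under|exact: over|rewrite uE].
have pqq : between p q q by apply: between_sym; exact: between_end.
have [b|/ltW b] := leP (- (e / 2)) q.2.
  have [a|/ltW a] := leP q.2 (slope_in q.1); first exact: (slanted q).
  case: ql => ql; last exact: (slanted q).
  by exists q; split => //; left; apply/eqP; rewrite eq_le ql b.
have [||u u01 uE] := @cut_along R p q 0 1 (e / 2); [lra|lra|].
have bm := box_along u01 bp bq; have pqm := between_along p q u01; have mw := under _ _ u01 qw.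
move: uE bm pqm mw; set m := along _ _ _ => uE bm pqm mw.
have mE : m.2 = - (e / 2) by lra.
have [a|/ltW a] := leP (slope_in m.1) m.2; last by apply: (slanted m) => //; rewrite mE.
by exists m; split => //; [split => //; rewrite mE|left].
Qed.

(** A point of a common boundary has a preimage that belongs to both pieces; the
    same holds on the other boundaries. *)
Lemma cut_upper kap p : slant kap -> box kap p -> p.2 = k * p.1 + w ->
  exists2 t, strip t s & koch kap t s = p.
Proof.
have [s0 s1] := (s_gt0 K, s_lt1 K).
move=> h b pE; have pE' : k * p.1 + w <= p.2 by rewrite pE.
have [t [l [t01 l01 uE]]] := upper_surj K h b pE'.
have st : strip t s by rewrite /strip t01 gtr0_norm// ltW.
exists t => //; rewrite (koch_tile K)// ?gtr0_norm// /tile (ltW s0) subrr mul0r.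
have [_ we] := shelf_bounds K; have e0 := collar_gt0 K; have q0 := k2_lt1 K.
have l0 : l * (e - w) = 0 by move: pE; rewrite -uE /upper/=; lra.
have {}l0 : l = 0.
  have eq0 : 0 < e * (1 - k ^+ 2) by rewrite mulr_gt0.
  by move/eqP: l0; rewrite mulf_eq0 => /orP[/eqP//|/eqP z]; lra.
by rewrite -uE l0.
Qed.

Lemma cut_lower kap p : slant kap -> box kap p -> middle p ->
  p.2 = - (e / 2) \/ p.2 = slope_in p.1 -> exists2 t, strip t (- s) & koch kap t (- s) = p.
Proof.
have [s0 s1] := (s_gt0 K, s_lt1 K); have e0 := collar_gt0 K.
move=> h b [_ m1 m2] pE.
have [|t [l [t01 l01 uE]]] := lower_surj K h b; first by case: pE => ->; [left|right].
have st : strip t (- s) by rewrite /strip t01 normrN gtr0_norm// ltW.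
exists t => //; rewrite (koch_tile K)// ?normrN ?gtr0_norm// /tile oppr_ge0 leNgt s0/= opprK subrr mul0r.
have /andP[l0 l1] := l01.
suff l00 : l = 0 by rewrite -uE l00.
have [th|th] := leP t (1 / 2).
  by move: m1; rewrite -uE /lower th/=; nra.
move: m2; rewrite -uE (lower_right kap l (ltW th))/=.
have cx : c <= c + (2 * t - 1) * (1 / 2 - c).
  have [_ c2] := bend_bounds K; have q0 := k2_lt1 K; rewrite lerDl mulr_ge0//; lra.
have [+ _] := slope_in_lip K cx; rewrite slope_in_c.
move: (slope_in _) => y y1 y2; nra.
Qed.

Lemma cut_axis kap p : slant kap -> box kap p -> middle p ->
  p.1 + k * p.2 = (1 + k ^+ 2) / 4 -> exists2 v, `|v| <= s & koch kap (1 / 2) v = p.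
Proof.
have [s0 s1] := (s_gt0 K, s_lt1 K).
move=> h b [m1 m2 m3] pE.
have [|q bq qp] := unfold0 K h b m1 m2; first by rewrite pE.
have q1 : q.1 = 1 / 2.
  have k2 := sqr_ge0 k; move: pE; rewrite -qp /fold0/= => pE.
  have : (1 + k ^+ 2) * (q.1 - 1 / 2) = 0 by lra.
  move/eqP; rewrite mulf_eq0 => /orP[/eqP|/eqP]; lra.
have [b1 b2 _ _] := bq.
have [|v v1 vE] := koch_axis_surj (y := q.2) (slant_flip K h).
  by rewrite b1/=; move: b2; rewrite q1; lra.
have one : strip 1 v by rewrite /strip v1 andbT; lra.
have [_ E] := koch_lift0 K h one; exists (- (s * v)); last by rewrite E vE -q1 -qp; case: (q).
by rewrite (lift_depth K) ler_piMr// ltW.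
Qed.

End Cuts.

Local Notation kp kap z := (koch kap (z.1 : R) (z.2 : R)).
Local Notation instrip z := (strip (z.1 : R) (z.2 : R)).

Section Splitting.
Hypothesis K : koch_ratio k s.
Implicit Types z m : R * R.

(** The pieces are the upper tile, the lower tiles and the two folded boxes.  A
    segment crosses their boundaries finitely often, at points that have preimages
    in both neighbouring pieces. *)
Lemma split_pieces kap (P : R * R -> R * R -> Prop) : slant kap ->
  (forall z z', P z z' -> P z' z) ->
  (forall z m z', instrip z -> instrip m -> instrip z' ->
     between (kp kap z) (kp kap z') (kp kap m) -> P z m -> P m z' -> P z z') ->
  (forall z z', instrip z -> instrip z' -> s <= `|z.2| -> s <= `|z'.2| -> (0 <= z.2) = (0 <= z'.2) -> P z z') ->
  (forall z z', instrip z -> instrip z' -> `|z.2| <= s -> `|z'.2| <= s ->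
     (z.1 <= 1 / 2 /\ z'.1 <= 1 / 2) \/ (1 / 2 <= z.1 /\ 1 / 2 <= z'.1) -> P z z') ->
  forall z z', instrip z -> instrip z' -> P z z'.
Proof.
move=> h sym join tiles kids.
have [s0 s1] := (s_gt0 K, s_lt1 K).
have ns : `|s| = s by exact: gtr0_norm.
have nm : `|- s| = s by rewrite normrN.
have bx z : instrip z -> box kap (kp kap z) by exact: (koch_box K h).
have mm z z' : instrip z -> instrip z' -> `|z.2| <= s -> `|z'.2| <= s -> P z z'.
  wlog zz : z z' / z.1 <= z'.1.
    move=> H a b c d; have [x|/ltW x] := leP z.1 z'.1; first exact: H.
    by apply: sym; exact: H.
  move=> st st' sz sz'.
  have [a|/ltW a] := leP z'.1 (1 / 2); first by apply: kids => //; left; rewrite (le_trans zz a).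
  have [b|/ltW b] := leP (1 / 2) z.1; first by apply: kids => //; right.
  have [m1 x1] := middle_fold0 K h (koch_box K (slant_flip K h) (strip_child0 K st sz b)).
  have [m2 x2] := middle_fold1 K (koch_box K (slant_k K) (strip_child1 K st' sz' a)).
  rewrite -(koch_fold0 K) in m1 x1 => //; rewrite -(koch_fold1 K h) in m2 x2 => //.
  have [p [bp mp btw pE]] := segment_meets_axis K (bx _ st) (bx _ st') m1 m2 x1 x2.
  have [v v1 vE] := cut_axis K h bp mp pE.
  have sm : strip (1 / 2) v by rewrite /strip (le_trans v1 (ltW s1)) andbT; lra.
  apply: (join z (1 / 2, v) z') => //=; first by rewrite vE.
    by apply: kids => //=; left.
  by apply: kids => //=; right.
have um z z' : instrip z -> instrip z' -> s <= z.2 -> (kp kap z').2 <= k * (kp kap z').1 + w ->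
   (forall t, strip t s -> P (t, s) z') -> P z z'.
  move=> st st' sz below H.
  have [p [bp btw pE]] := segment_meets_shelf (bx _ st) (bx _ st') (koch_above K h st sz) below.
  have [t ts tE] := cut_upper K h bp pE.
  apply: (join z (t, s) z') => //=; [by rewrite tE| |exact: H].
  by apply: tiles; rewrite //= ?ns//; [exact: depth_pos|exact: same_sign_pos s0 _ _].
have ml z z' : instrip z -> instrip z' -> `|z.2| <= s -> z'.2 <= - s -> P z z'.
  move=> st st' sz sz'; have [x1 x2] := koch_below K h st' sz'.
  have [p [bp mp btw pE]] := segment_meets_floor K (bx _ st) (bx _ st') (koch_middle K h st sz) x1 x2.
  have [t ts tE] := cut_lower K h bp mp pE.
  apply: (join z (t, - s) z') => //=; first by rewrite tE.
    by apply: mm => //=; rewrite nm.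
  by apply: tiles; rewrite //= ?nm//; [exact: depth_neg|exact: same_sign_neg s0 _ _].
have half z z' : instrip z -> instrip z' -> z'.2 <= z.2 -> P z z'.
  move=> st st' zz.
  have [a|a] := leP s z.2.
    have [b|b] := leP s z'.2; first by apply: tiles => //; [exact: depth_pos|exact: depth_pos|exact: same_sign_pos s0 _ _].
    have [d|/ltW d] := leP (- s) z'.2.
      have z's : `|z'.2| <= s by rewrite ler_norml d ltW.
      apply: um => //; first by have [] := koch_middle K h st' z's.
      by move=> t ts; apply: mm; rewrite //= ns.
    apply: um => //; first by have [] := koch_below K h st' d.
    by move=> t ts; apply: ml; rewrite //= ns.
  have [d|/ltW d] := leP (- s) z.2.
    have zs : `|z.2| <= s by rewrite ler_norml d ltW.
    have [b|/ltW b] := leP (- s) z'.2; last exact: ml.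
    by apply: mm => //; rewrite ler_norml b (le_trans zz (ltW a)).
  have d' := le_trans zz d.
  by apply: tiles => //; [exact: depth_neg|exact: depth_neg|exact: same_sign_neg s0 _ _].
move=> z z' st st'; have [a|/ltW a] := leP z'.2 z.2; first exact: half.
by apply: sym; exact: half.
Qed.

End Splitting.

(** * The lower bound in the half box *)

Section LowerBound.
Hypothesis K : koch_ratio k s.
Implicit Types z m : R * R.

Lemma geometric_bracket h : 0 < h -> h <= 1 -> exists2 n, s ^+ n.+1 <= h & h <= s ^+ n.
Proof.
move=> h0 h1; have [s0 s1] := (s_gt0 K, s_lt1 K).
have ex : exists n, s ^+ n.+1 <= h.
  apply/not_existsP => no; have : h <= 0; last by rewrite leNgt h0.
  apply: (@le_geometric _ s _ _ 1) => [||n]; [exact: ltW|by []|rewrite add0r mul1r].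
  have /negP := no n; rewrite -ltNge => /ltW a; apply: le_trans a _.
  by rewrite exprS ler_piMl// ?exprn_ge0// ltW.
have [n hn min] := ex_minnP ex; exists n => //.
case: n hn min => [|n] hn min; first by rewrite expr0.
by rewrite leNgt; apply/negP => /ltW /min; rewrite ltnn.
Qed.

(** The small factor (2 s)^-n in the estimate on t is the gain of n folds.  Segments
    that come too far out for them, where |v| >= s^n, are therefore excepted, as
    well as those that come within s^N of the curve, where the induction on N
    stops. *)
Definition tame (C : R) (N n : nat) kap z z' : Prop :=
  (`|z.2 - z'.2| <= C * dist (kp kap z) (kp kap z') /\
   `|z.1 - z'.1| <= C * (2 * s)^-1 ^+ n * dist (kp kap z) (kp kap z')) \/
  exists m, [/\ instrip m, between (kp kap z) (kp kap z') (kp kap m) &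
    `|m.2| <= s ^+ N \/ (0 < n)%N /\ s ^+ n <= `|m.2|].

Lemma koch_tame : exists2 C : R, 1 <= C & forall N n kap z z', slant kap ->
  instrip z -> instrip z' -> tame C N n kap z z'.
Proof.
have [s0 s1] := (s_gt0 K, s_lt1 K); have sh := s_ge_half K.
have [C C1 hC] := tile_colip K; exists C => // N n kap z z' h.
have C0 : 0 <= C by lra.
have ts0 : 0 < 2 * s by rewrite mulr_gt0.
elim: N n kap h z z' => [|N IH] n kap h z z' st st'.
  right; exists z; split => //; first exact: between_end.
  by left; rewrite expr0; case/andP: st.
move: z z' st st'; apply: (split_pieces K h).
- move=> z z' [[a b]|[m [sm bm hm]]]; last by right; exists m; split => //; exact: between_sym.
  by left; rewrite distrC [`|z'.1 - _|]distrC euclidean_distC.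
- move=> z m z' st sm st' bt [[a b]|[x [sx bx hx]]]; last first.
    by move=> _; right; exists x; split => //; exact: between_l bt bx.
  move=> [[a' b']|[x [sx bx hx]]]; last by right; exists x; split => //; exact: between_r bt bx.
  have Cn : 0 <= C * (2 * s)^-1 ^+ n by rewrite mulr_ge0// exprn_ge0// invr_ge0 ltW.
  left; split.
    apply: le_trans (ler_distD m.2 _ _) _; apply: le_trans (lerD a a') _.
    by rewrite -mulrDr ler_wpM2l.
  apply: le_trans (ler_distD m.1 _ _) _; apply: le_trans (lerD b b') _.
  by rewrite -mulrDr ler_wpM2l.
- move=> z z' st st' sz sz' sg.
  have [a b] := hC _ _ _ _ _ h st st' sz sz' sg.
  case: n => [|n]; first by left; rewrite !(koch_tile K)// expr0 mulr1.
  right; exists z; split => //; first exact: between_end.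
  by right; split => //; apply: le_trans sz; rewrite exprS ler_piMr// ?(ltW s0)// exprn_ile1// ltW.
- move=> z z' st st' sz sz'.
  have vE (v v' : R) : `|v - v'| = s * `|- v / s - - v' / s|.
    have -> : - v / s - - v' / s = - (v - v') / s by ring.
    by rewrite normrM normrN normfV (gtr0_norm s0) mulrC divfK// gt_eqF.
  have key kap' (f : R * R -> R * R) (y y' : R * R) : slant kap' -> instrip y -> instrip y' ->
      (forall p q, dist (f p) (f q) = s * dist p q) ->
      kp kap z = f (kp kap' y) -> kp kap z' = f (kp kap' y') ->
      `|z.2 - z'.2| = s * `|y.2 - y'.2| -> `|z.1 - z'.1| = 2^-1 * `|y.1 - y'.1| ->
      (forall m, instrip m -> exists2 x, instrip x & kp kap x = f (kp kap' m) /\ `|x.2| = s * `|m.2|) ->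
      tame C N.+1 n kap z z'.
    move=> h' sy sy' fd E E' Ev Et lift.
    have := IH n.-1 kap' h' y y' sy sy'; rewrite /tame E E' fd Ev Et.
    case=> [[a b]|[m [sm bm hm]]].
      left; split; first by rewrite mulrCA ler_pM2l.
      apply: (@le_trans _ _ (2^-1 * (C * (2 * s)^-1 ^+ n.-1 * dist (kp kap' y) (kp kap' y')))).
        by rewrite ler_wpM2l.
      have d0 := euclidean_dist_ge0 (kp kap' y) (kp kap' y').
      case: (n) => [|n']/=.
        rewrite expr0 mulr1 mulrCA; apply: ler_wpM2l => //; apply: ler_wpM2r => //; lra.
      rewrite exprS; have -> : C * ((2 * s)^-1 * (2 * s)^-1 ^+ n') * (s * dist (kp kap' y) (kp kap' y')) =
        2^-1 * (C * (2 * s)^-1 ^+ n' * dist (kp kap' y) (kp kap' y')) * (2 * ((2 * s)^-1 * s)) by field; rewrite gt_eqF.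
      have -> : 2 * ((2 * s)^-1 * s) = 1 by field; rewrite gt_eqF.
      by rewrite mulr1.
    have [x sx [xE xv]] := lift m sm.
    right; exists x; split => //.
      by move: bm; rewrite /between xE !fd -mulrDr ler_pM2l.
    rewrite xv; case: hm => [a|[a b]].
      by left; rewrite exprS ler_pM2l.
    by right; case: (n) a b => //= n' _ b; rewrite exprS ler_pM2l.
  case=> [[a a']|[a a']].
    apply: (key (flip kap) fold0 (2 * z.1, - z.2 / s) (2 * z'.1, - z'.2 / s)) => //=.
    + exact: slant_flip K _ h.
    + exact: (strip_child0 K).
    + exact: (strip_child0 K).
    + exact: fold0_dist K.
    + exact: (koch_fold0 K).
    + exact: (koch_fold0 K).
    + by rewrite -mulrBr normrM [`|2|]ger0_norm// mulKf.
    move=> [t v] /= sv; have [sv' E] := koch_lift0 K h sv.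
    by exists (t / 2, - (s * v)); rewrite //= (lift_depth K).
  apply: (key k fold1 (2 - 2 * z.1, - z.2 / s) (2 - 2 * z'.1, - z'.2 / s)) => //=.
  + exact: slant_k K.
  + exact: (strip_child1 K).
  + exact: (strip_child1 K).
  + exact: fold1_dist K.
  + exact: (koch_fold1 K).
  + exact: (koch_fold1 K).
  + have -> : 2 - 2 * z.1 - (2 - 2 * z'.1) = - (2 * (z.1 - z'.1)) by ring.
    by rewrite normrN normrM [`|2|]ger0_norm// mulKf.
  move=> [t v] /= sv; have [sv' E] := koch_lift1 K h sv.
  by exists (1 - t / 2, - (s * v)); rewrite //= (lift_depth K).
Qed.

Lemma koch_near_curve : exists2 C : R, 1 <= C & forall kap t v, slant kap -> strip t v ->
  dist (koch kap t v) (curve t) <= C * `|v|.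
Proof.
have [V V1 hV] := koch_vertical K; exists V => // kap t v h st; have /andP[t01 _] := st.
have st0 : strip t 0 by rewrite /strip normr0 ler01 andbT.
by rewrite -(curve_slant K h t01); apply: le_trans (hV _ _ _ _ h st st0) _; rewrite subr0.
Qed.

(** By separation, the length of a segment that comes close to the curve is at
    least of the order of the depths of its ends. *)
Lemma koch_colip_depth : exists2 C : R, 1 <= C & forall kap z z', slant kap -> instrip z -> instrip z' ->
  `|z.2 - z'.2| <= C * dist (kp kap z) (kp kap z').
Proof.
have [s0 s1] := (s_gt0 K, s_lt1 K).
have [A A1 hA] := koch_tame; have [B B1 hB] := koch_separation K; have [V V1 hV] := koch_near_curve.
exists (A + 2 * B) => [|kap z z' h st st']; first lra.
apply: (@le_geometric _ s _ _ (2 * B * V)) => [||N]; [exact: ltW|by []|].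
have d0 := euclidean_dist_ge0 (kp kap z) (kp kap z').
have BV : 0 <= 2 * B * V * s ^+ N by rewrite !mulr_ge0// ?exprn_ge0//; lra.
have [[a _]|[m [sm bm]]] := hA N 0%N kap z z' h st st'.
  have : 0 <= 2 * B * dist (kp kap z) (kp kap z') by rewrite !mulr_ge0//; lra.
  lra.
case=> [mN|[]//]; have /andP[m01 _] := sm.
have V0 : dist (kp kap m) (curve m.1) <= V * s ^+ N.
  by apply: le_trans (hV _ _ _ h sm) _; rewrite ler_wpM2l//; lra.
have far (y : R * R) : instrip y -> dist (kp kap y) (kp kap m) <= dist (kp kap z) (kp kap z') ->
    `|y.2| <= B * (dist (kp kap z) (kp kap z') + V * s ^+ N).
  move=> sy dy; apply: le_trans (hB _ _ _ _ h sy m01) _; apply: ler_wpM2l; first lra.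
  apply: le_trans (euclidean_dist_triangle _ (kp kap m) _) _; exact: lerD.
have e1 := euclidean_dist_ge0 (kp kap z) (kp kap m); have e2 := euclidean_dist_ge0 (kp kap m) (kp kap z').
have f1 : `|z.2| <= B * (dist (kp kap z) (kp kap z') + V * s ^+ N).
  by apply: far => //; apply: le_trans bm; rewrite lerDl.
have f2 : `|z'.2| <= B * (dist (kp kap z) (kp kap z') + V * s ^+ N).
  by apply: far => //; apply: le_trans bm; rewrite euclidean_distC lerDr.
have := ler_normB z.2 z'.2.
have : 0 <= A * dist (kp kap z) (kp kap z') by rewrite mulr_ge0//; lra.
lra.
Qed.

Variable alpha : R.
Hypothesis alpha0 : 0 <= alpha.
Hypothesis s_alpha : s `^ (1 + alpha) = 1 / 2.

Lemma powR_succ x : 0 <= x -> x `^ (1 + alpha) = x * x `^ alpha.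
Proof. by move=> x0; rewrite powRD ?powRr1// gt_eqF// ltr_wpDr. Qed.

Lemma powR_le (x y : R) : 0 <= x -> x <= y -> x `^ alpha <= y `^ alpha.
Proof. by move=> x0 xy; rewrite ge0_ler_powR ?nnegrE ?(le_trans x0 xy). Qed.

Lemma scale_powR n : (s ^+ n) `^ alpha = (2 * s)^-1 ^+ n.
Proof.
have s0 := s_gt0 K; have se : s `^ alpha = (2 * s)^-1.
  have : s * s `^ alpha = 1 / 2 by rewrite -powR_succ// ltW.
  move=> sE; apply: (mulfI (lt0r_neq0 s0)); rewrite sE; field; exact: lt0r_neq0.
elim: n => [|n IH]; first by rewrite !expr0 powR1.
by rewrite !exprS powRM ?exprn_ge0 ?(ltW s0)// IH se.
Qed.

(** If the segment comes arbitrarily close to the curve, both depths are bounded by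
    its length and the points are compared with those of the curve below them.
    Otherwise n is chosen so that s^n is about |v| plus the length, which no point
    of the segment exceeds in depth. *)
Lemma koch_colip : exists2 C : R, 1 <= C & forall kap z z', slant kap -> instrip z -> instrip z' ->
  `|z.2 - z'.2| <= C * dist (kp kap z) (kp kap z') /\
  `|z.1 - z'.1| <= (`|z.2| + C * dist (kp kap z) (kp kap z')) `^ alpha * (C * dist (kp kap z) (kp kap z')).
Proof.
have [s0 s1] := (s_gt0 K, s_lt1 K); have sh := s_ge_half K.
have [A A1 hA] := koch_tame; have [B B1 hB] := koch_separation K; have [V V1 hV] := koch_near_curve.
have [E E1 hE] := koch_colip_depth.
pose G := 32 * Q.
have G0 : 0 <= G by rewrite mulr_ge0// invr_ge0 ltW// (k2_lt1 K).
have p0 : 0 <= 2 `^ alpha :> R by exact: powR_ge0.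
pose C := E + A * 2 `^ alpha + G * (1 + 2 * V * B).
have VB : 0 <= V * B by rewrite mulr_ge0//; lra.
have Ap : 0 <= A * 2 `^ alpha by rewrite mulr_ge0//; lra.
have GV : 0 <= G * (1 + 2 * V * B) by rewrite mulr_ge0//; lra.
exists C => [|kap z z' h st st']; first by rewrite /C; lra.
set D := dist _ _; have D0 : 0 <= D by exact: euclidean_dist_ge0.
have CD (x : R) : x <= C -> x * D <= C * D by move=> xC; rewrite ler_wpM2r.
split; first by apply: le_trans (hE _ _ _ h st st') (CD _ _); rewrite /C; lra.
have C0 : 0 <= C by rewrite /C; lra.
have CD0 : 0 <= C * D by rewrite mulr_ge0.
have [deep|/existsNP[N shallow]] := pselect (forall N, exists m,
    [/\ instrip m, between (kp kap z) (kp kap z') (kp kap m) & `|m.2| <= s ^+ N]).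
  have far (y : R * R) : instrip y -> (forall m, between (kp kap z) (kp kap z') m -> dist (kp kap y) m <= D) ->
      `|y.2| <= B * D.
    move=> sy dy; apply: (@le_geometric _ s _ _ (B * V)) => [||N]; [exact: ltW|by []|].
    have [m [sm bm mN]] := deep N; have /andP[m01 _] := sm.
    have V0 : dist (kp kap m) (curve m.1) <= V * s ^+ N.
      by apply: le_trans (hV _ _ _ h sm) _; rewrite ler_wpM2l//; lra.
    apply: le_trans (hB _ _ _ _ h sy m01) _; rewrite -mulrA -mulrDr; apply: ler_wpM2l; first lra.
    by apply: le_trans (euclidean_dist_triangle _ (kp kap m) _) _; apply: lerD => //; exact: dy.
  have f1 : `|z.2| <= B * D.
    by apply: far => // m; apply: le_trans; rewrite lerDl euclidean_dist_ge0.
  have f2 : `|z'.2| <= B * D.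
    by apply: far => // m; apply: le_trans; rewrite euclidean_distC lerDr euclidean_dist_ge0.
  have /andP[z01 _] := st; have /andP[z01' _] := st'.
  have near (y : R * R) : instrip y -> `|y.2| <= B * D -> dist (kp kap y) (curve y.1) <= V * (B * D).
    by move=> sy yB; apply: le_trans (hV _ _ _ h sy) _; rewrite ler_wpM2l//; lra.
  have cD : dist (curve z.1) (curve z'.1) <= (1 + 2 * V * B) * D.
    have := euclidean_dist_triangle (curve z.1) (kp kap z) (curve z'.1).
    have := euclidean_dist_triangle (kp kap z) (kp kap z') (curve z'.1).
    have := near _ st' f2; have := near _ st f1; rewrite [X in X <= _ -> _]euclidean_distC -/D; lra.
  apply: le_trans (curve_colip K alpha0 s_alpha z01 z01') _.
  have X0 : 0 <= G * dist (curve z.1) (curve z'.1) by rewrite mulr_ge0// euclidean_dist_ge0.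
  rewrite -/G powR_succ// mulrC.
  have X : G * dist (curve z.1) (curve z'.1) <= C * D.
    apply: (@le_trans _ _ (G * (1 + 2 * V * B) * D)); first by rewrite -mulrA ler_wpM2l.
    by apply: CD; rewrite /C; lra.
  apply: ler_pM; [exact: powR_ge0|exact: X0| |exact: X].
  apply: powR_le => //.
  by apply: le_trans X _; rewrite lerDr.
have tameP n : (n = 0%N \/ `|z.2| + E * D < s ^+ n) -> `|z.1 - z'.1| <= A * (2 * s)^-1 ^+ n * D.
  move=> hn; have [[_ //]|[m [sm bm]]] := hA N n kap z z' h st st'.
  case=> [mN|[n0 mn]]; first by case: shallow; exists m.
  case: hn => [n00|hn]; first by rewrite n00 in n0.
  have : `|z.2 - m.2| <= E * D.
    apply: le_trans (hE _ _ _ h st sm) _; rewrite ler_wpM2l//; first lra.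
    by apply: le_trans bm; rewrite lerDl euclidean_dist_ge0.
  have := ler_normB z.2 (z.2 - m.2); rewrite subKr; lra.
have ED : 0 <= E * D by rewrite mulr_ge0//; lra.
have fin (x : R) : 0 <= x -> x <= 2 * (`|z.2| + C * D) -> A * x `^ alpha * D <= (`|z.2| + C * D) `^ alpha * (C * D).
  move=> x0 xh; apply: (@le_trans _ _ (A * (2 `^ alpha * (`|z.2| + C * D) `^ alpha) * D)).
    rewrite ler_wpM2r// ler_wpM2l//; first lra.
    by rewrite -powRM ?addr_ge0//; apply: powR_le.
  have -> : A * (2 `^ alpha * (`|z.2| + C * D) `^ alpha) * D = (`|z.2| + C * D) `^ alpha * (A * 2 `^ alpha * D) by ring.
  apply: ler_wpM2l; first exact: powR_ge0.
  by apply: CD; rewrite /C; lra.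
have CE : E * D <= C * D by apply: CD; rewrite /C; lra.
have [h1|h1] := leP 1 (`|z.2| + E * D).
  apply: le_trans (tameP 0%N (or_introl erefl)) _; rewrite expr0 mulr1.
  apply: le_trans (fin 1 _ _); [by rewrite powR1 mulr1|by []|]; lra.
have [h0|h0] := leP (`|z.2| + E * D) 0.
  apply: le_trans (tameP 0%N (or_introl erefl)) _; rewrite expr0 mulr1.
  have n0 := normr_ge0 z.2; have ED1 : E * D = 0 by lra.
  have -> : D = 0 by move/eqP: ED1; rewrite mulf_eq0 => /orP[/eqP|/eqP//]; lra.
  by rewrite !mulr0.
have [n n1 n2] := geometric_bracket h0 (ltW h1).
have sn0 : 0 <= s ^+ n by rewrite exprn_ge0// ltW.
have sn2 : s ^+ n <= 2 * (`|z.2| + C * D).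
  have : 1 / 2 * s ^+ n <= s ^+ n.+1 by rewrite exprS ler_wpM2r.
  lra.
move: n2; rewrite le_eqVlt => /predU1P[n2|n2].
  case: n n1 n2 sn0 sn2 => [|n] n1 n2 sn0 sn2.
    by rewrite expr0 in n2; lra.
  apply: le_trans (tameP n _) _.
    by right; rewrite n2 exprS gtr_pMl// exprn_gt0.
  rewrite -scale_powR; apply: fin; first by rewrite exprn_ge0// ltW.
  have : 1 / 2 * s ^+ n <= s ^+ n.+1 by rewrite exprS ler_wpM2r// exprn_ge0// ltW.
  lra.
by apply: le_trans (tameP n _) _; [right|rewrite -scale_powR; exact: fin].
Qed.
End LowerBound.

(** * The upper bound and density in the half box *)

Section UpperBound.
Hypothesis K : koch_ratio k s.
Implicit Types z m : R * R.

Variable alpha : R.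
Hypothesis alpha0 : 0 <= alpha.
Hypothesis s_alpha : s `^ (1 + alpha) = 1 / 2.

(** The same three legs as in the Grushin plane: out to depth |v| + L, along, and
    back. *)
Lemma koch_lip : exists2 C : R, 1 <= C & forall kap z z' L, slant kap -> instrip z -> instrip z' ->
  0 <= L -> `|z.2| + L <= 1 -> `|z.2 - z'.2| <= L -> `|z.1 - z'.1| <= (`|z.2| + L) `^ alpha * L ->
  dist (kp kap z) (kp kap z') <= C * L.
Proof.
have [s0 s1] := (s_gt0 K, s_lt1 K).
have [H H1 hH] := koch_horizontal K; have [V V1 hV] := koch_vertical K.
exists (H + 3 * V) => [|kap z z' L h st st' L0 L1 dv dt]; first lra.
move: L0; rewrite le_eqVlt => /predU1P[L0|L0].
  move: dv dt; rewrite -L0 mulr0 !normr_le0 !subr_eq0 => /eqP a /eqP b.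
  rewrite mulr0 (_ : z' = z); last by case: z z' a b {st st' L1} => [? ?] [? ?] /= -> ->.
  by rewrite /euclidean_dist !subrr expr0n/= addr0 sqrtr0.
pose h' := `|z.2| + L; pose v := if 0 <= z.2 then z.2 + L else z.2 - L.
have n0 := normr_ge0 z.2.
have vE : `|v| = h'.
  rewrite /v /h'; case: leP => a; first by rewrite !ger0_norm//; lra.
  by rewrite !ltr0_norm//; lra.
have vz : `|z.2 - v| <= L.
  by rewrite /v; case: ifP => _; rewrite ler_norml; lra.
have /andP[t01 _] := st; have /andP[t01' _] := st'.
have sv : strip z.1 v by rewrite /strip t01 vE.
have sv' : strip z'.1 v by rewrite /strip t01' vE.
have v0 : 0 < `|v| by rewrite vE /h'; lra.
have v1 : `|v| <= 1 by rewrite vE.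
have [n n1 n2] := geometric_bracket K v0 v1.
have d1 : dist (koch kap z.1 v) (koch kap z'.1 v) <= H * L.
  apply: le_trans (hH n _ _ _ _ h sv sv' n1) _.
  rewrite -mulrA ler_wpM2l//; first lra.
  have ts : 0 < (2 * s) ^+ n by rewrite exprn_gt0// mulr_gt0.
  rewrite -ler_pdivlMl//; apply: le_trans dt _; apply: ler_wpM2r; first exact: ltW.
  rewrite -exprVn -(scale_powR K alpha0 s_alpha); apply: (powR_le alpha0); first by rewrite addr_ge0// ltW.
  by rewrite -/h' -vE.
have d0 : dist (kp kap z) (koch kap z.1 v) <= V * L.
  by apply: le_trans (hV _ _ _ _ h st sv) _; rewrite ler_wpM2l//; lra.
have d2 : dist (koch kap z'.1 v) (kp kap z') <= V * (2 * L).
  apply: le_trans (hV _ _ _ _ h sv' st') _; rewrite ler_wpM2l//; first lra.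
  have := ler_distD z.2 v z'.2; rewrite [`|v - z.2|]distrC; lra.
have := euclidean_dist_triangle (kp kap z) (koch kap z.1 v) (kp kap z').
have := euclidean_dist_triangle (koch kap z.1 v) (koch kap z'.1 v) (kp kap z').
lra.
Qed.

Lemma koch_dense kap p N : slant kap -> box kap p -> exists2 z, instrip z & dist (kp kap z) p <= 3 * s ^+ N.
Proof.
have [s0 s1] := (s_gt0 K, s_lt1 K); have e0 := collar_gt0 K.
elim: N kap p => [|N IH] kap p h bp.
  exists (0, 0); first by rewrite /strip normr0 lexx ler01.
  by rewrite expr0 mulr1 (box_dist K h)//; apply: (koch_box K h); rewrite /strip normr0 lexx ler01.
have dd q : dist q q <= 3 * s ^+ N.+1.
  by rewrite /euclidean_dist !subrr expr0n/= addr0 sqrtr0 mulr_ge0// exprn_ge0// ltW.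
have s1' : 0 <= 1 - s by rewrite subr_ge0 ltW.
have depth l : 0 <= l <= 1 -> s <= s + l * (1 - s) /\ s + l * (1 - s) <= 1.
  move=> /andP[l0 l1]; split; first by rewrite lerDl mulr_ge0.
  by have := ler_wpM2r s1' l1; lra.
have depthK l : (s + l * (1 - s) - s) / (1 - s) = l.
  by rewrite addrC addKr mulfK// subr_eq0 gt_eqF.
have [a|/ltW a] := leP (k * p.1 + w) p.2.
  have [t [l [t01 l01 uE]]] := upper_surj K h bp a; have [v1 v2] := depth l l01.
  have v0 : 0 <= s + l * (1 - s) by lra.
  exists (t, s + l * (1 - s)); first by rewrite /strip/= t01 ger0_norm.
  rewrite (koch_tile K)/= ?/strip ?t01 ?ger0_norm//.
  by rewrite /tile v0 depthK uE.
have [low|mid] := pselect (p.2 <= - (e / 2) \/ p.2 <= slope_in p.1).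
  have [t [l [t01 l01 uE]]] := lower_surj K h bp low; have [v1 v2] := depth l l01.
  have v0 : 0 <= s + l * (1 - s) by lra.
  have vn : `|- (s + l * (1 - s))| = s + l * (1 - s) by rewrite normrN ger0_norm.
  exists (t, - (s + l * (1 - s))); first by rewrite /strip/= t01 vn.
  rewrite (koch_tile K)/= ?/strip ?t01 ?vn//.
  have vf : (0 <= - (s + l * (1 - s))) = false by rewrite oppr_ge0 leNgt (lt_le_trans s0 v1).
  by rewrite /tile vf opprK depthK uE.
have [m1 m2] : - (e / 2) <= p.2 /\ slope_in p.1 <= p.2.
  by split; rewrite leNgt; apply/negP => x; apply: mid; [left|right]; exact: ltW.
have [b|/ltW b] := leP (p.1 + k * p.2) ((1 + k ^+ 2) / 4).
  have [q bq <-] := unfold0 K h bp a m1 b.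
  have [[t v] /= st dq] := IH _ _ (slant_flip K h) bq; have [st2 E] := koch_lift0 K h st.
  by exists (t / 2, - (s * v)) => //=; rewrite E (fold0_dist K) exprS mulrCA ler_pM2l.
have [q bq <-] := unfold1 K h bp a m2 b.
have [[t v] /= st dq] := IH _ _ (slant_k K) bq; have [st2 E] := koch_lift1 K h st.
by exists (1 - t / 2, - (s * v)) => //=; rewrite E (fold1_dist K) exprS mulrCA ler_pM2l.
Qed.

End UpperBound.

(** * Blowing up to the plane *)

Section Plane.
Hypothesis K : koch_ratio k s.
Implicit Types z m : R * R.

Variable alpha : R.
Hypothesis alpha0 : 0 <= alpha.
Hypothesis s_alpha : s `^ (1 + alpha) = 1 / 2.

(** The map of the coordinates (t, v) that [fold1] induces, with fixed point
    (2/3, 0); its iterates bring every point into the strip. *)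
Definition zoom z : R * R := (1 - z.1 / 2, - (s * z.2)).
Definition unzoom z : R * R := (2 - 2 * z.1, - z.2 / s).
Definition unfold p : R * R :=
  (1 - 2 * (p.1 + k * p.2) / (1 + k ^+ 2), 2 * (k * p.1 - p.2) / (1 + k ^+ 2)).
Definition anchor : R * R := ((3 + k ^+ 2) / (9 + k ^+ 2), 2 * k / (9 + k ^+ 2)).

Let k2p : 1 + k ^+ 2 != 0. Proof. by rewrite gt_eqF// ltr_wpDr// sqr_ge0. Qed.

Lemma fold1K : cancel fold1 unfold.
Proof. by move=> [x y]; rewrite /unfold /fold1 /fold0/=; congr pair; field. Qed.

Lemma unfoldK : cancel unfold fold1.
Proof. by move=> [x y]; rewrite /unfold /fold1 /fold0/=; congr pair; field. Qed.

Lemma unzoomK : cancel unzoom zoom.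
Proof.
have s0 := lt0r_neq0 (s_gt0 K).
by move=> [x y]; rewrite /zoom /unzoom/=; congr pair; field.
Qed.

Lemma iter_fold1_dist n p q : dist (iter n fold1 p) (iter n fold1 q) = s ^+ n * dist p q.
Proof. by elim: n => [|n IH]; rewrite ?expr0 ?mul1r//= (fold1_dist K) IH exprS mulrA. Qed.

Lemma iter_unfoldK n : cancel (iter n unfold) (iter n fold1).
Proof. by elim: n => // n IH p; rewrite iterSr iterS unfoldK IH. Qed.

Lemma iter_fold1K n : cancel (iter n fold1) (iter n unfold).
Proof. by elim: n => // n IH p; rewrite iterSr iterS fold1K IH. Qed.

Lemma iter_unzoomK n : cancel (iter n unzoom) (iter n zoom).
Proof. by elim: n => // n IH p; rewrite iterSr iterS unzoomK IH. Qed.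

Lemma iter_zoom2 n z z' : `|(iter n zoom z).2 - (iter n zoom z').2| = s ^+ n * `|z.2 - z'.2|.
Proof.
elim: n => [|n IH]; first by rewrite expr0 mul1r.
rewrite exprS -mulrA -IH /=; set a := (iter n zoom z).2; set b := (iter n zoom z').2.
have -> : - (s * a) - - (s * b) = - (s * (a - b)) by ring.
by rewrite normrN normrM gtr0_norm// (s_gt0 K).
Qed.

Lemma iter_zoom1 n z z' : `|(iter n zoom z).1 - (iter n zoom z').1| = (1 / 2) ^+ n * `|z.1 - z'.1|.
Proof.
elim: n => [|n IH]; first by rewrite expr0 mul1r.
rewrite exprS -mulrA -IH /=; set a := (iter n zoom z).1; set b := (iter n zoom z').1.
have -> : 1 - a / 2 - (1 - b / 2) = - (1 / 2 * (a - b)) by field.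
by rewrite normrN normrM ger0_norm// divr_ge0.
Qed.

Let center : R * R := (2 / 3, 0).

Lemma iter_zoom_center n : iter n zoom center = center.
Proof.
elim: n => //= n ->; rewrite /zoom /center/= mulr0 oppr0; congr pair.
by field.
Qed.

Lemma iter_zoom_depth n z : `|(iter n zoom z).2| = s ^+ n * `|z.2|.
Proof. by have := iter_zoom2 n z center; rewrite iter_zoom_center /= !subr0. Qed.

Lemma vanishing M eps : 0 < eps -> exists n, s ^+ n * M <= eps.
Proof.
move=> e0; apply/not_existsP => no; have : eps <= 0; last by rewrite leNgt e0.
apply: (@le_geometric _ s _ _ M) => [||n]; [exact: ltW (s_gt0 K)|exact: s_lt1 K|].
by have /negP := no n; rewrite -ltNge => /ltW; rewrite add0r mulrC.
Qed.

Lemma zoom_strip n z M : `|z.1 - 2 / 3| + `|z.2| <= M -> s ^+ n * M <= 1 / 3 -> instrip (iter n zoom z).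
Proof.
move=> zM nM; have [sn0 sh] : 0 <= s ^+ n /\ 1 / 2 <= s.
  by split; [rewrite exprn_ge0// ltW// (s_gt0 K)|exact: s_ge_half K].
have a := normr_ge0 (z.1 - 2 / 3); have b := normr_ge0 z.2.
have d1 := iter_zoom1 n z center; rewrite iter_zoom_center /= in d1.
have hs : (1 / 2) ^+ n * `|z.1 - 2 / 3| <= s ^+ n * `|z.1 - 2 / 3|.
  by rewrite ler_wpM2r// lerXn2r// nnegrE; lra.
have : s ^+ n * (`|z.1 - 2 / 3| + `|z.2|) <= s ^+ n * M by rewrite ler_wpM2l.
have c : 0 <= s ^+ n * `|z.2| by rewrite mulr_ge0.
have c' : 0 <= s ^+ n * `|z.1 - 2 / 3| by rewrite mulr_ge0.
move=> H; rewrite /strip iter_zoom_depth; apply/andP; split; last lra.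
have : `|(iter n zoom z).1 - 2 / 3| <= 1 / 3 by rewrite d1; lra.
rewrite ler_norml; lra.
Qed.

(** By [koch_zoom] the value is the same for all n such that the n-th iterate is in
    the strip. *)
Definition plane z : R * R :=
  let n := xget 0%N [set n | instrip (iter n zoom z)] in
  iter n unfold (kp k (iter n zoom z)).

Lemma koch_zoom z : instrip z -> instrip (zoom z) /\ kp k (zoom z) = fold1 (kp k z).
Proof. by move=> st; rewrite /zoom/=; exact: (koch_lift1 K (slant_k K) st). Qed.

Lemma planeE n z : instrip (iter n zoom z) -> iter n fold1 (plane z) = kp k (iter n zoom z).
Proof.
rewrite /plane; set N := xget _ _ => st.
have stN : instrip (iter N zoom z) by apply: (@xgetPex _ 0%N [set n | instrip (iter n zoom z)]); exists n.
have step (m d : nat) : instrip (iter m zoom z) ->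
    instrip (iter (d + m) zoom z) /\ kp k (iter (d + m) zoom z) = iter d fold1 (kp k (iter m zoom z)).
  move=> sm; elim: d => // d [IH1 IH2]; rewrite addSn iterS; have [st1 E] := koch_zoom IH1.
  by split; rewrite // E IH2.
have [/subnK nN|/ltnW/subnK nN] := leqP N n.
  have [_] := step N (n - N)%N stN; rewrite nN => ->.
  by rewrite -{1}nN iterD iter_unfoldK.
have [_] := step n (N - n)%N st; rewrite nN => ->.
by rewrite -{1}nN addnC iterD iter_fold1K iter_unfoldK.
Qed.

Lemma common_scale z z' M : 0 <= M -> exists n,
  [/\ instrip (iter n zoom z), instrip (iter n zoom z') & s ^+ n * (`|z.2| + M) <= 1].
Proof.
move=> M0; have [s0 _] := (s_gt0 K, s_lt1 K).
have n1 := normr_ge0 (z.1 - 2 / 3); have n2 := normr_ge0 z.2.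
have n3 := normr_ge0 (z'.1 - 2 / 3); have n4 := normr_ge0 z'.2.
pose N := `|z.1 - 2 / 3| + `|z.2| + (`|z'.1 - 2 / 3| + `|z'.2|) + M.
have [|n nN] := @vanishing N (1 / 3); first by lra.
exists n; split; [apply: zoom_strip nN; rewrite /N; lra..|].
apply: (@le_trans _ _ (s ^+ n * N)); last by lra.
by rewrite ler_pM2l ?exprn_gt0// /N; lra.
Qed.

Lemma plane_lip : exists2 C : R, 1 <= C & forall z z' L, 0 <= L -> `|z.2 - z'.2| <= L ->
  `|z.1 - z'.1| <= (`|z.2| + L) `^ alpha * L -> dist (plane z) (plane z') <= C * L.
Proof.
have [s0 s1] := (s_gt0 K, s_lt1 K).
have [C C1 hC] := koch_lip K alpha0 s_alpha; exists C => // z z' L L0 d2 d1.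
have [n [st st' nM]] := common_scale z z' L0.
have sn : 0 < s ^+ n by rewrite exprn_gt0.
rewrite -(ler_pM2l sn) -iter_fold1_dist (planeE st) (planeE st') mulrCA.
apply: (hC k _ _ _ (slant_k K) st st');
  rewrite ?iter_zoom_depth ?iter_zoom1 ?iter_zoom2 -?mulrDr; [by rewrite mulr_ge0// ltW|exact: nM|by rewrite ler_pM2l|].
rewrite powRM ?addr_ge0 ?(ltW sn)// (scale_powR K alpha0 s_alpha).
have -> : (2 * s)^-1 ^+ n * (`|z.2| + L) `^ alpha * (s ^+ n * L) = (1 / 2) ^+ n * ((`|z.2| + L) `^ alpha * L).
  have -> : (1 / 2) ^+ n = (2 * s)^-1 ^+ n * s ^+ n.
    by rewrite -exprMn; congr (_ ^+ n); field; exact: lt0r_neq0.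
  by ring.
by rewrite ler_wpM2l// exprn_ge0.
Qed.

Lemma plane_colip : exists2 C : R, 1 <= C & forall z z',
  `|z.2 - z'.2| <= C * dist (plane z) (plane z') /\
  `|z.1 - z'.1| <= (`|z.2| + C * dist (plane z) (plane z')) `^ alpha * (C * dist (plane z) (plane z')).
Proof.
have [s0 s1] := (s_gt0 K, s_lt1 K).
have [C C1 hC] := koch_colip K alpha0 s_alpha; exists C => // z z'.
have [n [st st' _]] := common_scale z z' (lexx 0).
have sn : 0 < s ^+ n by rewrite exprn_gt0.
have := hC k _ _ (slant_k K) st st'.
rewrite -(planeE st) -(planeE st') iter_fold1_dist iter_zoom_depth iter_zoom1 iter_zoom2.
rewrite mulrCA -mulrDr (ler_pM2l sn); set D := C * _ => -[-> h]; split => //.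
have CD : 0 <= D by rewrite mulr_ge0 ?euclidean_dist_ge0//; lra.
move: h; rewrite powRM ?addr_ge0 ?(ltW sn)// (scale_powR K alpha0 s_alpha).
have -> : (2 * s)^-1 ^+ n * (`|z.2| + D) `^ alpha * (s ^+ n * D) = (1 / 2) ^+ n * ((`|z.2| + D) `^ alpha * D).
  have -> : (1 / 2) ^+ n = (2 * s)^-1 ^+ n * s ^+ n.
    by rewrite -exprMn; congr (_ ^+ n); field; exact: lt0r_neq0.
  by ring.
by rewrite ler_pM2l// exprn_gt0.
Qed.

Lemma anchor_fixed : fold1 anchor = anchor.
Proof.
have k9 : 9 + k ^+ 2 != 0 by rewrite gt_eqF// ltr_wpDr// sqr_ge0.
by rewrite /anchor /fold1 /fold0/=; congr pair; field.
Qed.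

(** The fixed point of [fold1] is interior to the box: this is why the iterates of
    [unfold] spread the box over the whole plane. *)
Lemma anchor_interior p : dist p anchor <= e / 2 -> box k p.
Proof.
move=> d; have := le_trans (dist1_le _ _) d; have := le_trans (dist2_le _ _) d.
have k9 : 0 < 9 + k ^+ 2 by rewrite ltr_wpDr// sqr_ge0.
have q0 := k2_lt1 K; have k0 := k_ge0 K; have k1 := k_lt1 K; have e0 := collar_gt0 K; have e1 := collar_le.
rewrite /anchor/= !ler_norml.
have a1 : 1 / 5 + k ^+ 2 / 5 <= (3 + k ^+ 2) / (9 + k ^+ 2) by rewrite ler_pdivlMr//; nra.
have a2 : (3 + k ^+ 2) / (9 + k ^+ 2) <= 2 / 5 by rewrite ler_pdivrMr//; nra.
have a3 : 0 <= 2 * k / (9 + k ^+ 2) by rewrite divr_ge0 ?mulr_ge0// ltW.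
have a4 : 2 * k / (9 + k ^+ 2) <= k * ((3 + k ^+ 2) / (9 + k ^+ 2)).
  by rewrite mulrA ler_pM2r ?invr_gt0//; nra.
have a5 : 2 * k / (9 + k ^+ 2) <= 1 / 4 * k by rewrite ler_pdivrMr//; nra.
move: a1 a2 a3 a4 a5; set x := (3 + k ^+ 2) / _; set y := 2 * k / _ => a1 a2 a3 a4 a5 /andP[y1 y2] /andP[x1 x2].
have k2 := sqr_ge0 k.
have u0 : k * (e / 2) <= 1 * (e / 2) by rewrite ler_wpM2r//; lra.
have u1 : k * (x - p.1) <= k * (e / 2) by rewrite ler_wpM2l//; lra.
have u2 : k * (p.2 - y) <= k * (e / 2) by rewrite ler_wpM2l//; lra.
have u3 : k * y <= k * (1 / 4 * k) by rewrite ler_wpM2l.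
split; lra.
Qed.

Lemma plane_dense p : exists C : R, forall N, exists z, dist (plane z) p <= C * s ^+ N.
Proof.
have [s0 s1] := (s_gt0 K, s_lt1 K); have e0 := collar_gt0 K.
have [|n hn] := @vanishing (dist p anchor) (e / 2); first by rewrite divr_gt0.
have sn : 0 < s ^+ n by rewrite exprn_gt0.
have bp : box k (iter n fold1 p).
  apply: anchor_interior; have <- : iter n fold1 anchor = anchor.
    by elim: (n) => //= m ->; exact: anchor_fixed.
  by rewrite iter_fold1_dist.
exists (3 / s ^+ n) => N; have [z st dz] := koch_dense K N (slant_k K) bp.
have stz : instrip (iter n zoom (iter n unzoom z)) by rewrite iter_unzoomK.
exists (iter n unzoom z); rewrite -(ler_pM2l sn) -iter_fold1_dist planeE// iter_unzoomK.
by apply: le_trans dz _; rewrite le_eqVlt; apply/orP; left; apply/eqP; field; rewrite gt_eqF.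
Qed.

(** Preimages of approximations of p form a Cauchy sequence by the lower bound, and
    the upper bound gives the value at its limit. *)
Lemma plane_surj p : exists z, plane z = p.
Proof.
have [s0 s1] := (s_gt0 K, s_lt1 K).
have [B hB] := plane_dense p; have [z_ hz] := choice hB.
have [C C1 hC] := plane_colip; have [A A1 hA] := plane_lip.
have B0 : 0 <= B by have := le_trans (euclidean_dist_ge0 _ _) (hz 0%N); rewrite expr0 mulr1.
have dd (n m : nat) : dist (plane (z_ (n + m)%N)) (plane (z_ n)) <= 2 * B * s ^+ n.
  apply: le_trans (euclidean_dist_triangle _ p _) _; rewrite [dist p _]euclidean_distC.
  have : B * s ^+ (n + m) <= B * s ^+ n.
    by rewrite ler_wpM2l// exprD ler_piMr ?exprn_ge0 ?(ltW s0)// exprn_ile1// ltW.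
  have := hz n; have := hz (n + m)%N; lra.
have CB : 0 <= C * (2 * B) by rewrite !mulr_ge0//; lra.
have c2 (n m : nat) : `|(z_ (n + m)%N).2 - (z_ n).2| <= C * (2 * B) * s ^+ n.
  have [h _] := hC (z_ (n + m)%N) (z_ n); apply: le_trans h _; rewrite -mulrA ler_wpM2l//; lra.
pose W := `|(z_ 0%N).2| + 2 * (C * (2 * B)).
have W2 n : `|(z_ n).2| + C * (2 * B) <= W.
  have := c2 0%N n; rewrite add0n expr0 mulr1 /W => h.
  have := ler_normD ((z_ n).2 - (z_ 0%N).2) (z_ 0%N).2; rewrite subrK; lra.
have c1 (n m : nat) : `|(z_ (n + m)%N).1 - (z_ n).1| <= W `^ alpha * (C * (2 * B)) * s ^+ n.
  have [_ h] := hC (z_ (n + m)%N) (z_ n); apply: le_trans h _; set D := dist _ _.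
  have D0 : 0 <= D by exact: euclidean_dist_ge0.
  have CD : C * D <= C * (2 * B) * s ^+ n by rewrite -mulrA ler_wpM2l; [lra..|exact: dd].
  have sn1 : s ^+ n <= 1 by rewrite exprn_ile1// ltW.
  have CD0 : 0 <= C * D by rewrite mulr_ge0//; lra.
  rewrite -[leRHS]mulrA; apply: ler_pM => //; first exact: powR_ge0.
  apply: (powR_le alpha0); first by rewrite addr_ge0.
  have := W2 (n + m)%N; have : C * (2 * B) * s ^+ n <= C * (2 * B) * 1 by rewrite ler_wpM2l.
  lra.
have l2 := geometric_limitP c2; have l1 := geometric_limitP c1.
set v := geometric_limit _ _ _ in l2; set t := geometric_limit _ _ _ in l1.
exists (t, v); apply: euclidean_dist_eq0.
have A0 : 0 <= A by lra.
apply/ler_addgt0Pr => eps eps0; rewrite add0r.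
pose L := eps / (A + 1); have A10 : 0 < A + 1 by lra.
have L0 : 0 < L by rewrite divr_gt0.
have LE : (A + 1) * L = eps by rewrite /L mulrC divfK// gt_eqF.
have La : 0 < L `^ alpha * L by rewrite mulr_gt0// powR_gt0.
have [n1 h1] := vanishing (C * (2 * B)) L0.
have [n2 h2] := vanishing (W `^ alpha * (C * (2 * B))) La.
have [n3 h3] := vanishing B L0.
have [n [nn1 nn2 nn3]] : exists n, [/\ (n1 <= n)%N, (n2 <= n)%N & (n3 <= n)%N].
  by exists (n1 + n2 + n3)%N; split; rewrite ?leq_addl// -addnA ?leq_addr// addnCA leq_addr.
have mono x y (m : nat) : 0 <= x -> s ^+ m * x <= y -> (m <= n)%N -> x * s ^+ n <= y.
  move=> x0 h mn; apply: le_trans h; rewrite mulrC ler_wpM2r//.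
  by rewrite ler_wiXn2l// ltW.
have WW : 0 <= W `^ alpha * (C * (2 * B)) by rewrite mulr_ge0// powR_ge0.
have a2 : `|v - (z_ n).2| <= L by exact: le_trans (l2 n) (mono _ _ _ CB h1 nn1).
have a1 : `|t - (z_ n).1| <= L `^ alpha * L.
  exact: le_trans (l1 n) (mono _ _ _ WW h2 nn2).
have a3 : dist (plane (z_ n)) p <= L.
  exact: le_trans (hz n) (mono _ _ _ B0 h3 nn3).
have := hA (t, v) (z_ n) L (ltW L0) a2 => /= h.
apply: le_trans (euclidean_dist_triangle _ (plane (z_ n)) _) _.
rewrite -LE mulrDl mul1r; apply: lerD => //; apply: h.
apply: le_trans a1 _; rewrite ler_wpM2r ?(ltW L0)//.
by apply: (powR_le alpha0); [exact: ltW|rewrite lerDr].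
Qed.
End Plane.

End Koch.

(** * The theorem *)

(** Here alpha < 1 is used: it gives s^2 < 1/2, hence k < 1. *)
Lemma koch_ratio_exists (R : realType) (alpha : R) : 0 <= alpha < 1 ->
  exists k s : R, koch_ratio k s /\ s `^ (1 + alpha) = 1 / 2.
Proof.
move=> /andP[a0 a1]; have b0 : 0 < 1 + alpha by rewrite ltr_wpDr.
have ln2 : 0 < ln 2 :> R by rewrite ln_gt0// ltr1n.
have half : expR (- ln 2) = 1 / 2 :> R by rewrite expRN lnK ?posrE// div1r.
pose s : R := expR (- (ln 2 / (1 + alpha))).
have s0 : 0 < s by exact: expR_gt0.
have s2 : s ^+ 2 < 1 / 2.
  rewrite expr2 /s -expRD -half ltr_expR -opprD ltrN2.
  by rewrite -mulrDl ltr_pdivlMr//; nra.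
have s1 : 1 / 2 <= s.
  by rewrite -half ler_expR lerN2 ler_pdivrMr//; nra.
have q0 : 0 <= 4 * s ^+ 2 - 1 by nra.
exists (Num.sqrt (4 * s ^+ 2 - 1)), s; split; last first.
  by rewrite /powR gt_eqF// expRK -half; congr expR; field; rewrite gt_eqF.
split => //.
- by rewrite -[ltRHS]sqrtr1 ltr_sqrt//; lra.
- by rewrite sqr_sqrtr//; ring.
Qed.

Theorem corollary1p2 (R : realType) (alpha : R) (halpha : 0 <= alpha < 1) :
  bilipschitz_homeomorphic (@grushin_dist R alpha)
    (fun p q : R * R => (euclidean_dist p q)%:E).
Proof.
have [k [s [K s_alpha]]] := koch_ratio_exists halpha.
have /andP[alpha0 _] := halpha.
have [A A1 hA] := plane_lip K alpha0 s_alpha.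
have [C C1 hC] := plane_colip K alpha0 s_alpha.
pose swap (p : R * R) := (p.2, p.1).
exists (fun p => plane k s (swap p)); split; last first.
  move=> p _; have [z zp] := plane_surj K alpha0 s_alpha p.
  by exists (swap z); rewrite // /swap -zp; case: (z).
exists (A + 6 * C) => [|p q]; first lra.
set D := euclidean_dist _ _.
have D0 : 0 <= D by exact: euclidean_dist_ge0.
have L0 : 0 < A + 6 * C by lra.
rewrite (lee_pdivrMl _ _ L0); split.
  apply: (@le_trans _ _ (6 * (C * D))%:E); last by rewrite -EFinM lee_fin; nra.
  (* the length is enlarged because D may vanish, where the three legs need a
     positive one *)
  apply/lee_addgt0Pr => eps eps0; rewrite -EFinD.
  have CD : 0 <= C * D by rewrite mulr_ge0//; lra.
  have -> : 6 * (C * D) + eps = 6 * (C * D + eps / 6) by field.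
  have adm : admissible alpha p q (C * D) := hC (swap p) (swap q).
  apply: admissible_dist => //; first by lra.
  by apply: admissible_mono adm => //; lra.
rewrite -(lee_pdivrMl _ _ L0); apply: le_ereal_inf_tmp => _ [g [ac g0 g1] <-].
rewrite (lee_pdivrMl _ _ L0).
have len0 : (0 <= grushin_length alpha g)%E by apply: integral_ge0 => t _; exact: sqrte_ge0.
case E : (grushin_length alpha g) len0 => [r| |] //; last by rewrite gt0_muley ?leey.
have Er : (grushin_length alpha g <= r%:E)%E by rewrite E.
rewrite !lee_fin => r0; have [h1 h2] := length_admissible ac alpha0 Er.
rewrite g0 g1 in h1 h2; apply: le_trans (hA (swap p) (swap q) r r0 h1 h2) _.
by rewrite ler_wpM2r//; lra.
Qed.
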